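(* Let $V$ be a vertex operator algebra, $p$ a positive integer, $\omega_p$ a primitive $p$-th root of unity, $\nu$ an automorphism of $V$ with $\nu^p=1_V$, and $M$ a $\mathbb Q$-graded $\nu$-twisted $V$-module. For $u_1,v_1,u_2,v_2\in V$, $$[X_M(Y[u_1,y_1]v_1,x_1),\,X_M(Y[u_2,y_2]v_2,x_2)]=\mathrm{Res}_y\,\frac1p\sum_{r=0}^{p-1}\Big\{$$ $$\delta\Big(\omega_p^{-r}\big(e^{y_1-y}\tfrac{x_1}{x_2}\big)^{1/p}\Big)X_M\big(Y[u_2,y_2]\,Y[\nu^{-r}v_1,-y_1+y]\,Y[\nu^{-r}u_1,y]v_2,\,x_2\big)$$ $$+\,\delta\Big(\omega_p^{-r}\big(e^{-y}\tfrac{x_1}{x_2}\big)^{1/p}\Big)X_M\big(Y[u_2,y_2]\,Y[\nu^{-r}u_1,y_1+y]\,Y[\nu^{-r}v_1,y]v_2,\,x_2\big)$$ $$+\,\delta\Big(\omega_p^{-r}\big(e^{-y_2+y_1-y}\tfrac{x_1}{x_2}\big)^{1/p}\Big)X_M\big(Y\big[Y[\nu^{-r}v_1,-y_1]\,Y[u_2,-y]\nu^{-r}u_1,\,y_2+y\big]v_2,\,x_2\big)$$ $$+\,\delta\Big(\omega_p^{-r}\big(e^{-y_2-y}\tfrac{x_1}{x_2}\big)^{1/p}\Big)X_M\big(Y\big[Y[\nu^{-r}u_1,y_1]\,Y[u_2,-y]\nu^{-r}v_1,\,y_2+y\big]v_2,\,x_2\big)\Big\}.$$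
   Context: Vector spaces are over $\mathbb C$; $x,x_0,x_1,x_2,y,y_1,y_2$ are commuting formal variables; $\delta(x)=\sum_{n\in\mathbb Z}x^n$; $\mathrm{Res}_y$ is the coefficient of $y^{-1}$. The symbol $x^{1/p}$ is a formal variable whose $p$-th power is $x$. Binomial expansion convention: a (possibly fractional) power of a binomial, such as $(y_1+y)^n$ or $(-y_1+y)^n$, is expanded in nonnegative integral powers of the second variable. Exponentials are the usual power series and $(e^{a}x_1/x_2)^{1/p}=e^{a/p}x_1^{1/p}x_2^{-1/p}$. A vertex operator algebra $(V,Y,\mathbf 1,\omega)$ is a $\mathbb Z$-graded space $V=\coprod_n V_{(n)}$ with $V_{(n)}=0$ for $n$ sufficiently negative and $\dim V_{(n)}<\infty$, with a linear map $v\mapsto Y(v,x)=\sum_{n\in\mathbb Z}v_nx^{-n-1}\in(\mathrm{End}\,V)[[x,x^{-1}]]$ and vectors $\mathbf 1,\omega\in V$ such that: for $v,w\in V$, $v_nw=0$ for $n$ large; $Y(\mathbf 1,x)=1_V$; $Y(v,x)\mathbf 1\in V[[x]]$ with constant term $v$; writing $Y(\omega,x)=\sum_n L(n)x^{-n-2}$, $[L(m),L(n)]=(m-n)L(m+n)+c_V\frac{m^3-m}{12}\delta_{m+n,0}1_V$ for some $c_V\in\mathbb C$, $L(0)v=nv$ for $v\in V_{(n)}$, $Y(L(-1)u,x)=\frac{d}{dx}Y(u,x)$; and the Jacobi identity $x_0^{-1}\delta\big(\frac{x_1-x_2}{x_0}\big)Y(u,x_1)Y(v,x_2)-x_0^{-1}\delta\big(\frac{x_2-x_1}{-x_0}\big)Y(v,x_2)Y(u,x_1)=x_2^{-1}\delta\big(\frac{x_1-x_0}{x_2}\big)Y(Y(u,x_0)v,x_2)$.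 An automorphism $\nu$ of $V$ is a linear automorphism fixing $\omega$ and $\mathbf 1$ with $\nu Y(v,x)\nu^{-1}=Y(\nu v,x)$ for $v\in V$. A ($\mathbb Q$-graded) $\nu$-twisted $V$-module is a $\mathbb Q$-graded space $M=\coprod_{n\in\mathbb Q}M_{(n)}$ with $M_{(n)}=0$ for $n$ sufficiently negative and $\dim M_{(n)}<\infty$, with a linear map $v\mapsto Y_M(v,x)=\sum_{n\in\frac1p\mathbb Z}v_n^\nu x^{-n-1}\in(\mathrm{End}\,M)[[x^{1/p},x^{-1/p}]]$ such that: for $v\in V$, $w\in M$, $v_n^\nu w=0$ for $n$ large; $Y_M(\mathbf 1,x)=1_M$; $Y_M(\omega,x)=\sum_{n\in\mathbb Z}L_M(n)x^{-n-2}$ with $[L_M(m),L_M(n)]=(m-n)L_M(m+n)+c_V\frac{m^3-m}{12}\delta_{m+n,0}1_M$, $L_M(0)w=nw$ for $w\in M_{(n)}$, $Y_M(L(-1)u,x)=\frac{d}{dx}Y_M(u,x)$; and the twisted Jacobi identity $x_0^{-1}\delta\big(\frac{x_1-x_2}{x_0}\big)Y_M(u,x_1)Y_M(v,x_2)-x_0^{-1}\delta\big(\frac{x_2-x_1}{-x_0}\big)Y_M(v,x_2)Y_M(u,x_1)=\frac1px_2^{-1}\sum_{r=0}^{p-1}\delta\Big(\omega_p^r\big(\frac{x_1-x_0}{x_2}\big)^{1/p}\Big)Y_M(Y(\nu^ru,x_0)v,x_2)$. Homogeneous twisted vertex operators: $X_M(u,x)=Y_M(x^{L(0)}u,x)$,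 where $x^{L(0)}u=x^nu$ for $u\in V_{(n)}$, extended linearly (and coefficientwise to formal series with coefficients in $V$). Zhu's operators: $Y[u,y]=Y(e^{yL(0)}u,e^y-1)$, where negative powers of $e^y-1\in y\mathbb C[[y]]$ are taken in $\mathbb C((y))$. *)

(* Defs.v *)
From HB Require Import structures.
From mathcomp Require Import all_boot all_order all_algebra.
From mathcomp Require Import all_classical.
From mathcomp Require Import reals complex.

Set Implicit Arguments.
Unset Strict Implicit.
Unset Printing Implicit Defensive.

Import Order.TTheory GRing.Theory Num.Theory.

Local Open Scope classical_set_scope.
Local Open Scope ring_scope.

(* A formal series in the six variables x0, x1, x2, y, y1, y2 is the family of
   its coefficients, indexed by the exponent vectors.  Exponents are rational,
   so that x ^ (1/p) is the monomial of exponent 1/p in x; no condition is put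
   on the support. *)
Notation expo := 'rV[rat]_6.
Notation fser W := (expo -> W).

Definition vx0 : 'I_6 := @Ordinal 6 0 isT.
Definition vx1 : 'I_6 := @Ordinal 6 1 isT.
Definition vx2 : 'I_6 := @Ordinal 6 2 isT.
Definition vy  : 'I_6 := @Ordinal 6 3 isT.
Definition vy1 : 'I_6 := @Ordinal 6 4 isT.
Definition vy2 : 'I_6 := @Ordinal 6 5 isT.

(* [\sum_(k \in A) F k] is the sum of the nonzero terms when there are finitely
   many of them, and 0 otherwise.  Every infinite sum below is taken
   coefficientwise, and only families that have finitely many nonzero
   contributions to each coefficient are summed in the formulas that follow. *)
Definition fsum (W : zmodType) (K : choiceType) (F : K -> fser W) : fser W :=
  fun e => \sum_(k \in [set: K]) F k e.

Definition fprod2 (A B : Type) (W : zmodType) (f : A -> B -> W)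
    (s : fser A) (t : fser B) : fser W :=
  fun e => \sum_(d \in [set: expo]) f (s d) (t (e - d)).

Definition fconst (W : zmodType) (w : W) : fser W :=
  fun e => if e == 0 then w else 0.

Notation "w %:fs" := (fconst w) (at level 2, left associativity, format "w %:fs").

Definition fmapc (A B : Type) (f : A -> B) (s : fser A) : fser B :=
  fun e => f (s e).

Definition fres (W : zmodType) (i : 'I_6) (s : fser W) : fser W :=
  fun e => if e 0 i == 0 then s (e - delta_mx 0 i) else 0.

Section ScalarSeries.
Variable C : numFieldType.

Definition fscale (W : lmodType C) (a : fser C^o) (s : fser W) : fser W :=
  fprod2 (fun (c : C) (w : W) => c *: w) a s.

Definition fderiv (W : lmodType C) (i : 'I_6) (s : fser W) : fser W :=
  fun e => (ratr (e 0 i + 1) : C) *: s (e + delta_mx 0 i).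

(* x_i ^ q *)
Definition mono (i : 'I_6) (q : rat) : fser C^o :=
  fun e => (e == q *: delta_mx 0 i)%:R.

Definition fpow (a : fser C^o) (k : nat) : fser C^o :=
  iter k (fscale a) (1 : C^o)%:fs.

Definition fexp (a : fser C^o) : fser C^o :=
  fsum (fun k : nat => (k`!%:R : C)^-1 *: fpow a k).

Definition gbinom (q : rat) (k : nat) : rat :=
  (\prod_(l < k) (q - (l : nat)%:R)) / k`!%:R.

(* (x_i + c x_j) ^ q, in nonnegative integral powers of x_j *)
Definition binpow (i : 'I_6) (c : C) (j : 'I_6) (q : rat) : fser C^o :=
  fsum (fun k : nat =>
    (ratr (gbinom q k) * c ^+ k : C) *:
      fscale (mono i (q - k%:R)) (mono j k%:R)).

(* A formal expression z enters delta functions and vertex operators only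
   through its integral powers, so it is represented by the family
   n |-> z ^ n. *)
Definition powers := int -> fser C^o.

(* c z *)
Definition scalep (c : C) (z : powers) : powers := fun n => c ^ n *: z n.

(* x_i ^ (1/p) *)
Definition rootp (p : nat) (i : 'I_6) : powers :=
  fun n => mono i (n%:~R / p%:R).

Definition varp (i : 'I_6) : powers := fun n => mono i n%:~R.

(* x_i + c x_j; note that - x_i + x_j is [scalep (-1) (sump i (-1) j)] *)
Definition sump (i : 'I_6) (c : C) (j : 'I_6) : powers :=
  fun n => binpow i c j n%:~R.

(* ((x_i - x_j) / x_k) ^ (1/p) *)
Definition quotp (p : nat) (i j k : 'I_6) : powers :=
  fun n => fscale (binpow i (-1) j (n%:~R / p%:R)) (mono k (- n%:~R / p%:R)).

(* (e ^ a x1 / x2) ^ (1/p) *)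
Definition expquotp (p : nat) (a : fser C^o) : powers :=
  fun n => fscale (fexp ((n%:~R / p%:R : C) *: a))
             (fscale (mono vx1 (n%:~R / p%:R)) (mono vx2 (- n%:~R / p%:R))).

Definition delta (z : powers) : fser C^o := fsum z.

(* e ^ y - 1 and its inverse in C((y)), obtained as
   y ^ (-1) \sum_k (1 - (e ^ y - 1) / y) ^ k *)
Definition expm1 : fser C^o := fexp (mono vy 1) - (1 : C^o)%:fs.

Definition expm1V : fser C^o :=
  fscale (mono vy (-1))
    (fsum (fun k : nat => fpow ((1 : C^o)%:fs - fscale (mono vy (-1)) expm1) k)).

Definition expm1p : powers := fun n =>
  match n with Posz k => fpow expm1 k | Negz k => fpow expm1V k.+1 end.

(* If [md v k] is the coefficient v_(k/p) of x ^ (- k/p - 1) in Y(v, x), and if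
   z represents the p-th root of the argument, this is Y(s, z ^ p) t, for series
   s and t with coefficients in V and M. *)
Definition vop (V : Type) (M : lmodType C) (p : nat) (md : V -> int -> M -> M)
    (s : fser V) (z : powers) (t : fser M) : fser M :=
  fsum (fun k : int =>
    fscale (z (- k - p%:Z)) (fprod2 (fun v w => md v k w) s t)).

Definition bilin (V M : lmodType C) (md : V -> int -> M -> M) : Prop :=
  (forall k a u v w, md (a *: u + v) k w = a *: md u k w + md v k w) /\
  (forall k v a w w', md v k (a *: w + w') = a *: md v k w + md v k w').

Definition truncated (V M : lmodType C) (md : V -> int -> M -> M) : Prop :=
  forall v w, exists N : int, forall k, N <= k -> md v k w = 0.

(* A decomposition of M into a direct sum of subspaces M_(n), given by the
   projections [pr n] onto its summands; M_(n) is zero for n sufficiently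
   negative and finite-dimensional for every n. *)
Definition grading (I : realDomainType) (M : lmodType C)
    (pr : I -> {linear M -> M}) : Prop :=
  [/\ forall m n w, pr m (pr n w) = if m == n then pr n w else 0,
      forall w, finite_set [set n | pr n w != 0],
      forall w, w = \sum_(n \in [set: I]) pr n w,
      exists N : I, forall n, n < N -> forall w, pr n w = 0 &
      forall n, exists b : seq M, forall w, exists c : nat -> C,
        pr n w = \sum_(i < size b) c i *: b`_i ].

Definition virasoro (M : lmodType C) (c : C) (L : int -> M -> M) : Prop :=
  forall (m n : int) (w : M),
    L m (L n w) - L n (L m w) =
      (m - n)%:~R *: L (m + n) w +
      (if m + n == 0 then c * ((m ^+ 3 - m)%:~R / 12%:R) else 0) *: w.

End ScalarSeries.

Arguments mono {C} i q.
Arguments rootp {C} p i.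
Arguments varp {C} i.
Arguments quotp {C} p i j k.

(* An identity between series with operator coefficients is stated after
   application to an arbitrary vector. *)
Record voa (C : numFieldType) := VOA {
  voa_sort :> lmodType C;
  voa_pr : int -> {linear voa_sort -> voa_sort};
  voa_md : voa_sort -> int -> voa_sort -> voa_sort;
  vac : voa_sort;
  omega : voa_sort;
  charge : C;
  voa_grading : grading voa_pr;
  voa_bilin : bilin voa_md;
  voa_trunc : truncated voa_md;
  voa_vac : forall v (i : 'I_6),
    vop 1%N voa_md vac%:fs (varp i) v%:fs = v%:fs;
  voa_creation : forall v,
    (forall n : int, 0 <= n -> voa_md v n vac = 0) /\ voa_md v (-1) vac = v;
  (* L(n) is the coefficient of x ^ (- n - 2) in Y(omega, x). *)
  voa_virasoro : virasoro charge (fun n => voa_md omega (n + 1));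
  voa_L0 : forall n v, voa_pr n v = v -> voa_md omega 1 v = n%:~R *: v;
  voa_deriv : forall u v (i : 'I_6),
    vop 1%N voa_md (voa_md omega 0 u)%:fs (varp i) v%:fs =
    fderiv i (vop 1%N voa_md u%:fs (varp i) v%:fs);
  voa_jacobi : forall u v w,
    let Y s i t := vop 1%N voa_md s (varp i) t in
    fscale (mono vx0 (-1))
      (fscale (delta (quotp 1%N vx1 vx2 vx0)) (Y u%:fs vx1 (Y v%:fs vx2 w%:fs)))
    - fscale (mono vx0 (-1))
      (fscale (delta (scalep (-1) (quotp 1%N vx2 vx1 vx0)))
         (Y v%:fs vx2 (Y u%:fs vx1 w%:fs)))
    = fscale (mono vx2 (-1))
      (fscale (delta (quotp 1%N vx1 vx0 vx2)) (Y (Y u%:fs vx0 v%:fs) vx2 w%:fs))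
}.

Record automorphism (C : numFieldType) (V : voa C) := Automorphism {
  aut_fun :> {linear V -> V};
  aut_inv : V -> V;
  aut_funK : cancel aut_fun aut_inv;
  aut_invK : cancel aut_inv aut_fun;
  aut_vac : aut_fun (vac V) = vac V;
  aut_omega : aut_fun (omega V) = omega V;
  aut_md : forall v n w,
    aut_fun (voa_md v n (aut_inv w)) = voa_md (aut_fun v) n w
}.

(* [tw_md v k] is the operator v_(k/p) of the twisted module. *)
Record twisted_module (C : numFieldType) (V : voa C) (nu : automorphism V)
    (p : nat) (zeta : C) := TwistedModule {
  tw_sort :> lmodType C;
  tw_pr : rat -> {linear tw_sort -> tw_sort};
  tw_md : V -> int -> tw_sort -> tw_sort;
  tw_grading : grading tw_pr;
  tw_bilin : bilin tw_md;
  tw_trunc : truncated tw_md;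
  tw_vac : forall w (i : 'I_6),
    vop p tw_md (vac V)%:fs (rootp p i) w%:fs = w%:fs;
  tw_omega_int : forall k w, ~~ (p%:Z %| k)%Z -> tw_md (omega V) k w = 0;
  tw_virasoro :
    virasoro (charge V) (fun n => tw_md (omega V) (p%:Z * (n + 1)));
  tw_L0 : forall n w, tw_pr n w = w -> tw_md (omega V) p w = ratr n *: w;
  tw_deriv : forall u w (i : 'I_6),
    vop p tw_md (voa_md (omega V) 0 u)%:fs (rootp p i) w%:fs =
    fderiv i (vop p tw_md u%:fs (rootp p i) w%:fs);
  tw_jacobi : forall u v w,
    let Y s i t := vop 1%N (@voa_md C V) s (varp i) t in
    let YM s i t := vop p tw_md s (rootp p i) t in
    fscale (mono vx0 (-1))
      (fscale (delta (quotp 1%N vx1 vx2 vx0)) (YM u%:fs vx1 (YM v%:fs vx2 w%:fs)))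
    - fscale (mono vx0 (-1))
      (fscale (delta (scalep (-1) (quotp 1%N vx2 vx1 vx0)))
         (YM v%:fs vx2 (YM u%:fs vx1 w%:fs)))
    = (p%:R : C)^-1 *: fscale (mono vx2 (-1))
      (\sum_(r < p)
         fscale (delta (scalep (zeta ^+ r) (quotp p vx1 vx0 vx2)))
           (YM (Y (iter r nu u)%:fs vx0 v%:fs) vx2 w%:fs))
}.

Section HomogeneousAndZhu.
Variables (C : numFieldType) (V : voa C).

(* x_i ^ L(0) s *)
Definition xL0 (i : 'I_6) (s : fser V) : fser V :=
  fsum (fun n : int => fscale (mono i n%:~R) (fmapc (@voa_pr C V n) s)).

(* X_M(s, x_i) t *)
Definition homY (nu : automorphism V) (p : nat) (zeta : C)
    (M : twisted_module nu p zeta) (s : fser V) (i : 'I_6) (t : fser M) : fser M :=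
  vop p (@tw_md C V nu p zeta M) (xL0 i s) (rootp p i) t.

(* e ^ (y L(0)) u *)
Definition expyL0 (u : V) : fser V :=
  fsum (fun k : nat => fscale (mono vy k%:R)
    (((k`!%:R : C)^-1 *: iter k (voa_md (omega V) 1) u)%:fs)).

(* The coefficient of y ^ (- n - 1) in Y[u, y] v = Y(e ^ (y L(0)) u, e ^ y - 1) v *)
Definition zhu_md (u : V) (n : int) (v : V) : V :=
  vop 1%N (@voa_md C V) (expyL0 u) (@expm1p C) v%:fs
    ((- n - 1)%:~R *: delta_mx 0 vy).

(* Y[s, z] t *)
Definition zhuY (s : fser V) (z : powers C) (t : fser V) : fser V :=
  vop 1%N zhu_md s z t.

End HomogeneousAndZhu.

(* Main.v *)
Require Import Defs.
From HB Require Import structures.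
From mathcomp Require Import all_boot all_order all_algebra.
From mathcomp Require Import all_classical.
From mathcomp Require Import reals complex.
From mathcomp Require Import ring lra zify.

Set Implicit Arguments.
Unset Strict Implicit.
Unset Printing Implicit Defensive.

Import Order.TTheory GRing.Theory Num.Theory.
Local Open Scope ring_scope.

(* Write X_k(v) for the coefficient of x ^ (- k / p) in X_M(v, x).  Taking the residue
   in x0 of the twisted Jacobi identity and substituting x0 = x2 (e ^ y - 1) gives
     [X_k(u), X_l(v)] = 1/p sum_r omega_p ^ (r k) X_(k+l)(Res_y e ^ (t y) Y[nu ^ (-r) u, y] v),
   where t = k / p.  It remains to expand Res_y e ^ (t y) Y[Y[u, y1] v, y] Y[u', y2] v'
   in V, for u = nu ^ (-r) u1, v = nu ^ (-r) v1, u' = u2 and v' = v2.  By the commutator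
   formula for Y[., y], the operator Res_y e ^ (t y) Y[w, y] acts on Y[u', y2] v' like a
   derivation, up to the factor e ^ (t y2) on the term in which it acts on u'.  In both
   terms, the residue of the iterate Y[Y[u, y1] v, y] is a difference of two products,
   which skew-symmetry and translation covariance, with respect to L(-1) + L(0), bring
   into the required form.  All identities are proved coefficientwise, with sums
   truncated at a large N. *)

(** Series are bare coefficient functions, and a sum with infinitely many nonzero terms is 0 by
    convention, so products of series are neither associative nor distributive in general. Hence no
    formal substitution is carried out: products are evaluated at single exponent vectors where
    finitely many terms survive, and vanishing elsewhere is a matter of supports. The substitution
    [x = e ^ y - 1] lives entirely in the coefficients [zhu_ser T k] of
    [e ^ (T y) ((e ^ y - 1) / y) ^ k], whose identities transfer skew-symmetry, translation and the
    commutator formula from [Y(., x)] to [Y[., y]]. For the commutator formula, single modes of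
    [Y[u, y]] are awkward, since each mixes many modes of [Y(u, x)]; the residue against [e ^ (t y)]
    is a plain binomial sum, and as [t] is arbitrary, comparing powers of [t] recovers the single
    modes. The identity inside V is then derived for abstract modes with a translation operator [D],
    so that the weight [e ^ (t y)] and the [e ^ (y D)] of skew-symmetry merge into
    [e ^ (y (t + D))]. *)

Definition pseries (C : numFieldType) : Type := nat -> C.
HB.instance Definition _ (C : numFieldType) :=
  GRing.Zmodule.copy (pseries C) (nat -> C).

(** * Power series in one variable *)

Section PowerSeries.
Variable C : numFieldType.
Implicit Types (f g h : pseries C) (T S : C) (k l : int).

Definition ps_one : pseries C := fun n => (n == 0)%:R.
Definition ps_mul f g : pseries C := fun n => \sum_(i < n.+1) f i * g (n - i)%N.

(** A coefficient of a Cauchy product sees only finitely many coefficients of its factors, so the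
    ring laws are inherited from [{poly C}] by truncation. *)
Let trunc n f : {poly C} := \poly_(i < n) f i.

Let ps_mul_trunc n f g m : (m < n)%N -> ps_mul f g m = (trunc n f * trunc n g)`_m.
Proof.
move=> mn; rewrite coefM; apply: eq_bigr => i _.
by rewrite !coef_poly !ifT//; apply: leq_ltn_trans mn; rewrite ?leq_subr// -ltnS.
Qed.

Let trunc_mul n f g m : (m < n)%N -> (trunc n (ps_mul f g))`_m = (trunc n f * trunc n g)`_m.
Proof. by move=> mn; rewrite coef_poly mn (ps_mul_trunc _ _ mn). Qed.

Lemma ps_mulA : associative ps_mul.
Proof.
move=> f g h; apply/funext => m; rewrite !(@ps_mul_trunc m.+1)//.
transitivity ((trunc m.+1 f * (trunc m.+1 g * trunc m.+1 h))`_m).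
  rewrite [LHS]coefM [RHS]coefM; apply: eq_bigr => i _; congr (_ * _).
  by rewrite trunc_mul// ltnS leq_subr.
rewrite mulrA [LHS]coefM [RHS]coefM; apply: eq_bigr => i _; congr (_ * _).
by rewrite trunc_mul.
Qed.

Lemma ps_mulC : commutative ps_mul.
Proof. by move=> f g; apply/funext => m; rewrite !(@ps_mul_trunc m.+1)// mulrC. Qed.

Lemma ps_mul1 : left_id ps_one ps_mul.
Proof.
move=> f; apply/funext => m; rewrite /ps_mul big_ord_recl /= subn0 mul1r.
by rewrite big1 ?addr0// => i _; rewrite mul0r.
Qed.

Lemma ps_mulDl : left_distributive ps_mul +%R.
Proof.
move=> f g h; apply/funext => m; rewrite /ps_mul -[RHS]/(_ + _).
by rewrite -big_split; apply: eq_bigr => i _; rewrite mulrDl.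
Qed.

Lemma ps_one_neq0 : ps_one != 0.
Proof. by apply/eqP => /(congr1 (fun f => f 0%N))/eqP; rewrite oner_eq0. Qed.

End PowerSeries.

HB.instance Definition _ (C : numFieldType) :=
  GRing.Zmodule_isComNzRing.Build (pseries C) (@ps_mulA C) (@ps_mulC C)
    (@ps_mul1 C) (@ps_mulDl C) (@ps_one_neq0 C).

Section PowerSeriesTheory.
Variable C : numFieldType.
Implicit Types (f g h : pseries C) (T S : C) (k l : int).

Lemma psM f g n : (f * g) n = \sum_(i < n.+1) f i * g (n - i)%N.
Proof. by []. Qed.

Lemma ps1 n : (1 : pseries C) n = (n == 0)%:R. Proof. by []. Qed.

Lemma psD f g n : (f + g) n = f n + g n. Proof. by []. Qed.

Lemma psN f n : (- f) n = - f n. Proof. by []. Qed.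

Lemma ps_sum I (r : seq I) (P : pred I) (F : I -> pseries C) n :
  (\sum_(i <- r | P i) F i) n = \sum_(i <- r | P i) F i n.
Proof. by elim/big_rec2: _ => // i x y _ <-. Qed.

Definition ps_exp T : pseries C := fun i => T ^+ i / i`!%:R.
Definition ps_X : pseries C := fun n => (n == 1%N)%:R.
(* (e ^ y - 1) / y *)
Definition ps_quot : pseries C := fun i => i.+1`!%:R^-1.
(** The geometric series in [1 - ps_quot], mirroring [expm1V]. As [1 - ps_quot] has no constant
    term, its powers above [i] do not reach the coefficient [i]. *)
Definition ps_inv : pseries C := fun i => \sum_(k < i.+1) ((1 - ps_quot) ^+ k) i.

Lemma fact_neq0 n : n`!%:R != 0 :> C.
Proof. by rewrite pnatr_eq0 -lt0n fact_gt0. Qed.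

Lemma psX0 f : (ps_X * f) 0%N = 0.
Proof. by rewrite psM big_ord1 mul0r. Qed.

Lemma psXS f n : (ps_X * f) n.+1 = f n.
Proof.
by rewrite psM big_ord_recl mul0r add0r big_ord_recl mul1r subSS subn0 big1 ?addr0 // => i _; rewrite mul0r.
Qed.

Lemma ps_exp0 : ps_exp 0 = 1.
Proof. by apply/funext => -[|n]; rewrite /ps_exp ps1 ?expr0 ?divr1// expr0n mul0r. Qed.

Lemma ps_expD S T : ps_exp (S + T) = ps_exp S * ps_exp T.
Proof.
apply/funext => n; rewrite psM /ps_exp addrC exprDn mulr_suml; apply: eq_bigr => i _.
have le_in : (i <= n)%N by rewrite -ltnS.
rewrite -mulr_natr -(bin_fact le_in) !natrM.
have := fact_neq0 i; have := fact_neq0 (n - i).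
have : 'C(n, i)%:R != 0 :> C by rewrite pnatr_eq0 -lt0n bin_gt0.
by move=> *; field; apply/and3P.
Qed.

Lemma ps_exp1 : ps_exp 1 = 1 + ps_X * ps_quot.
Proof.
apply/funext => -[|n]; rewrite psD ps1 ?psX0 ?psXS /ps_exp expr1n ?divr1 ?addr0//.
by rewrite add0r mul1r.
Qed.

Lemma ps_pow_small f (k n : nat) : f 0%N = 0 -> (n < k)%N -> (f ^+ k) n = 0.
Proof.
move=> f0; elim: k n => // k IH n; rewrite ltnS exprS psM => nk; rewrite big_ord_recl f0 mul0r add0r.
by rewrite big1// => i _; rewrite IH ?mulr0// lift0; have := ltn_ord i; lia.
Qed.

Lemma ps_quot_inv : ps_quot * ps_inv = 1.
Proof.
set z := 1 - ps_quot.
have z0 : z 0%N = 0 by rewrite /z psD psN ps1 /ps_quot invr1 subrr.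
have zk (k : nat) n : (n < k)%N -> (z ^+ k) n = 0 by exact: ps_pow_small.
have inv_le n m : (m <= n)%N -> ps_inv m = (\sum_(k < n.+1) z ^+ k) m.
  move=> mn; rewrite ps_sum /ps_inv -/z (big_ord_widen n.+1 (fun j : nat => (z ^+ j) m))// big_mkcond /=.
  by apply: eq_bigr => i _; case: ltnP => // /zk.
apply/funext => n; have -> : (ps_quot * ps_inv) n = (ps_quot * \sum_(k < n.+1) z ^+ k) n.
  by rewrite !psM; apply: eq_bigr => i _; rewrite (inv_le n) ?leq_subr.
have -> : ps_quot = - (z - 1) by rewrite /z; ring.
(* Telescoping: [(1 - z) \sum_(k < n.+1) z ^ k = 1 - z ^ n.+1], and [z ^ n.+1] has no coefficient of
   degree [n]. *)
by rewrite mulNr -subrX1 opprB psD psN zk// subr0.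
Qed.

Definition ps_quotz k : pseries C :=
  match k with Posz n => ps_quot ^+ n | Negz n => ps_inv ^+ n.+1 end.

Lemma ps_quotzS k : ps_quotz (k + 1) = ps_quot * ps_quotz k.
Proof.
case: k => [n|[|n]].
- have -> : Posz n + 1 = Posz n.+1 by lia.
  by rewrite /= exprS.
- by rewrite /= expr1 ps_quot_inv.
have -> : (Negz n.+1 + 1 = Negz n) by lia.
by rewrite /= [in RHS]exprS mulrA ps_quot_inv mul1r.
Qed.

Lemma ps_quotzD k l : ps_quotz (k + l) = ps_quotz k * ps_quotz l.
Proof.
elim/int_ind: k => [|n IH|n IH]; first by rewrite add0r mul1r.
  have -> : n.+1%:Z + l = (n%:Z + l) + 1 by lia.
  by rewrite ps_quotzS IH mulrA -ps_quotzS -addn1.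
have H : ps_quot * ps_quotz (- n.+1%:Z + l) = ps_quot * (ps_quotz (- n.+1%:Z) * ps_quotz l).
  rewrite mulrA -!ps_quotzS -[- n.+1%:Z + 1]/(- n.+1%:Z + 1%:Z).
  have -> : - n.+1%:Z + l + 1 = - n%:Z + l by lia.
  by have -> : - n.+1%:Z + 1%:Z = - n%:Z by lia.
by have := congr1 ( *%R ps_inv) H; rewrite !mulrA [ps_inv * _]mulrC ps_quot_inv !mul1r.
Qed.

(** The derivation [y d/dy]; unlike [d/dy], it does not shift the index of coefficients. *)
Definition ps_euler f : pseries C := fun n => n%:R * f n.

Lemma ps_eulerM f g : ps_euler (f * g) = ps_euler f * g + f * ps_euler g.
Proof.
apply/funext => n; rewrite psD [LHS]/ps_euler !psM mulr_sumr -big_split.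
apply: eq_bigr => i _; rewrite /ps_euler /=.
have -> : n%:R = i%:R + (n - i)%:R :> C by rewrite -natrD subnKC// -ltnS.
by ring.
Qed.

Definition ps_const T : pseries C := fun n => if n is 0%N then T else 0.

Lemma ps_constM T f n : (ps_const T * f) n = T * f n.
Proof. by rewrite psM big_ord_recl subn0 big1 ?addr0 // => i _; rewrite mul0r. Qed.

Lemma ps_natM (m : nat) f n : (m%:R * f) n = m%:R * f n.
Proof.
have -> : m%:R = ps_const m%:R :> pseries C; last by rewrite ps_constM.
elim: m => [|m IH]; first by apply/funext => -[].
by rewrite -natr1 IH; apply/funext => -[|n']; rewrite psD ps1 /= ?addr0// natr1.
Qed.

Lemma ps_intM k f n : (k%:~R * f) n = k%:~R * f n.
Proof.
by case: k => m; rewrite ?NegzE ?mulrNz -!pmulrn ?mulNr ?psN ps_natM.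
Qed.

Lemma ps_euler_exp T : ps_euler (ps_exp T) = ps_const T * (ps_X * ps_exp T).
Proof.
apply/funext => n; rewrite ps_constM /ps_euler; case: n => [|n]; rewrite ?psX0 ?mul0r ?mulr0//.
rewrite psXS /ps_exp factS natrM exprS; have := fact_neq0 n.
have : n.+1%:R != 0 :> C by rewrite pnatr_eq0.
by move: n.+1%:R n`!%:R => a b a0 b0; field; apply/andP.
Qed.

Lemma ps_euler_quot : ps_euler ps_quot = ps_exp 1 - ps_quot.
Proof.
apply/funext => n; rewrite psD psN /ps_euler /ps_quot /ps_exp expr1n factS natrM.
have := fact_neq0 n; have : n.+1%:R != 0 :> C by rewrite pnatr_eq0.
have -> : n%:R = n.+1%:R - 1 :> C by rewrite -natr1 addrK.
by move: n.+1%:R n`!%:R => a b a0 b0; field; apply/andP.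
Qed.

Lemma ps_euler1 : ps_euler 1 = 0.
Proof. by apply/funext => -[|n]; rewrite /ps_euler ps1 ?mul0r ?mulr0. Qed.

Lemma ps_quotI : injective ( *%R ps_quot).
Proof.
by apply: (can_inj (g := *%R ps_inv)) => x; rewrite mulrA [ps_inv * _]mulrC ps_quot_inv mul1r.
Qed.

(** Follows from [y q' = e ^ y - q] for [q = (e ^ y - 1) / y]. Both sides obey the same recursion in
    [k], which also runs downwards because multiplication by [q] is injective. *)
Lemma ps_euler_quotz k :
  ps_euler (ps_quotz k) = k%:~R * (ps_exp 1 * ps_quotz (k - 1) - ps_quotz k).
Proof.
pose a l := ps_quotz (l - 1); pose rhs l := l%:~R * (ps_exp 1 * a l - ps_quot * a l).
have qa l : ps_quotz l = ps_quot * a l by rewrite -ps_quotzS subrK.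
have aS l : a (l + 1) = ps_quot * a l by rewrite -qa /a addrK.
have step l : ps_euler (ps_quotz (l + 1)) =
    (ps_exp 1 - ps_quot) * ps_quotz l + ps_quot * ps_euler (ps_quotz l).
  by rewrite ps_quotzS ps_eulerM ps_euler_quot.
have rhsS l : rhs (l + 1) = (ps_exp 1 - ps_quot) * ps_quotz l + ps_quot * rhs l.
  by rewrite /rhs aS qa intrD; ring.
rewrite qa -/(a k) -/(rhs k) -qa.
elim/int_ind: k => [|n IH|n IH].
- by rewrite /rhs mul0r ps_euler1.
- by rewrite (_ : n.+1%:Z = n%:Z + 1) ?step ?rhsS ?IH//; lia.
have E : - n.+1%:Z + 1 = - n%:Z by lia.
have := step (- n.+1%:Z); rewrite E IH -E rhsS => /addrI/ps_quotI.
by [].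
Qed.

(** The series [e ^ (T y) ((e ^ y - 1) / y) ^ k]; its coefficients are, up to factorials, the
    generalized Bernoulli polynomials of order [- k] in [T]. For [u] of weight [T], [y ^ k] times
    this series is what replaces [x ^ k] on passing from [Y(u, x)] to [Y[u, y]]. *)
Definition zhu_ser T k : pseries C := ps_exp T * ps_quotz k.

Lemma zhu_serM S T k l : zhu_ser S k * zhu_ser T l = zhu_ser (S + T) (k + l).
Proof. by rewrite /zhu_ser ps_expD ps_quotzD; ring. Qed.

Lemma ps_quotz0 k : ps_quotz k 0%N = 1.
Proof.
have q0 : ps_quot 0%N = 1 by rewrite /ps_quot invr1.
have i0 : ps_inv 0%N = 1 by rewrite /ps_inv big_ord1.
have pow0 (f : pseries C) (n : nat) : f 0%N = 1 -> (f ^+ n) 0%N = 1.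
  by move=> f0; elim: n => [//|n IH]; rewrite exprS psM big_ord1 f0 mul1r IH.
by case: k => n; apply: pow0.
Qed.

Lemma zhu_ser0 T k : zhu_ser T k 0%N = 1.
Proof. by rewrite /zhu_ser psM big_ord1 ps_quotz0 /ps_exp divr1 mulr1. Qed.

(** The relation [e ^ y = 1 + y q], with [q = (e ^ y - 1) / y], read off on coefficients. *)
Lemma zhu_ser_pascal T k i :
  zhu_ser (T + 1) k i.+1 = zhu_ser T k i.+1 + zhu_ser T (k + 1) i.
Proof.
have -> : zhu_ser (T + 1) k = zhu_ser T k + ps_X * zhu_ser T (k + 1).
  by rewrite /zhu_ser ps_expD ps_exp1 ps_quotzS; ring.
by rewrite psD psXS.
Qed.

(** Compares the coefficients of [y ^ (k + i)] in the derivative of [e ^ (T y) (e ^ y - 1) ^ k]. *)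
Lemma zhu_ser_deriv T k i :
  (k%:~R + i.+1%:R) * zhu_ser T k i.+1 =
  T * zhu_ser T k i + k%:~R * zhu_ser (T + 1) (k - 1) i.+1.
Proof.
have := congr1 (fun f => f i.+1) (ps_eulerM (ps_exp T) (ps_quotz k)).
rewrite ps_euler_exp ps_euler_quotz.
rewrite (_ : _ + _ = ps_const T * (ps_X * zhu_ser T k) +
   k%:~R * (zhu_ser (T + 1) (k - 1) - zhu_ser T k)); last first.
  by rewrite /zhu_ser ps_expD; ring.
rewrite psD ps_constM ps_intM psXS psD psN -/(zhu_ser T k) /ps_euler => H.
by rewrite mulrDl H; ring.
Qed.

(** Under [y -> - y], the series [q = (e ^ y - 1) / y] becomes [e ^ (- y) q], so [e ^ (T y) q ^ k]
    becomes [e ^ ((- T - k) y) q ^ k]. *)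
Lemma zhu_ser_refl T k i :
  (-1) ^+ i * zhu_ser T k i = zhu_ser (- T - k%:~R) k i.
Proof.
pose s f : pseries C := fun n => (-1) ^+ n * f n.
have sM f g : s (f * g) = s f * s g.
  apply/funext => n; rewrite /s !psM mulr_sumr; apply: eq_bigr => j _.
  have jn : (j <= n)%N by rewrite -ltnS.
  by rewrite -{1}(subnKC jn) exprD; ring.
have s_exp S : s (ps_exp S) = ps_exp (- S).
  by apply/funext => n; rewrite /s /ps_exp mulrA -exprMn mulN1r.
have s_quot : s ps_quot = ps_quot * ps_exp (- 1).
  have : s (ps_exp 1) = ps_exp (- 1) by rewrite s_exp.
  have e1 : ps_exp 1 * ps_exp (- 1) = 1 by rewrite -ps_expD subrr ps_exp0.
  have sX : s ps_X = - ps_X.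
    by apply/funext => -[|[|n]]; rewrite psN /s /ps_X /= ?mulr0 ?oppr0// expr1 mulN1r.
  have s1 : s (1 : pseries C) = 1 by rewrite -ps_exp0 s_exp oppr0.
  have sD f g : s (f + g) = s f + s g.
    by apply/funext => n; rewrite /s !psD mulrDr.
  rewrite {1}ps_exp1 sD s1 sM sX => H.
  have H' : ps_X * s ps_quot = ps_X * (ps_quot * ps_exp (-1)).
    have -> : ps_X * (ps_quot * ps_exp (-1)) = (1 + ps_X * ps_quot) * ps_exp (-1) - ps_exp (-1) by ring.
    by rewrite -ps_exp1 e1 -H; ring.
  by apply/funext => n; rewrite -[LHS]psXS H' psXS.
have s_quotz : s (ps_quotz k) = ps_quotz k * ps_exp (- k%:~R).
  have step l : s (ps_quotz (l + 1)) = ps_quot * ps_exp (-1) * s (ps_quotz l).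
    by rewrite ps_quotzS sM s_quot.
  elim/int_ind: k => [|n IH|n IH].
  - by rewrite oppr0 ps_exp0 mulr1 -{1}[ps_quotz 0]ps_exp0 s_exp oppr0 ps_exp0.
  - have -> : n.+1%:Z = n%:Z + 1 by lia.
    by rewrite step IH ps_quotzS intrD opprD ps_expD; ring.
  have := step (- n.+1%:Z); have -> : - n.+1%:Z + 1 = - n%:Z by lia.
  rewrite IH => H.
  have -> : s (ps_quotz (- n.+1%:Z)) = ps_inv * ps_exp 1 *
      (ps_quot * ps_exp (- 1) * s (ps_quotz (- n.+1%:Z))).
    transitivity ((ps_quot * ps_inv) * (ps_exp 1 * ps_exp (- 1)) * s (ps_quotz (- n.+1%:Z))).
      by rewrite ps_quot_inv -ps_expD subrr ps_exp0 !mul1r.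
    by ring.
  rewrite -H; have -> : - n%:Z = - n.+1%:Z + 1 by lia.
  rewrite ps_quotzS.
  have -> : - (- n.+1%:Z)%:~R = 1 + - (- n.+1%:Z + 1)%:~R :> C by rewrite intrD; ring.
  rewrite ps_expD.
  transitivity ((ps_quot * ps_inv) * (ps_exp 1 * ps_quotz (- n.+1%:Z) * ps_exp (- (- n.+1%:Z + 1)%:~R))); first by ring.
  by rewrite ps_quot_inv; ring.
rewrite -[LHS]/(s (zhu_ser T k) i).
suff -> : s (zhu_ser T k) = zhu_ser (- T - k%:~R) k by [].
by rewrite /zhu_ser sM s_exp s_quotz ps_expD; ring.
Qed.

End PowerSeriesTheory.

(** * Binomial coefficients and the substitution [x = e ^ y - 1] *)

Section Binomial.
Variable C : numFieldType.
Implicit Types (T S : C) (k n : nat) (f : pseries C).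

(** The analogue of [gbinom] over [C]: upper arguments such as [t + h - 1], with an arbitrary scalar
    [t], are needed later. *)
Definition binc T (k : nat) : C := (\prod_(l < k) (T - l%:R)) / k`!%:R.

Lemma binc0 T : binc T 0 = 1. Proof. by rewrite /binc big_ord0 divr1. Qed.

Lemma bincS T k : k.+1%:R * binc T k.+1 = (T - k%:R) * binc T k.
Proof.
rewrite /binc big_ord_recr factS natrM /=; have := fact_neq0 C k.
have : k.+1%:R != 0 :> C by rewrite pnatr_eq0.
by move: k.+1%:R k`!%:R => a b a0 b0; field; apply/andP.
Qed.

Lemma ratr_gbinom (q : rat) k : ratr (gbinom q k) = binc (ratr q) k.
Proof.
rewrite /gbinom /binc fmorph_div /= rmorph_prod /= ratr_nat; congr (_ / _).
by apply: eq_bigr => l _; rewrite rmorphB /= ratr_nat.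
Qed.

Lemma binc_trinomial T i k :
  binc T (i + k) * 'C(i + k, i)%:R = binc T i * binc (T - i%:R) k.
Proof.
have : ('C(i + k, i) * (i`! * k`!))%:R = (i + k)`!%:R :> C.
  by have := bin_fact (leq_addr k i); rewrite addKn => ->.
rewrite !natrM /binc big_split_ord /= => H.
have -> : \prod_(j < k) (T - (i + j)%:R) = \prod_(j < k) (T - i%:R - j%:R).
  by apply: eq_bigr => j _; rewrite natrD opprD addrA.
have := fact_neq0 C i; have := fact_neq0 C k; have := fact_neq0 C (i + k).
rewrite -H !mulf_eq0 !negb_or => /and3P[? ? ?] *; field; exact/and3P.
Qed.

Lemma binc_nat (n k : nat) : binc n%:R k = 'C(n, k)%:R.
Proof.
elim: k => [|k IH]; first by rewrite binc0 bin0.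
have k0 : k.+1%:R != 0 :> C by rewrite pnatr_eq0.
apply: (mulfI k0); rewrite bincS IH -natrM mul_bin_left.
have [kn|nk] := leqP k n; first by rewrite natrM natrB.
by rewrite bin_small// mulr0 muln0.
Qed.

Lemma binc1 T : binc T 1 = T.
Proof. by rewrite /binc big_ord1 subr0 divr1. Qed.

Lemma binc_absorb T k : k.+1%:R * binc T k.+1 = T * binc (T - 1) k.
Proof. by have := binc_trinomial T 1 k; rewrite add1n bin1 binc1 mulrC. Qed.

(** The left side is [Res_y e ^ (T y) (e ^ y - 1) ^ (- k - 1)], which the substitution
    [x = e ^ y - 1], [dy = dx / (1 + x)] turns into [Res_x (1 + x) ^ (T - 1) x ^ (- k - 1)]. The
    induction replaces the substitution by the vanishing of the residue of a derivative. *)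
Lemma zhu_ser_residue T (k : nat) : zhu_ser T (- k.+1%:Z) k = binc (T - 1) k.
Proof.
elim: k T => [|k IH] T; first by rewrite zhu_ser0 binc0.
have k0 : k.+1%:R != 0 :> C by rewrite pnatr_eq0.
apply: (mulfI k0); rewrite binc_absorb -IH.
have := zhu_ser_deriv (T - 1) (- k.+1%:Z) k.
have -> : - k.+1%:Z - 1 = - k.+2%:Z by lia.
rewrite subrK mulrNz -pmulrn addNr mul0r mulNr => /esym/eqP.
by rewrite subr_eq0 => /eqP.
Qed.

(** This is [e ^ (T y) = (1 + x) ^ T] for [x = e ^ y - 1], cut off at [x ^ n]. Both sides have
    constant term 1 and satisfy [f' = T f] up to the cut-off. *)
Lemma ps_expE T n i : (i <= n)%N ->
  ps_exp T i = (\sum_(k < n.+1) ps_const (binc T k) * (ps_X C * ps_quot C) ^+ k) i.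
Proof.
set x := ps_X C * ps_quot C; move=> le_in.
have x_small (k j : nat) : (j < k)%N -> (x ^+ k) j = 0.
  elim: k j => // k IH [|j]; rewrite exprS /x -mulrA ?psX0// psXS ltnS psM => jk.
  by rewrite big1// => l _; rewrite IH ?mulr0//; have := ltn_ord l; lia.
have ex : ps_euler x = ps_X C * (1 + x).
  have eX : ps_euler (ps_X C) = ps_X C :> pseries C.
    by apply/funext => -[|[|j]]; rewrite /ps_euler /ps_X ?mul0r ?mulr0 ?mulr1.
  by rewrite /x ps_eulerM eX ps_euler_quot -ps_exp1; ring.
have exk k : ps_euler (x ^+ k.+1) = k.+1%:R * (ps_X C * (x ^+ k + x ^+ k.+1)).
  elim: k => [|k IH]; first by rewrite expr1 expr0 ex; ring.
  by rewrite exprS ps_eulerM IH ex -!natr1 !exprS; ring.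
elim: i le_in => [|i IH] le_in; rewrite ps_sum.
  rewrite big_ord_recl ps_constM binc0 expr0 ps1 mulr1 /ps_exp divr1 expr0.
  by rewrite big1 ?addr0// => k _; rewrite ps_constM lift0 x_small ?mulr0.
have i0 : i.+1%:R != 0 :> C by rewrite pnatr_eq0.
apply: (mulfI i0).
have -> : i.+1%:R * ps_exp T i.+1 = T * ps_exp T i.
  by have := congr1 (fun f => f i.+1) (ps_euler_exp T); rewrite ps_constM psXS.
rewrite IH 1?ltnW// !ps_sum [in RHS]big_ord_recl [in RHS]ps_constM expr0 ps1 mulr0 add0r.
have -> : i.+1%:R * (\sum_(k < n) (ps_const (binc T (lift ord0 k)) * x ^+ lift ord0 k) i.+1) =
    \sum_(k < n) k.+1%:R * binc T k.+1 * ((x ^+ k) i + (x ^+ k.+1) i).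
  rewrite mulr_sumr; apply: eq_bigr => k _; rewrite lift0 ps_constM.
  have := congr1 (fun f => f i.+1) (exk k); rewrite ps_natM psXS psD /ps_euler => E.
  by rewrite mulrCA E; ring.
under [in RHS]eq_bigr do rewrite mulrDr.
rewrite big_split /= mulr_sumr big_ord_recr /= ps_constM (x_small n i)// !mulr0 addr0.
(* Shift of [k.+1] to [k]: the term at 0 carries the factor 0, and [x ^ n] does not reach the degree
   [i]. *)
have -> : \sum_(k < n) k.+1%:R * binc T k.+1 * (x ^+ k.+1) i =
    \sum_(k < n) k%:R * binc T k * (x ^+ k) i.
  have := erefl (\sum_(k < n.+1) k%:R * binc T k * (x ^+ k) i).
  rewrite {1}big_ord_recl big_ord_recr /= (x_small n i)// mulr0 addr0 !mul0r add0r.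
  by [].
rewrite -big_split; apply: eq_bigr => k _; rewrite ps_constM /= bincS; ring.
Qed.

(** Expands [e ^ (T y)] in powers of [e ^ y - 1]; each such power raises [k] by one and costs one
    power of [y]. *)
Lemma zhu_ser_binom T S (k : int) n :
  zhu_ser (S + T) k n = \sum_(j < n.+1) binc T j * zhu_ser S (k + j%:Z) (n - j)%N.
Proof.
have shift (j i : nat) f : (j <= i)%N -> (ps_X C ^+ j * f) i = f (i - j)%N.
  elim: j i => [|j IH] [|i] //; rewrite ?expr0 ?mul1r ?subn0// => ji.
  by rewrite exprS -mulrA psXS IH// subSS.
have -> : zhu_ser (S + T) k = ps_exp T * zhu_ser S k.
  by rewrite /zhu_ser ps_expD; ring.
have -> : (ps_exp T * zhu_ser S k) n =
    ((\sum_(j < n.+1) ps_const (binc T j) * (ps_X C * ps_quot C) ^+ j) * zhu_ser S k) n.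
  by rewrite !psM; apply: eq_bigr => i _; rewrite (@ps_expE T n) // -ltnS.
rewrite mulr_suml ps_sum; apply: eq_bigr => j _.
have jn : (j <= n)%N by rewrite -ltnS.
rewrite -mulrA ps_constM exprMn -[X in _ * X _]mulrA shift//.
have -> : ps_quot C ^+ j * zhu_ser S k = zhu_ser S (k + j%:Z) => //.
by rewrite /zhu_ser ps_quotzD -[ps_quotz C j%:Z]/(ps_quot C ^+ j); ring.
Qed.

End Binomial.

Local Open Scope classical_set_scope.
Local Open Scope ring_scope.

(** * Calculus of formal series in six variables *)

Section FiniteSums.
Variable W : zmodType.

Lemma fsum_inj (K L : choiceType) (h : L -> K) (F : K -> W) :
  injective h -> (forall x, (forall l, x <> h l) -> F x = 0) ->
  \sum_(x \in [set: K]) F x = \sum_(l \in [set: L]) F (h l).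
Proof.
move=> hI F0.
rewrite -(@fsbig_image _ _ _ L K setT h F); last by move=> ? ? _ _; exact: hI.
apply/esym/fsbig_widen => // x [_ Px] /=; apply: F0 => l xl; apply: Px.
by exists l.
Qed.

Lemma fsum_single (K : choiceType) (k : K) (F : K -> W) :
  (forall x, x != k -> F x = 0) -> \sum_(x \in [set: K]) F x = F k.
Proof.
move=> F0; rewrite (@fsum_inj _ unit (fun=> k)).
- rewrite (_ : [set: unit] = [set tt]) ?fsbig_set1//.
  by apply/seteqP; split => // -[].
- by move=> [] [].
- by move=> x xk; apply: F0; apply/eqP; exact: (xk tt).
Qed.

Lemma fsum_eq (K : choiceType) (F G : K -> W) : F =1 G ->
  \sum_(x \in [set: K]) F x = \sum_(x \in [set: K]) G x.
Proof. by move=> FG; apply: eq_fsbigr => x _; exact: FG. Qed.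

Lemma fsum_eq0 (K : choiceType) (F : K -> W) : (forall x, F x = 0) ->
  \sum_(x \in [set: K]) F x = 0.
Proof. by move=> F0; apply: fsbig1 => x _; exact: F0. Qed.

Lemma fsum_seq (K : choiceType) (r : seq K) (F : K -> W) : uniq r ->
  (forall x, x \notin r -> F x = 0) -> \sum_(x \in [set: K]) F x = \sum_(x <- r) F x.
Proof.
move=> r_uniq F0; rewrite [RHS]fsbig_seq//; apply/esym/fsbig_widen => // x [_ /= xr].
by apply: F0; apply/negP.
Qed.

Lemma fsum_ord (n : nat) (F : nat -> W) : (forall i, (n <= i)%N -> F i = 0) ->
  \sum_(i \in [set: nat]) F i = \sum_(i < n) F i.
Proof.
move=> F0; rewrite (@fsum_seq _ (iota 0 n)) ?iota_uniq//.
  by rewrite -(big_mkord xpredT) /index_iota subn0.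
by move=> i; rewrite mem_iota add0n leq0n /= -leqNgt => /F0.
Qed.

(** Injectivity makes the two families have the same support, so the identity also holds when that
    support is infinite and both sums are 0. *)
Lemma fsum_linear (K : choiceType) (U : zmodType) (f : {additive W -> U}) (F : K -> W) :
  injective f -> f (\sum_(x \in [set: K]) F x) = \sum_(x \in [set: K]) f (F x).
Proof.
move=> fI; have E : [set: K] `&` (F @^-1` [set~ 0]) = [set: K] `&` ((fun x => f (F x)) @^-1` [set~ 0]).
  apply/seteqP; split => x [_ /= Fx]; split => //= E; apply: Fx; last by rewrite E raddf0.
  by apply: fI; rewrite raddf0.
have -> : finite_support 0 [set: K] (fun x => f (F x)) = finite_support 0 [set: K] F.
  by rewrite /finite_support !unlock E.
by rewrite raddf_sum.
Qed.

End FiniteSums.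

Lemma fsum_nat3 (W : zmodType) (n : nat) (F : nat * nat * nat -> W) :
  (forall i j k, (n <= i)%N || (n <= j)%N || (n <= k)%N -> F (i, j, k) = 0) ->
  \sum_(x \in [set: nat * nat * nat]) F x =
  \sum_(i < n) \sum_(j < n) \sum_(k < n) F (val i, val j, val k).
Proof.
move=> F0.
rewrite (@fsum_inj _ _ ('I_n * 'I_n * 'I_n)%type (fun x => (val x.1.1, val x.1.2, val x.2))).
- rewrite (@fsum_seq _ _ (index_enum _)) ?index_enum_uniq//; last first.
    by move=> x; rewrite mem_index_enum.
  by rewrite !pair_big; apply: eq_bigr => -[[i j] k].
- by move=> [[i j] k] [[i' j'] k'] /= [] /ord_inj -> /ord_inj -> /ord_inj ->.
- move=> [[i j] k] H; apply: F0; apply/negPn/negP; rewrite !negb_or -!ltnNge.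
  by move=> /andP[/andP[ik jk] kk]; exact: (H (Ordinal ik, Ordinal jk, Ordinal kk)).
Qed.

Section Exponents.

Definition ex6 (a0 a1 a2 a3 a4 a5 : rat) : expo :=
  \row_j nth 0 [:: a0; a1; a2; a3; a4; a5] j.

Lemma ex6_eta (e : expo) :
  e = ex6 (e 0 vx0) (e 0 vx1) (e 0 vx2) (e 0 vy) (e 0 vy1) (e 0 vy2).
Proof.
apply/rowP => j; rewrite mxE; case: j => -[|[|[|[|[|[|//]]]]]] lt_j /=;
  by congr (e _ _); exact: val_inj.
Qed.

Lemma ex6_vx0 a0 a1 a2 a3 a4 a5 : ex6 a0 a1 a2 a3 a4 a5 0 vx0 = a0.
Proof. by rewrite mxE. Qed.
Lemma ex6_vx1 a0 a1 a2 a3 a4 a5 : ex6 a0 a1 a2 a3 a4 a5 0 vx1 = a1.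
Proof. by rewrite mxE. Qed.
Lemma ex6_vx2 a0 a1 a2 a3 a4 a5 : ex6 a0 a1 a2 a3 a4 a5 0 vx2 = a2.
Proof. by rewrite mxE. Qed.
Lemma ex6_vy a0 a1 a2 a3 a4 a5 : ex6 a0 a1 a2 a3 a4 a5 0 vy = a3.
Proof. by rewrite mxE. Qed.
Lemma ex6_vy1 a0 a1 a2 a3 a4 a5 : ex6 a0 a1 a2 a3 a4 a5 0 vy1 = a4.
Proof. by rewrite mxE. Qed.
Lemma ex6_vy2 a0 a1 a2 a3 a4 a5 : ex6 a0 a1 a2 a3 a4 a5 0 vy2 = a5.
Proof. by rewrite mxE. Qed.

Definition ex6_coord := (ex6_vx0, ex6_vx1, ex6_vx2, ex6_vy, ex6_vy1, ex6_vy2).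

Lemma ex6D a0 a1 a2 a3 a4 a5 b0 b1 b2 b3 b4 b5 :
  ex6 a0 a1 a2 a3 a4 a5 + ex6 b0 b1 b2 b3 b4 b5 =
  ex6 (a0 + b0) (a1 + b1) (a2 + b2) (a3 + b3) (a4 + b4) (a5 + b5).
Proof. by rewrite [LHS]ex6_eta !mxE. Qed.

Lemma ex6N a0 a1 a2 a3 a4 a5 :
  - ex6 a0 a1 a2 a3 a4 a5 = ex6 (- a0) (- a1) (- a2) (- a3) (- a4) (- a5).
Proof. by rewrite [LHS]ex6_eta !mxE. Qed.

Lemma ex60 : ex6 0 0 0 0 0 0 = 0.
Proof. by rewrite [RHS]ex6_eta !mxE. Qed.

Lemma ex6_inj a0 a1 a2 a3 a4 a5 b0 b1 b2 b3 b4 b5 :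
  ex6 a0 a1 a2 a3 a4 a5 = ex6 b0 b1 b2 b3 b4 b5 ->
  [/\ a0 = b0, a1 = b1, a2 = b2 & [/\ a3 = b3, a4 = b4 & a5 = b5]].
Proof.
move=> E; have H i := congr1 (fun e : expo => e 0 i) E.
move: (H vx0) (H vx1) (H vx2) (H vy) (H vy1) (H vy2).
by rewrite !ex6_coord.
Qed.

Lemma delta_vx0 q : q *: delta_mx 0 vx0 = ex6 q 0 0 0 0 0.
Proof. by rewrite [LHS]ex6_eta !mxE /= ?mulr1 ?mulr0. Qed.
Lemma delta_vx1 q : q *: delta_mx 0 vx1 = ex6 0 q 0 0 0 0.
Proof. by rewrite [LHS]ex6_eta !mxE /= ?mulr1 ?mulr0. Qed.
Lemma delta_vx2 q : q *: delta_mx 0 vx2 = ex6 0 0 q 0 0 0.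
Proof. by rewrite [LHS]ex6_eta !mxE /= ?mulr1 ?mulr0. Qed.
Lemma delta_vy q : q *: delta_mx 0 vy = ex6 0 0 0 q 0 0.
Proof. by rewrite [LHS]ex6_eta !mxE /= ?mulr1 ?mulr0. Qed.
Lemma delta_vy1 q : q *: delta_mx 0 vy1 = ex6 0 0 0 0 q 0.
Proof. by rewrite [LHS]ex6_eta !mxE /= ?mulr1 ?mulr0. Qed.
Lemma delta_vy2 q : q *: delta_mx 0 vy2 = ex6 0 0 0 0 0 q.
Proof. by rewrite [LHS]ex6_eta !mxE /= ?mulr1 ?mulr0. Qed.

Definition ex6E := (delta_vx0, delta_vx1, delta_vx2, delta_vy, delta_vy1, delta_vy2,
  ex6N, ex6D).

End Exponents.

Section Series.
Variable C : numFieldType.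
Implicit Types (W V M : lmodType C) (i j : 'I_6) (q : rat) (e : expo).

Lemma fsumZ W (K : choiceType) (c : C) (F : K -> W) :
  \sum_(x \in [set: K]) c *: F x = c *: \sum_(x \in [set: K]) F x.
Proof.
have [->|c0] := eqVneq c 0.
  by rewrite scale0r fsum_eq0// => x; rewrite scale0r.
by rewrite (@fsum_linear _ _ _ ( *:%R c))//; exact: scalerI.
Qed.

Lemma fscaleE W (a : fser C^o) (t : fser W) e :
  fscale a t e = \sum_(d \in [set: expo]) a d *: t (e - d).
Proof. by []. Qed.

Lemma fscale_inj W (L : choiceType) (h : L -> expo) (a : fser C^o) (t : fser W) e :
  injective h -> (forall d, (forall l, d <> h l) -> a d *: t (e - d) = 0) ->
  fscale a t e = \sum_(l \in [set: L]) a (h l) *: t (e - h l).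
Proof. by move=> hI a0; rewrite fscaleE (fsum_inj hI). Qed.

Lemma fscale_single W (d : expo) (a : fser C^o) (t : fser W) e :
  (forall d', d' != d -> a d' *: t (e - d') = 0) ->
  fscale a t e = a d *: t (e - d).
Proof. by move=> a0; rewrite fscaleE (fsum_single a0). Qed.

Lemma fscale_mono W i q (t : fser W) e :
  fscale (mono i q) t e = t (e - q *: delta_mx 0 i).
Proof.
rewrite (@fscale_single _ (q *: delta_mx 0 i)) /mono ?eqxx ?scale1r//.
by move=> d /negPf ->; rewrite scale0r.
Qed.

Lemma fscale_scalel W (c : C) (a : fser C^o) (t : fser W) :
  fscale (c *: a) t = c *: fscale a t.
Proof.
apply/funext => e; rewrite -[RHS]/(c *: (fscale a t e)) !fscaleE -fsumZ.
by apply: fsum_eq => d; rewrite scalerA.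
Qed.

(** Injectivity of [h] keeps the monomials of [a] apart, so the convolution over exponent vectors
    becomes a sum over their indices. *)
Lemma fscale_monomials W (K : choiceType) (h : K -> expo) (c : K -> C) (a : fser C^o)
    (t : fser W) e : injective h ->
  (forall d, a d = \sum_(n \in [set: K]) c n * (d == h n)%:R) ->
  fscale a t e = \sum_(n \in [set: K]) c n *: t (e - h n).
Proof.
move=> hI aE; rewrite (fscale_inj hI).
  apply: fsum_eq => n; rewrite aE (@fsum_single _ _ n) ?eqxx ?mulr1// => n' n'n.
  by rewrite (inj_eq hI) eq_sym (negPf n'n) mulr0.
move=> d dh; rewrite aE fsum_eq0 ?scale0r// => n.
by rewrite (negPf (introN eqP (dh n))) mulr0.
Qed.

Lemma fscale_monomials2 W (K L : choiceType) (h : K -> L -> expo) (c : K -> L -> C)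
    (a : fser C^o) (t : fser W) e : injective (fun x : K * L => h x.1 x.2) ->
  (forall d, a d = \sum_(n \in [set: K]) \sum_(m \in [set: L]) c n m * (d == h n m)%:R) ->
  fscale a t e = \sum_(x \in [set: K * L]) c x.1 x.2 *: t (e - h x.1 x.2).
Proof.
move=> hI aE; apply: (@fscale_monomials _ _ (fun x => h x.1 x.2) (fun x => c x.1 x.2)) => // d.
have [[[n m] /= ->]|dh] := pselect (exists x : K * L, d = h x.1 x.2).
  have hE x : (h n m == h x.1 x.2) = (x == (n, m)).
    by rewrite eq_sym (inj_eq hI x (n, m)).
  rewrite [RHS](@fsum_single _ _ (n, m)) ?eqxx ?mulr1; last first.
    by move=> x; rewrite hE => /negPf ->; rewrite mulr0.
  rewrite aE (@fsum_single _ _ n) => [|n' neq]; last first.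
    by apply: fsum_eq0 => m'; rewrite (hE (n', m')) xpair_eqE (negPf neq) mulr0.
  rewrite (@fsum_single _ _ m) ?eqxx ?mulr1// => m' neq.
  by rewrite (hE (n, m')) xpair_eqE (negPf neq) andbF mulr0.
have dh0 x : d == h x.1 x.2 = false by apply/eqP => dE; apply: dh; exists x.
rewrite aE !fsum_eq0// => x; rewrite ?fsum_eq0 ?dh0 ?mulr0// => m.
by rewrite (dh0 (x, m)) mulr0.
Qed.

Lemma delta_coord q i j : (q *: delta_mx 0 i : expo) 0 j = if i == j then q else 0.
Proof. by rewrite !mxE eqxx [j == i]eq_sym /=; case: eqP; rewrite ?mulr1 ?mulr0. Qed.

Lemma expoD (d e : expo) j : (d + e) 0 j = d 0 j + e 0 j.
Proof. by rewrite mxE. Qed.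

Lemma expoN (d : expo) j : (- d) 0 j = - d 0 j.
Proof. by rewrite mxE. Qed.

Lemma binpowE i (c : C) j q e : binpow i c j q e =
  \sum_(m \in [set: nat]) binc (ratr q) m * c ^+ m *
    (e == (q - m%:R) *: delta_mx 0 i + m%:R *: delta_mx 0 j)%:R.
Proof.
apply: fsum_eq => m.
rewrite -[LHS]/(ratr (gbinom q m) * c ^+ m * fscale (mono i (q - m%:R)) (mono j m%:R : fser C^o) e).
by rewrite fscale_mono ratr_gbinom /mono subr_eq addrC.
Qed.

Lemma fscale_binpow W i (c : C) j q (t : fser W) e : i != j ->
  fscale (binpow i c j q) t e =
  \sum_(m \in [set: nat]) (binc (ratr q) m * c ^+ m) *:
     t (e - ((q - m%:R) *: delta_mx 0 i + m%:R *: delta_mx 0 j)).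
Proof.
move=> ij; apply: fscale_monomials (binpowE i c j q) => m m' /(congr1 (fun e : expo => e 0 j)).
rewrite !expoD !delta_coord eqxx (negPf ij) !add0r => /eqP.
by rewrite eqr_nat => /eqP.
Qed.

Lemma fscale_monor (a : fser C^o) i q e :
  fscale a (mono i q : fser C^o) e = a (e - q *: delta_mx 0 i).
Proof.
rewrite (@fscale_single _ (e - q *: delta_mx 0 i)).
  by rewrite /mono subKr eqxx /GRing.scale /= mulr1.
move=> d dE; rewrite /mono; case: eqP => [E|_]; last by rewrite scaler0.
by case/eqP: dE; rewrite -E subKr.
Qed.

(** The pair consists of the power in the delta function and the order in the binomial expansion.
    Both can be read off from the exponents of the variables [l] and [j], so no two terms share a
    monomial. *)
Lemma fscale_delta_quotp W (p : nat) (w : C) i j l (t : fser W) e :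
  (0 < p)%N -> i != j -> i != l -> j != l ->
  fscale (delta (scalep w (quotp p i j l))) t e =
  \sum_(x \in [set: int * nat])
     (w ^ x.1 * (binc (ratr (x.1%:~R / p%:R)) x.2 * (-1) ^+ x.2)) *:
     t (e - ((x.1%:~R / p%:R - x.2%:R) *: delta_mx 0 i + x.2%:R *: delta_mx 0 j
            - (x.1%:~R / p%:R) *: delta_mx 0 l)).
Proof.
move=> p0 ij il jl; have p0' : p%:R != 0 :> rat by rewrite pnatr_eq0 -lt0n.
apply: (@fscale_monomials2 _ _ _ (fun (n : int) m => (n%:~R / p%:R - m%:R) *: delta_mx 0 i + m%:R *: delta_mx 0 j
            - (n%:~R / p%:R) *: delta_mx 0 l) (fun n m => w ^ n * (binc (ratr (n%:~R / p%:R)) m * (-1) ^+ m))).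
  move=> [n m] [n' m'] /= E; have H k := congr1 (fun e : expo => e 0 k) E.
  have := H j; have := H l; rewrite !(expoD, expoN) !delta_coord !eqxx [l == j]eq_sym.
  rewrite (negPf ij) (negPf il) (negPf jl) !addr0 !add0r.
  by move=> /oppr_inj/(mulIf (invr_neq0 p0'))/intr_inj -> /eqP; rewrite eqr_nat => /eqP ->.
move=> d; apply: fsum_eq => n.
rewrite -[LHS]/(w ^ n * fscale (binpow i (-1) j (n%:~R / p%:R)) (mono l (- n%:~R / p%:R) : fser C^o) d).
rewrite fscale_monor binpowE mulr_fsumr; apply: fsum_eq => m.
by rewrite mulNr scaleNr opprK mulrA (can2_eq (addrK _) (subrK _)).
Qed.

(* coefficient of z ^ q in e ^ (a z) *)
Definition expcoef (a : C) (q : rat) : C :=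
  if (denq q == 1) && (0 <= q) then ps_exp a `|numq q|%N else 0.

Lemma expcoef_nat a (n : nat) : expcoef a n%:R = ps_exp a n.
Proof.
by rewrite /expcoef ler0n pmulrn denq_int numq_int.
Qed.

Lemma expcoef_eq0 a q : (forall n : nat, q <> n%:R) -> expcoef a q = 0.
Proof.
move=> qn; rewrite /expcoef; case: ifP => // /andP[/eqP d1 q0].
case: (qn `|numq q|%N); rewrite -[LHS]divq_num_den d1 divr1 pmulrn.
by rewrite gez0_abs// numq_ge0.
Qed.

Lemma expcoef_rec a q : a * expcoef a (q - 1) = ratr q * expcoef a q.
Proof.
have [[n ->]|qn] := pselect (exists n : nat, q = n%:R).
  case: n => [|n].
    rewrite [expcoef _ (_ - _)]expcoef_eq0 ?rmorph0 ?mulr0 ?mul0r// => m.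
    by move=> E; have := ler0n rat m; rewrite -E; lra.
  rewrite ratr_nat expcoef_nat -natr1 addrK expcoef_nat.
  have := congr1 (fun f => f n.+1) (ps_euler_exp a).
  by rewrite ps_constM psXS => <-.
rewrite !expcoef_eq0 ?mulr0// => n qE; apply: qn; first by exists n.
by exists n.+1; rewrite -natr1 -qE subrK.
Qed.

(** The common shape of the exponents in the four delta functions of the theorem, so that all of
    them are expanded at once. *)
Definition linexp (a b c : C) : fser C^o :=
  a *: mono vy 1 + b *: mono vy1 1 + c *: mono vy2 1.

Definition expserE (a b c : C) (e : expo) : C :=
  if [&& e 0 vx0 == 0, e 0 vx1 == 0 & e 0 vx2 == 0] then
    expcoef a (e 0 vy) * expcoef b (e 0 vy1) * expcoef c (e 0 vy2) else 0.

Lemma fscale_linexp W a b c (t : fser W) e : fscale (linexp a b c) t e =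
  a *: t (e - 1 *: delta_mx 0 vy) + b *: t (e - 1 *: delta_mx 0 vy1) + c *: t (e - 1 *: delta_mx 0 vy2).
Proof.
have neq (i j : 'I_6) : i != j -> (1 *: delta_mx 0 i : expo) == 1 *: delta_mx 0 j = false.
  move=> ij; apply/eqP => /(congr1 (fun e : expo => e 0 i)).
  by rewrite !delta_coord eqxx eq_sym (negPf ij) => /eqP; rewrite oner_eq0.
rewrite fscaleE (@fsum_seq _ _ [:: 1 *: delta_mx 0 vy; 1 *: delta_mx 0 vy1; 1 *: delta_mx 0 vy2]); last first.
- move=> d; rewrite !inE !negb_or => /and3P[/negPf d1 /negPf d2 /negPf d3].
  rewrite -[linexp a b c d]/(a * (_ == _)%:R + b * (_ == _)%:R + c * (_ == _)%:R).
  by rewrite d1 d2 d3 !mulr0 !addr0 scale0r.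
- by rewrite /= !inE !neq.
rewrite !big_cons big_nil addr0 addrA.
have E d : linexp a b c d = a * (d == 1 *: delta_mx 0 vy)%:R
   + b * (d == 1 *: delta_mx 0 vy1)%:R + c * (d == 1 *: delta_mx 0 vy2)%:R by [].
by rewrite !E !eqxx !neq// !mulr0 !mulr1 !addr0 !add0r.
Qed.

(** The multinomial theorem: [(a y + b y1 + c y2) ^ n / n!] is the part of total degree [n] of the
    product of the three exponentials. The induction step is Euler's identity for homogeneous
    series, through [expcoef_rec]. *)
Lemma fpow_linexp a b c (n : nat) e : fpow (linexp a b c) n e =
  if e 0 vy + e 0 vy1 + e 0 vy2 == n%:R then n`!%:R * expserE a b c e else 0.
Proof.
elim: n e => [|n IH] e.
  rewrite /fpow /= /fconst; case: eqP => [->|e0].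
    by rewrite /expserE !mxE !addr0 !eqxx /= !(@expcoef_nat _ 0) /ps_exp !divr1 !mulr1.
  case: eqP => // s0; rewrite mul1r /expserE; case: ifP => // /and3P[/eqP x0 /eqP x1 /eqP x2].
  apply/eqP; rewrite eq_sym; apply: contraT => N0; case: e0; rewrite [e]ex6_eta -ex60 x0 x1 x2.
  have pos (u : C) q : expcoef u q != 0 -> 0 <= q.
    by apply: contraNT; rewrite /expcoef => /negPf ->; rewrite andbF.
  move: N0; rewrite !mulf_eq0 !negb_or => /andP[/andP[/pos H1 /pos H2] /pos H3].
  by congr ex6; lra.
rewrite -[LHS]/(fscale (linexp a b c) (fpow (linexp a b c) n) e) fscale_linexp !IH.
rewrite !(expoD, expoN) !delta_coord /=.
have E (i : 'I_6) : expserE a b c (e - 1 *: delta_mx 0 i) =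
  if [&& e 0 vx0 - (if i == vx0 then 1 else 0) == 0,
      e 0 vx1 - (if i == vx1 then 1 else 0) == 0 &
      e 0 vx2 - (if i == vx2 then 1 else 0) == 0] then
    expcoef a (e 0 vy - if i == vy then 1 else 0) *
    expcoef b (e 0 vy1 - if i == vy1 then 1 else 0) *
    expcoef c (e 0 vy2 - if i == vy2 then 1 else 0) else 0.
  by rewrite /expserE !(expoD, expoN) !delta_coord.
rewrite !E /= !subr0 -natr1.
have -> : (e 0 vy - 1 + e 0 vy1 + e 0 vy2 == n%:R) = (e 0 vy + e 0 vy1 + e 0 vy2 == n%:R + 1).
  by apply/eqP/eqP; lra.
have -> : (e 0 vy + (e 0 vy1 - 1) + e 0 vy2 == n%:R) = (e 0 vy + e 0 vy1 + e 0 vy2 == n%:R + 1).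
  by apply/eqP/eqP; lra.
have -> : (e 0 vy + e 0 vy1 + (e 0 vy2 - 1) == n%:R) = (e 0 vy + e 0 vy1 + e 0 vy2 == n%:R + 1).
  by apply/eqP/eqP; lra.
case: eqP => [sE|_]; last by rewrite !scaler0 !addr0.
rewrite /expserE; case: ifP => _; last by rewrite !mulr0 !scaler0 !addr0.
have := expcoef_rec a (e 0 vy); have := expcoef_rec b (e 0 vy1); have := expcoef_rec c (e 0 vy2).
have : n.+1`!%:R = n`!%:R * (ratr (e 0 vy) + ratr (e 0 vy1) + ratr (e 0 vy2)) :> C.
  by rewrite -!rmorphD /= sE natr1 ratr_nat factS natrM mulrC.
rewrite /GRing.scale /= => -> Hc Hb Ha.
set A := expcoef a (e 0 vy) in Ha *; set B := expcoef b (e 0 vy1) in Hb *.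
set D := expcoef c (e 0 vy2) in Hc *.
transitivity (n`!%:R * (a * expcoef a (e 0 vy - 1) * B * D + A * (b * expcoef b (e 0 vy1 - 1)) * D
    + A * B * (c * expcoef c (e 0 vy2 - 1)))); first by ring.
by rewrite Ha Hb Hc; ring.
Qed.

Lemma fexp_linexp a b c e : fexp (linexp a b c) e = expserE a b c e.
Proof.
rewrite /fexp /fsum.
have E (k : nat) : ((k`!%:R : C)^-1 *: fpow (linexp a b c) k) e =
    if e 0 vy + e 0 vy1 + e 0 vy2 == k%:R then expserE a b c e else 0.
  rewrite -[LHS]/((k`!%:R : C)^-1 * fpow (linexp a b c) k e) fpow_linexp.
  by case: ifP => _; rewrite ?mulr0// mulKf// fact_neq0.
rewrite (fsum_eq E).
have [[k sk]|sn] := pselect (exists k : nat, e 0 vy + e 0 vy1 + e 0 vy2 = k%:R).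
  rewrite (@fsum_single _ _ k) sk ?eqxx// => k'.
  by rewrite eqr_nat eq_sym => /negPf ->.
rewrite fsum_eq0 => [|k]; last by case: eqP => // sk; case: sn; exists k.
rewrite /expserE; case: ifP => // _; apply/esym/eqP/negPn/negP.
have nat_of (u : C) q : expcoef u q != 0 -> exists n : nat, q = n%:R.
  move=> u0; apply: contrapT => qn; case/eqP: u0; apply: expcoef_eq0 => n qE; apply: qn.
  by exists n.
rewrite !mulf_eq0 !negb_or => /andP[/andP[/nat_of[n1 E1] /nat_of[n2 E2]] /nat_of[n3 E3]].
by case: sn; exists (n1 + n2 + n3)%N; rewrite E1 E2 E3 !natrD.
Qed.

End Series.

(** * Supports of series *)

Section Support.
Variable P : expo -> Prop.

Definition supp_in (W : zmodType) (s : fser W) := forall e, ~ P e -> s e = 0.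

Hypothesis PD : forall d e, P d -> P e -> P (d + e).

Lemma supp_fconst (W : zmodType) (w : W) : P 0 -> supp_in w%:fs.
Proof. by move=> P0 e Pe; rewrite /fconst; case: (e =P 0) => // eE; case: Pe; rewrite eE. Qed.

Lemma supp_fsum (W : zmodType) (K : choiceType) (F : K -> fser W) :
  (forall k, supp_in (F k)) -> supp_in (fsum F).
Proof. by move=> PF e Pe; apply: fsum_eq0 => k; exact: PF. Qed.

Lemma supp_fprod2 (A B W : zmodType) (f : A -> B -> W) (s : fser A) (t : fser B) :
  (forall b, f 0 b = 0) -> (forall a, f a 0 = 0) ->
  supp_in s -> supp_in t -> supp_in (fprod2 f s t).
Proof.
move=> f0 f0' Ps Pt e Pe; apply: fsum_eq0 => d.
have [Pd|/Ps ->//] := pselect (P d); rewrite (Pt (e - d))// => Ped.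
by apply: Pe; rewrite -[e](subrK d) addrC; exact: PD.
Qed.

Lemma supp_fmapc (A B : zmodType) (f : A -> B) (s : fser A) :
  f 0 = 0 -> supp_in s -> supp_in (fmapc f s).
Proof. by move=> f0 Ps e /Ps; rewrite /fmapc => ->. Qed.

Lemma supp_add (W : zmodType) (s t : fser W) : supp_in s -> supp_in t -> supp_in (s + t).
Proof. by move=> Ps Pt e Pe; rewrite -[LHS]/(s e + t e) Ps// Pt// addr0. Qed.

Lemma supp_opp (W : zmodType) (s : fser W) : supp_in s -> supp_in (- s).
Proof. by move=> Ps e Pe; rewrite -[LHS]/(- s e) Ps// oppr0. Qed.

Lemma supp_sum (W : zmodType) I (r : seq I) (F : I -> fser W) :
  (forall i, supp_in (F i)) -> supp_in (\sum_(i <- r) F i).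
Proof. by move=> PF; elim/big_ind: _ => // s t; exact: supp_add. Qed.

Variable C : numFieldType.

Lemma supp_fscale (W : lmodType C) (a : fser C^o) (t : fser W) :
  supp_in a -> supp_in t -> supp_in (fscale a t).
Proof. by apply: supp_fprod2 => [b|c]; rewrite ?scale0r ?scaler0. Qed.

Lemma supp_scale (W : lmodType C) (c : C) (t : fser W) : supp_in t -> supp_in (c *: t).
Proof. by move=> Pt e Pe; rewrite -[LHS]/(c *: t e) Pt// scaler0. Qed.

Lemma supp_mono i q : P (q *: delta_mx 0 i) -> supp_in (mono i q : fser C^o).
Proof. by move=> Pi e Pe; rewrite /mono; case: eqP => // eE; case: Pe; rewrite eE. Qed.

Lemma supp_binpow i (c : C) j q :
  (forall m : nat, P ((q - m%:R) *: delta_mx 0 i + m%:R *: delta_mx 0 j)) ->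
  supp_in (binpow i c j q).
Proof.
move=> Pij e Pe; rewrite binpowE fsum_eq0// => m.
by case: eqP => [eE|]; rewrite ?mulr0//; case: Pe; rewrite eE.
Qed.

Lemma supp_vop (V M : lmodType C) (p : nat) (md : V -> int -> M -> M) s (z : powers C) t :
  bilin md -> (forall n, supp_in (z n)) -> supp_in s -> supp_in t ->
  supp_in (vop p md s z t).
Proof.
move=> [md1 md2] Pz Ps Pt; apply: supp_fsum => k; apply: supp_fscale => //.
apply: supp_fprod2 => // [w|v].
  by have := md1 k (-1) 0 0 w; rewrite scaler0 addr0 scaleN1r addNr.
by have := md2 k v (-1) 0 0; rewrite scaler0 addr0 scaleN1r addNr.
Qed.

End Support.

Section Vop.
Variable C : numFieldType.
Implicit Types (V M W : lmodType C).

Lemma bilin0l V M (md : V -> int -> M -> M) : bilin md -> forall k w, md 0 k w = 0.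
Proof. by move=> [md1 _] k w; have := md1 k (-1) 0 0 w; rewrite scaler0 addr0 scaleN1r addNr. Qed.

Lemma bilin0r V M (md : V -> int -> M -> M) : bilin md -> forall k v, md v k 0 = 0.
Proof. by move=> [_ md2] k v; have := md2 k v (-1) 0 0; rewrite scaler0 addr0 scaleN1r addNr. Qed.

Lemma fprod2_constl (A B D : zmodType) (f : A -> B -> D) (a : A) (t : fser B) :
  (forall b, f 0 b = 0) -> fprod2 f a%:fs t = fmapc (f a) t.
Proof.
move=> f0; apply/funext => e; rewrite /fprod2 (@fsum_single _ _ 0).
  by rewrite /fconst eqxx subr0.
by move=> d /negPf d0; rewrite /fconst d0.
Qed.

Lemma fprod2_constr (A B D : zmodType) (f : A -> B -> D) (b : B) (s : fser A) :
  (forall a, f a 0 = 0) -> fprod2 f s b%:fs = fmapc (f^~ b) s.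
Proof.
move=> f0; apply/funext => e; rewrite /fprod2 (@fsum_single _ _ e).
  by rewrite /fconst subrr eqxx.
by move=> d de; rewrite /fconst subr_eq0 eq_sym (negPf de).
Qed.

(** When the factors involve disjoint sets of variables, an exponent vector splits between them in
    only one way, and the convolution reduces to one term. *)
Lemma fprod2_disjoint (A B D : zmodType) (f : A -> B -> D) (I J : pred 'I_6)
    (s : fser A) (t : fser B) (a b : expo) :
  (forall b, f 0 b = 0) -> (forall a, f a 0 = 0) ->
  (forall i, I i -> ~~ J i) ->
  supp_in (fun e => forall i, ~~ I i -> e 0 i = 0) s ->
  supp_in (fun e => forall i, ~~ J i -> e 0 i = 0) t ->
  (forall i, ~~ I i -> a 0 i = 0) -> (forall i, ~~ J i -> b 0 i = 0) ->
  fprod2 f s t (a + b) = f (s a) (t b).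
Proof.
move=> f0 f0' IJ sI tJ aI bJ; rewrite /fprod2 (@fsum_single _ _ a).
  by rewrite addrC addKr.
move=> d da; have [dI|/sI ->//] := pselect (forall i, ~~ I i -> d 0 i = 0).
rewrite (tJ (a + b - d))// => dJ; case/eqP: da; apply/rowP => i.
case: (boolP (I i)) => [Ii|nIi]; last by rewrite dI ?aI.
have := dJ i (IJ i Ii); rewrite !(expoD, expoN) bJ ?IJ// addr0 => /eqP.
by rewrite subr_eq0 => /eqP.
Qed.

Lemma vop_constl V M p (md : V -> int -> M -> M) v (z : powers C) t e : bilin md ->
  vop p md v%:fs z t e =
  \sum_(k \in [set: int]) fscale (z (- k - p%:Z)) (fmapc (md v k) t) e.
Proof.
by move=> md2; apply: fsum_eq => k; rewrite fprod2_constl// => w; exact: bilin0l.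
Qed.

Lemma vop_constr V M p (md : V -> int -> M -> M) s (z : powers C) w e : bilin md ->
  vop p md s z w%:fs e =
  \sum_(k \in [set: int]) fscale (z (- k - p%:Z)) (fmapc (md^~ k ^~ w) s) e.
Proof.
by move=> md2; apply: fsum_eq => k; rewrite fprod2_constr// => v; exact: bilin0r.
Qed.

Lemma fscale_varp W i n (t : fser W) e :
  fscale (varp (C := C) i n) t e = t (e - n%:~R *: delta_mx 0 i).
Proof. exact: fscale_mono. Qed.

Lemma fscale_rootp W p i n (t : fser W) e :
  fscale (rootp (C := C) p i n) t e = t (e - (n%:~R / p%:R) *: delta_mx 0 i).
Proof. exact: fscale_mono. Qed.

Lemma fscale_scalep W (c : C) (z : powers C) n (t : fser W) e :
  fscale (scalep c z n) t e = c ^ n *: fscale (z n) t e.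
Proof. by rewrite /scalep fscale_scalel. Qed.

End Vop.

Section ExponentialDelta.
Variable C : numFieldType.

Lemma delta_expquotpE p (w a b c : C) d : delta (scalep w (expquotp p (linexp a b c))) d =
  \sum_(n \in [set: int]) w ^ n *
    expserE (n%:~R / p%:R * a) (n%:~R / p%:R * b) (n%:~R / p%:R * c)
      (d - ex6 0 (n%:~R / p%:R) (- (n%:~R / p%:R)) 0 0 0).
Proof.
apply: fsum_eq => n.
set q : rat := n%:~R / p%:R; set k : C := n%:~R / p%:R.
have lin : k *: linexp a b c = linexp (k * a) (k * b) (k * c).
  by rewrite /linexp !scalerDr !scalerA.
rewrite -[LHS]/(w ^ n * fscale (fexp (k *: linexp a b c))
   (fscale (mono vx1 q) (mono vx2 (- n%:~R / p%:R) : fser C^o)) d) lin; congr (_ * _).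
have monoE d' : fscale (mono vx1 q) (mono vx2 (- n%:~R / p%:R) : fser C^o) d' =
    (d' == ex6 0 q (- q) 0 0 0)%:R.
  rewrite fscale_mono /mono mulNr (can2_eq (subrK _) (addrK _)) !ex6E.
  by rewrite !addr0 !add0r.
rewrite (@fscale_single _ _ (d - ex6 0 q (- q) 0 0 0)) => [|d' dd'].
  by rewrite fexp_linexp monoE subKr eqxx /GRing.scale /= mulr1.
rewrite monoE; case: eqP => [dE|_]; last by rewrite scaler0.
by case/eqP: dd'; rewrite -dE subKr.
Qed.

(** As [t] does not involve [x1], the exponent [k / p] of [x1] singles out the power [k] in the
    delta function. What remains is a multiplication by [e ^ ((k / p) (a y + b y1 + c y2))] and a
    shift in [x2]. *)
Lemma fscale_delta_exp (W : lmodType C) p (w a b c : C) (t : fser W) (k : int) a2 a3 a4 a5 :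
  (0 < p)%N -> (forall e : expo, e 0 vx1 != 0 -> t e = 0) ->
  fscale (delta (scalep w (expquotp p (linexp a b c)))) t (ex6 0 (k%:~R / p%:R) a2 a3 a4 a5) =
  w ^ k *: \sum_(x \in [set: nat * nat * nat])
    (ps_exp (k%:~R / p%:R * a) x.1.1 * ps_exp (k%:~R / p%:R * b) x.1.2 *
     ps_exp (k%:~R / p%:R * c) x.2) *:
    t (ex6 0 0 (a2 + k%:~R / p%:R) (a3 - x.1.1%:R) (a4 - x.1.2%:R) (a5 - x.2%:R)).
Proof.
move=> p0 t_x1; set q : rat := k%:~R / p%:R.
pose h (x : nat * nat * nat) := ex6 0 q (- q) x.1.1%:R x.1.2%:R x.2%:R.
have p0' : p%:R != 0 :> rat by rewrite pnatr_eq0 -lt0n.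
have expser_off u v x n : (n == k = false) -> forall d : expo, d 0 vx1 = q ->
    expserE u v x (d - ex6 0 (n%:~R / p%:R) (- (n%:~R / p%:R)) 0 0 0) = 0 :> C.
  move=> nk d dq; rewrite /expserE !(expoD, expoN) !ex6_coord dq.
  case: ifP => // /and3P[_ E _]; move: E nk.
  by rewrite subr_eq0 /q => /eqP/(mulIf (invr_neq0 p0'))/intr_inj ->; rewrite eqxx.
rewrite -fsumZ (@fscale_inj _ _ _ h).
- apply: fsum_eq => x; rewrite delta_expquotpE (@fsum_single _ _ k) => [|n /negPf nk]; last first.
    by rewrite (expser_off _ _ _ _ nk) ?mulr0// ex6_coord.
  rewrite scalerA /expserE !(expoD, expoN) !ex6_coord /q !subrr !subr0 eqxx /= !expcoef_nat.
  by congr (_ *: t _); rewrite /h !ex6E /q subr0 subrr opprK.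
- move=> [[i j] l] [[i' j'] l'] /ex6_inj[_ _ _ []] /= /eqP; rewrite eqr_nat => /eqP ->.
  by move=> /eqP; rewrite eqr_nat => /eqP -> /eqP; rewrite eqr_nat => /eqP ->.
move=> d dh; have [dq|dq] := eqVneq (d 0 vx1) q; last first.
  by rewrite t_x1 ?scaler0// expoD expoN ex6_coord subr_eq0 eq_sym.
rewrite delta_expquotpE fsum_eq0 ?scale0r// => n.
have [->|/negPf nk] := eqVneq n k; last by rewrite (expser_off _ _ _ _ nk) ?mulr0.
rewrite /expserE !(expoD, expoN) !ex6_coord -/q !subr0 opprK.
case: ifP => [/and3P[/eqP d0 /eqP d1 /eqP d2]|]; last by rewrite mulr0.
apply/eqP; rewrite mulf_eq0; apply/orP; right; apply: contraT.
have nat_of (u : C) r : expcoef u r != 0 -> exists m : nat, r = m%:R.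
  move=> u0; apply: contrapT => rn; case/eqP: u0; apply: expcoef_eq0 => m rE; apply: rn.
  by exists m.
rewrite !mulf_eq0 !negb_or => /andP[/andP[/nat_of[i iE] /nat_of[j jE]] /nat_of[l lE]].
case: (dh (i, j, l)); rewrite /h /= [d]ex6_eta dq iE jE lE d0.
by rewrite (_ : d 0 vx2 = - q)//; apply/eqP; rewrite -addr_eq0; apply/eqP.
Qed.

End ExponentialDelta.

(** * Laurent series in [y] and the powers of [e ^ y - 1] *)

Section OneVariable.
Variable C : numFieldType.
Implicit Types (f g : pseries C) (k l : int).

(* the Laurent series y ^ k f(y) *)
Definition laurent k f : fser C^o := fun e =>
  \sum_(n \in [set: nat]) f n * (e == (k + n%:Z)%:~R *: delta_mx 0 vy)%:R.

Lemma delta_vy_inj : injective (fun s : int => s%:~R *: delta_mx 0 vy : expo).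
Proof.
by move=> s t /(congr1 (fun e : expo => e 0 vy)); rewrite !delta_coord eqxx => /intr_inj.
Qed.

Lemma laurentE k f (n : nat) : laurent k f ((k + n%:Z)%:~R *: delta_mx 0 vy) = f n.
Proof.
rewrite /laurent (@fsum_single _ _ n) ?eqxx ?mulr1// => m /negPf mn.
rewrite (inj_eq delta_vy_inj) (_ : _ == _ = false) ?mulr0//.
by apply/eqP => H; move/eqP: mn; apply; lia.
Qed.

Lemma laurent_off k f (e : expo) :
  (forall n : nat, e <> (k + n%:Z)%:~R *: delta_mx 0 vy) -> laurent k f e = 0.
Proof. by move=> en; rewrite /laurent fsum_eq0// => n; case: eqP => [/en//|]; rewrite mulr0. Qed.

Lemma eq_laurent k f (a : fser C^o) :
  (forall n : nat, a ((k + n%:Z)%:~R *: delta_mx 0 vy) = f n) ->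
  (forall e : expo, (forall n : nat, e <> (k + n%:Z)%:~R *: delta_mx 0 vy) -> a e = 0) ->
  a = laurent k f.
Proof.
move=> aE a0; apply/funext => e.
have [[n ->]|en] := pselect (exists n : nat, e = (k + n%:Z)%:~R *: delta_mx 0 vy).
  by rewrite aE laurentE.
have {}en n : e <> (k + n%:Z)%:~R *: delta_mx 0 vy by move=> E; apply: en; exists n.
by rewrite a0// laurent_off.
Qed.

Lemma fscale_laurent (W : lmodType C) k f (t : fser W) e : fscale (laurent k f) t e =
  \sum_(n \in [set: nat]) f n *: t (e - (k + n%:Z)%:~R *: delta_mx 0 vy).
Proof.
by apply: fscale_monomials => // m n /delta_vy_inj/addrI[].
Qed.

Lemma laurentM k l f g : fscale (laurent k f) (laurent l g) = laurent (k + l) (f * g).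
Proof.
apply: eq_laurent => [n|e en]; rewrite fscale_laurent; last first.
  apply: fsum_eq0 => m; rewrite laurent_off ?scaler0// => n /eqP.
  rewrite subr_eq -scalerDl -intrD => /eqP E; apply: (en (m + n)%N); rewrite E.
  by congr (_%:~R *: _); lia.
have E (m : nat) : ((k + l + n%:Z)%:~R *: delta_mx 0 vy - (k + m%:Z)%:~R *: delta_mx 0 vy : expo) =
    (l + (n%:Z - m%:Z))%:~R *: delta_mx 0 vy.
  by rewrite -scalerBl -intrB; congr (_%:~R *: _); lia.
rewrite psM (@fsum_ord _ n.+1) => [|m nm].
  apply: eq_bigr => m _; rewrite E; have mn : (m <= n)%N by rewrite -ltnS.
  by rewrite subzn// laurentE.
rewrite E laurent_off ?scaler0// => j /delta_vy_inj; lia.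
Qed.

Lemma fconst_laurent : (1 : C^o)%:fs = laurent 0 1.
Proof.
apply: eq_laurent => [n|e en]; rewrite /fconst.
  have e0 : (0 : expo) = 0%:~R *: delta_mx 0 vy by rewrite scale0r.
  by rewrite add0r [X in _ == X]e0 (inj_eq delta_vy_inj) ps1; case: n.
case: eqP => // e0; case: (en 0%N); by rewrite e0 addr0 scale0r.
Qed.

Lemma fpow_laurent k f (n : nat) : fpow (laurent k f) n = laurent (n%:Z * k) (f ^+ n).
Proof.
elim: n => [|n IH]; first by rewrite mul0r /fpow /= fconst_laurent.
rewrite -[LHS]/(fscale (laurent k f) (fpow (laurent k f) n)) IH laurentM exprS.
by have -> : k + n%:Z * k = n.+1%:Z * k by rewrite -[n.+1]addn1 PoszD mulrDl mul1r addrC.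
Qed.

Lemma fexp_mono_vy : fexp (mono vy 1) = laurent 0 (ps_exp (1 : C)).
Proof.
have -> : mono vy 1 = linexp (1 : C) 0 0.
  by rewrite /linexp scale1r !scale0r !addr0.
apply: eq_laurent => [n|e en]; rewrite fexp_linexp /expserE.
  have ec0 : expcoef 0 0 = 1 :> C by rewrite (@expcoef_nat _ 0 0) /ps_exp expr0 divr1.
  by rewrite !delta_coord /= add0r -pmulrn !ec0 !mulr1 expcoef_nat.
case: ifP => // /and3P[/eqP d0 /eqP d1 /eqP d2].
have z r : r != 0 -> expcoef (0 : C) r = 0.
  move=> r0; have [[[|m] rE]|rn] := pselect (exists m : nat, r = m%:R).
  - by rewrite rE eqxx in r0.
  - by rewrite rE expcoef_nat /ps_exp expr0n mul0r.
  by apply: expcoef_eq0 => m rE; apply: rn; exists m.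
have [d4|/z ->] := eqVneq (e 0 vy1) 0; last by rewrite mulr0 mul0r.
have [d5|/z ->] := eqVneq (e 0 vy2) 0; last by rewrite mulr0.
rewrite [expcoef 1 _]expcoef_eq0 ?mul0r// => n d3; apply: (en n).
by rewrite [e]ex6_eta d0 d1 d2 d3 d4 d5 add0r delta_vy pmulrn.
Qed.

Lemma laurentB k f g : laurent k f - laurent k g = laurent k (f - g).
Proof.
apply: eq_laurent => [n|e en]; rewrite -[LHS]/(laurent k f _ - laurent k g _).
  by rewrite !laurentE.
by rewrite !laurent_off ?subr0.
Qed.

Lemma expm1_laurent : @expm1 C = laurent 1 (ps_quot C).
Proof.
rewrite /expm1 fexp_mono_vy fconst_laurent laurentB ps_exp1 addrC addKr.
apply: eq_laurent => [n|e en].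
  have -> : 1 + n%:Z = 0 + n.+1%:Z by lia.
  by rewrite laurentE psXS.
rewrite /laurent fsum_eq0// => -[|n]; first by rewrite psX0 mul0r.
case: eqP => [E|]; last by rewrite mulr0.
by case: (en n); rewrite E; congr (_%:~R *: _); lia.
Qed.

Lemma mono_laurent k : (mono vy k%:~R : fser C^o) = laurent k 1.
Proof.
apply: eq_laurent => [n|e en]; rewrite /mono.
  by rewrite (inj_eq delta_vy_inj) ps1; congr _%:R; case: n => [|n]; lia.
by case: eqP => // E; case: (en 0%N); rewrite addr0.
Qed.

Lemma expm1V_laurent : @expm1V C = laurent (-1) (ps_inv C).
Proof.
rewrite /expm1V -[-1 : rat]/((-1)%:~R) mono_laurent expm1_laurent laurentM mul1r.
rewrite -[-1 + 1]/(0 : int) fconst_laurent laurentB.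
have -> : fsum (fun k : nat => fpow (laurent 0 (1 - ps_quot C)) k) = laurent 0 (ps_inv C).
  apply: eq_laurent => [n|e en].
    rewrite /fsum /ps_inv (@fsum_ord _ n.+1) => [|k nk].
      by apply: eq_bigr => k _; rewrite fpow_laurent mulr0 laurentE.
    rewrite fpow_laurent mulr0 laurentE ps_pow_small//.
    by rewrite psD psN ps1 /ps_quot invr1 subrr.
  by apply: fsum_eq0 => k; rewrite fpow_laurent mulr0 laurent_off.
by rewrite laurentM addr0 mul1r.
Qed.

Lemma expm1p_laurent k : @expm1p C k = laurent k (ps_quotz C k).
Proof.
case: k => n; first by rewrite /expm1p expm1_laurent fpow_laurent mulr1.
rewrite -[LHS]/(fpow (@expm1V C) n.+1) expm1V_laurent fpow_laurent.
by have -> : n.+1%:Z * -1 = Negz n by lia.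
Qed.

End OneVariable.

(** * Coefficients of the Jacobi identity *)

Section VopRootp.
Variables (C : numFieldType) (V M : lmodType C).

Lemma rootp1 i : rootp 1 i = varp i :> powers C.
Proof. by apply/funext => n; rewrite /rootp /varp divr1. Qed.

(** Upper negation, by reversing the product; it converts exponents of binomial expansions into mode
    indices. *)
Lemma binc_opp (T : C) (j : nat) : binc (j%:R - 1 - T) j * (-1) ^+ j = binc T j.
Proof.
rewrite /binc mulrAC; congr (_ / _); rewrite -[j in (-1) ^+ j]card_ord -prodr_const.
rewrite (reindex_inj rev_ord_inj) -big_split; apply: eq_bigr => l _ /=.
by rewrite natrB ?ltn_ord// -natr1; ring.
Qed.

Lemma vop_rootp p (md : V -> int -> M -> M) v i t e : bilin md ->
  vop p md v%:fs (rootp p i) t e =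
  \sum_(k \in [set: int]) md v k (t (e + ((k + p%:Z)%:~R / p%:R) *: delta_mx 0 i)).
Proof.
move=> md2; rewrite vop_constl//; apply: fsum_eq => k; rewrite fscale_rootp /fmapc.
by rewrite -opprD mulrNz mulNr scaleNr opprK.
Qed.

Lemma vop_rootpr p (md : V -> int -> M -> M) s i w e : bilin md ->
  vop p md s (rootp p i) w%:fs e =
  \sum_(k \in [set: int]) md (s (e + ((k + p%:Z)%:~R / p%:R) *: delta_mx 0 i)) k w.
Proof.
move=> md2; rewrite vop_constr//; apply: fsum_eq => k; rewrite fscale_rootp /fmapc.
by rewrite -opprD mulrNz mulNr scaleNr opprK.
Qed.

Lemma pfrac_shift (p : nat) (k l : int) : (0 < p)%N ->
  - (k%:~R / p%:R) - 1 + (l + p%:Z)%:~R / p%:R = (l - k)%:~R / p%:R :> rat.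
Proof.
move=> p0; have p0' : p%:R != 0 :> rat by rewrite pnatr_eq0 -lt0n.
by rewrite !intrD -pmulrn; field.
Qed.

Lemma pfrac_eq0 (p : nat) (k : int) : (0 < p)%N -> (k%:~R / p%:R == 0 :> rat) = (k == 0).
Proof.
move=> p0; rewrite mulf_eq0 invr_eq0 pnatr_eq0 (gtn_eqF p0) orbF intr_eq0.
by [].
Qed.

Definition avoids (W : zmodType) (i : 'I_6) (t : fser W) :=
  forall e : expo, e 0 i != 0 -> t e = 0.

Lemma avoids_fconst (W : zmodType) i (w : W) : avoids i w%:fs.
Proof. by move=> e ei; rewrite /fconst; case: (e =P 0) ei => // ->; rewrite mxE eqxx. Qed.

Lemma avoids_vop_rootp p (md : V -> int -> M -> M) v i j t : bilin md -> i != j ->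
  avoids j t -> avoids j (vop p md v%:fs (rootp p i) t).
Proof.
move=> md2 ij tj e ej; rewrite vop_rootp// fsum_eq0// => k; rewrite tj ?(bilin0r md2)//.
by rewrite expoD delta_coord (negPf ij) addr0.
Qed.

Lemma avoids_vop_rootpr p (md : V -> int -> M -> M) s i j w : bilin md -> i != j ->
  avoids j s -> avoids j (vop p md s (rootp p i) w%:fs).
Proof.
move=> md2 ij tj e ej; rewrite vop_rootpr// fsum_eq0// => k; rewrite tj ?(bilin0l md2)//.
by rewrite expoD delta_coord (negPf ij) addr0.
Qed.

Lemma scalep1 (z : powers C) : scalep 1 z = z.
Proof. by apply/funext => n; rewrite /scalep exp1rz scale1r. Qed.

(** With the variable [l] absent from [t] and from [e], only the power 0 of the delta function
    counts, and [binc 0 m] vanishes for positive [m]. Taking the residue in [x0] thus removes the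
    delta functions on the left of the Jacobi identity. *)
Lemma fscale_delta_quotp1 (W : lmodType C) (w : C) i j l (t : fser W) (e : expo) :
  i != j -> i != l -> j != l -> avoids l t -> e 0 l = 0 ->
  fscale (delta (scalep w (quotp 1 i j l))) t e = t e.
Proof.
move=> ij il jl tl el; rewrite fscale_delta_quotp// (@fsum_single _ _ (0, 0%N)) => [|[n m]].
  by rewrite /= expr0z binc0 expr0 !(mul1r, scale1r, mulr0z, mul0r, mulr0n, subr0, scale0r, addr0, oppr0).
rewrite xpair_eqE negb_and /= !divr1 => nm.
have [n0|n0] := eqVneq n 0; last first.
  rewrite [t _]tl ?scaler0// !(expoD, expoN) !delta_coord eqxx (negPf il) (negPf jl) el.
  by rewrite !add0r opprK intr_eq0.
have m0 : (0 < m)%N by move: nm; rewrite n0 eqxx /= lt0n.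
rewrite n0 rmorph0 (_ : binc 0 m = 0) ?mul0r ?mulr0 ?scale0r//.
by rewrite -[0 : C]/(0%:R) binc_nat bin_small.
Qed.

End VopRootp.

Section JacobiCommutator.
Variables (C : numFieldType) (V M : lmodType C).

(** Extracts the coefficient of [x0 ^ (-1) x1 ^ (- k / p - 1) x2 ^ (- l / p - 1)]. Abstract modes
    and an abstract [g] let the result serve both V, with [p = 1], and the twisted module. *)
Lemma jacobi_commutator (p : nat) (Y : V -> int -> V -> V) (md : V -> int -> M -> M) (z : C)
    (g : nat -> V -> V) u v w :
  bilin Y -> bilin md -> (0 < p)%N -> z ^+ p = 1 ->
  (let Y s i t := vop 1%N Y s (varp i) t in
   let YM s i t := vop p md s (rootp p i) t in
   fscale (mono vx0 (-1))
      (fscale (delta (quotp 1%N vx1 vx2 vx0)) (YM u%:fs vx1 (YM v%:fs vx2 w%:fs)))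
    - fscale (mono vx0 (-1))
      (fscale (delta (scalep (-1) (quotp 1%N vx2 vx1 vx0)))
         (YM v%:fs vx2 (YM u%:fs vx1 w%:fs)))
    = (p%:R : C)^-1 *: fscale (mono vx2 (-1))
      (\sum_(r < p)
         fscale (delta (scalep (z ^+ r) (quotp p vx1 vx0 vx2)))
           (YM (Y (g r u)%:fs vx0 v%:fs) vx2 w%:fs))) ->
  forall k l : int, md u k (md v l w) - md v l (md u k w) =
    (p%:R : C)^-1 *: \sum_(r < p) (z ^+ r) ^ (- k) *: \sum_(j \in [set: nat])
      binc (k%:~R / p%:R) j *: md (Y (g r u) j v) (k + l - p%:Z * j%:Z) w.
Proof.
move=> Y2 md2 p0 zp jac k l.
have p0' : p%:R != 0 :> rat by rewrite pnatr_eq0 -lt0n.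
have {jac} := congr1 (fun s : fser M => s (ex6 (-1) (- (k%:~R / p%:R) - 1) (- (l%:~R / p%:R) - 1) 0 0 0)) jac.
have dv0 : 1 *: delta_mx 0 vx0 = ex6 1 0 0 0 0 0 by rewrite delta_vx0.
set e1 := ex6 _ _ _ _ _ _.
rewrite /= -[LHS]/(fscale _ _ e1 - fscale _ _ e1) !fscale_mono.
have -> : e1 - (-1) *: delta_mx 0 vx0 = ex6 0 (- (k%:~R / p%:R) - 1) (- (l%:~R / p%:R) - 1) 0 0 0.
  by rewrite /e1 !ex6E !oppr0 !addr0 subrr.
rewrite -{1}(scalep1 (quotp 1 vx1 vx2 vx0)) !fscale_delta_quotp1 ?ex6_coord//; last first.
- by apply: avoids_vop_rootp => //; apply: avoids_vop_rootp => //; exact: avoids_fconst.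
- by apply: avoids_vop_rootp => //; apply: avoids_vop_rootp => //; exact: avoids_fconst.
have frac0 (a b : int) : ((a%:~R / p%:R : rat) == b%:~R / p%:R) = (a == b).
  by rewrite (inj_eq (mulIf (invr_neq0 p0'))) eqr_int.
have one (a b : M) (c : bool) : (c -> a = b) -> (if c then a else 0) = (if c then b else 0).
  by case: c => // ->.
(* In a product of two operators in distinct variables, the two exponents single out one mode of
   each. *)
have YMYM (u' v' : V) i1 i2 (k' l' : int) (e : expo) : i1 != i2 ->
    (forall j, j != i1 -> j != i2 -> e 0 j = 0) ->
    e 0 i1 = - (k'%:~R / p%:R) - 1 -> e 0 i2 = - (l'%:~R / p%:R) - 1 ->
    vop p md u'%:fs (rootp p i1) (vop p md v'%:fs (rootp p i2) w%:fs) e =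
      md u' k' (md v' l' w).
  move=> i12 e0 e1k e2l; rewrite vop_rootp// (@fsum_single _ _ k') => [|n nk]; last first.
    rewrite vop_rootp// fsum_eq0 ?(bilin0r md2)// => n'.
    rewrite /fconst ifF ?(bilin0r md2)//; apply/eqP => /(congr1 (fun e : expo => e 0 i1)).
    rewrite !expoD !delta_coord eqxx [i2 == i1]eq_sym (negPf i12) addr0 e1k pfrac_shift// mxE.
    by move/eqP; rewrite pfrac_eq0// subr_eq0 (negPf nk).
  congr (md _ _ _); rewrite vop_rootp// (@fsum_single _ _ l') => [|n nl]; last first.
    rewrite /fconst ifF ?(bilin0r md2)//; apply/eqP => /(congr1 (fun e : expo => e 0 i2)).
    rewrite !expoD !delta_coord eqxx (negPf i12) addr0 e2l pfrac_shift// mxE.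
    by move/eqP; rewrite pfrac_eq0// subr_eq0 (negPf nl).
  rewrite /fconst ifT//; apply/eqP/rowP => j; rewrite !expoD !delta_coord mxE.
  have [<-|ji1] := eqVneq i1 j.
    by rewrite [i2 == i1]eq_sym (negPf i12) addr0 e1k pfrac_shift// subrr mul0r.
  have [<-|ji2] := eqVneq i2 j; first by rewrite addr0 e2l pfrac_shift// subrr mul0r.
  by rewrite !addr0 e0// eq_sym.
have e2_0 j : j != vx1 -> j != vx2 ->
    ex6 0 (- (k%:~R / p%:R) - 1) (- (l%:~R / p%:R) - 1) 0 0 0 0 j = 0.
  by case: j => -[|[|[|[|[|[|//]]]]]] lj; rewrite ?mxE.
rewrite (YMYM _ _ _ _ k l) ?ex6_coord// (YMYM _ _ _ _ l k) ?ex6_coord//; last first.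
  by move=> j j1 j2; exact: e2_0.
move=> ->; congr (_ *: _).
rewrite -[LHS]/(fscale _ _ e1) fscale_mono fct_sumE; apply: eq_bigr => r _.
have -> : e1 - (-1) *: delta_mx 0 vx2 = ex6 (-1) (- (k%:~R / p%:R) - 1) (- (l%:~R / p%:R)) 0 0 0.
  by rewrite /e1 !ex6E !oppr0 !addr0 subrK.
rewrite fscale_delta_quotp// -fsumZ.
have avT : avoids vx1 (vop p md (vop 1 Y (g r u)%:fs (varp vx0) v%:fs) (rootp p vx2) w%:fs).
  apply: avoids_vop_rootpr => //; rewrite -rootp1; apply: avoids_vop_rootp => //.
  exact: avoids_fconst.
(* The iterate does not involve [x1], so the exponent of [x1] forces [n / p - j = - k / p - 1], that
   is, the power [n = p (j - 1) - k] of the delta function. *)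
rewrite (@fsum_inj _ _ nat (fun j => (p%:Z * (j%:Z - 1) - k, j))); last 2 first.
- by move=> j j' [].
- move=> [n j] nj; rewrite avT ?scaler0//= !(expoD, expoN) !delta_coord /= ex6_coord.
  rewrite addr0 subr0; apply/eqP => E; apply: (nj j); congr (_, _).
  have En : n%:~R / p%:R = (p%:Z * (j%:Z - 1) - k)%:~R / p%:R :> rat.
    rewrite intrB intrM -pmulrn intrB -pmulrn mulrBl mulrAC mulfV// mul1r.
    by move: E => /eqP; rewrite subr_eq0 => /eqP; lra.
  by move/eqP: En; rewrite frac0 => /eqP.
apply: eq_fsbigr => j _ /=; set n := p%:Z * (j%:Z - 1) - k.
have z0 : z ^+ r != 0.
  apply: expf_neq0; apply/eqP => z0; move: zp; rewrite z0 expr0n (gtn_eqF p0) => /eqP.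
  by rewrite eq_sym oner_eq0.
(* The exponents [n] and [- k] differ by a multiple of [p], and [z ^ p = 1]. *)
have -> : (z ^+ r) ^ n = (z ^+ r) ^ (- k).
  rewrite /n expfzDr// -exprz_exp -[(z ^+ r) ^ p%:Z]/((z ^+ r) ^+ p) exprAC zp expr1n.
  by rewrite exp1rz mul1r.
have nE : n%:~R / p%:R = j%:R - 1 - k%:~R / p%:R :> C.
  have p0C : p%:R != 0 :> C by rewrite pnatr_eq0 -lt0n.
  by rewrite /n intrB intrM intrB -!pmulrn; field.
have nEq : n%:~R / p%:R = j%:R - 1 - k%:~R / p%:R :> rat.
  by rewrite /n intrB intrM intrB -!pmulrn; field.
rewrite fmorph_div /= ratr_int ratr_nat nE binc_opp scalerA; congr (_ *: _).
rewrite vop_rootpr// (@fsum_single _ _ (k + l - p%:Z * j%:Z)) => [|k' kk']; last first.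
  rewrite -rootp1 vop_rootp// fsum_eq0 ?(bilin0l md2)// => n'.
  rewrite /fconst ifF ?(bilin0r Y2)//; apply/eqP => /(congr1 (fun e : expo => e 0 vx2)).
  rewrite !(expoD, expoN) !delta_coord /= !ex6_coord mxE nEq.
  rewrite intrD -pmulrn mulrDl mulfV// => E; case/eqP: kk'.
  have : k'%:~R / p%:R = (k + l - p%:Z * j%:Z)%:~R / p%:R :> rat.
    rewrite !(intrD, intrN, intrM) -!pmulrn.
    transitivity (k%:~R / p%:R + l%:~R / p%:R - j%:R : rat); first by lra.
    by field.
  by move/eqP; rewrite frac0 => /eqP.
congr (md _ _ _); rewrite -rootp1 vop_rootp// (@fsum_single _ _ j%:Z) => [|n' nj']; last first.
  rewrite /fconst ifF ?(bilin0r Y2)//; apply/eqP => /(congr1 (fun e : expo => e 0 vx0)).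
  rewrite !(expoD, expoN) !delta_coord /= !ex6_coord mxE divr1 intrD -!pmulrn => E.
  by case/eqP: nj'; apply/eqP; rewrite -(eqr_int rat) -pmulrn; apply/eqP; lra.
rewrite /fconst ifT//; apply/eqP; rewrite nEq !ex6E -ex60.
have -> : (k + l - p%:Z * j%:Z + p%:Z)%:~R / p%:R = k%:~R / p%:R + l%:~R / p%:R - j%:R + 1 :> rat.
  by rewrite !(intrD, intrN, intrM) -!pmulrn; field.
by rewrite divr1 intrD -!pmulrn; congr ex6; ring.
Qed.

End JacobiCommutator.

Section Bilinear.
Variables (C : numFieldType) (V M : lmodType C) (md : V -> int -> M -> M).
Hypothesis md2 : bilin md.

Lemma bilinDl u v k w : md (u + v) k w = md u k w + md v k w.
Proof. by case: md2 => H _; rewrite -{1}[u]scale1r H scale1r. Qed.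

Lemma bilinZl a u k w : md (a *: u) k w = a *: md u k w.
Proof. by case: (md2) => H _; rewrite -[a *: u]addr0 H (bilin0l md2) addr0. Qed.

Lemma bilinDr v k w w' : md v k (w + w') = md v k w + md v k w'.
Proof. by case: md2 => _ H; rewrite -{1}[w]scale1r H scale1r. Qed.

Lemma bilinZr v k a w : md v k (a *: w) = a *: md v k w.
Proof. by case: (md2) => _ H; rewrite -[a *: w]addr0 H (bilin0r md2) addr0. Qed.

Lemma bilin_suml I (r : seq I) (P : pred I) (F : I -> V) k w :
  md (\sum_(i <- r | P i) F i) k w = \sum_(i <- r | P i) md (F i) k w.
Proof. by elim/big_rec2: _ => [|i x y _ <-]; rewrite ?(bilin0l md2) ?bilinDl. Qed.

Lemma bilin_sumr I (r : seq I) (P : pred I) (F : I -> M) v k :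
  md v k (\sum_(i <- r | P i) F i) = \sum_(i <- r | P i) md v k (F i).
Proof. by elim/big_rec2: _ => [|i x y _ <-]; rewrite ?(bilin0r md2) ?bilinDr. Qed.

Hypothesis md_trunc : truncated md.

Lemma trunc_nat v w (n : int) : exists N : nat, forall i : nat, (N <= i)%N -> md v (n + i%:Z) w = 0.
Proof.
have [N HN] := md_trunc v w; exists `|N - n|%N => i Ni; apply: HN; lia.
Qed.

End Bilinear.

(** Truncation bounds depend on the vectors involved; finitely many of them can be merged into
    one. *)
Lemma bound_all (K : nat) (P : nat -> nat -> Prop) :
  (forall j, exists N : nat, forall i, (N <= i)%N -> P j i) ->
  exists N : nat, forall j i, (j < K)%N -> (N <= i)%N -> P j i.
Proof.
move=> H; elim: K => [|K [N HN]]; first by exists 0%N.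
have [N' HN'] := H K; exists (maxn N N') => j i; rewrite ltnS leq_eqVlt geq_max.
by move=> /orP[/eqP ->|jK] /andP[Ni N'i]; [exact: HN'|exact: HN].
Qed.

(** * Signs and rearrangement of finite double sums *)

Section Sign.
Variable C : numFieldType.

Definition sgn (n : int) : C := (-1) ^ n.

Lemma sgnD m n : sgn (m + n) = sgn m * sgn n.
Proof. by rewrite /sgn expfzDr// oppr_eq0 oner_eq0. Qed.

Lemma sgn_nat (n : nat) : sgn n = (-1) ^+ n. Proof. by []. Qed.

Lemma sgn1 : sgn 1 = -1. Proof. by []. Qed.

Lemma sgnM n : sgn n * sgn n = 1.
Proof. by rewrite /sgn -expfzMl mulN1r opprK exp1rz. Qed.

Lemma sgnN n : sgn (- n) = sgn n.
Proof. by rewrite -[LHS]mulr1 -(sgnM n) mulrA -sgnD addNr mul1r. Qed.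

End Sign.

Section SumExchange.
Variable W : zmodType.

Lemma sum_widen (N K : nat) (F : nat -> W) : (N <= K)%N ->
  (forall i, (N <= i)%N -> F i = 0) -> \sum_(i < K) F i = \sum_(i < N) F i.
Proof.
move=> NK F0; rewrite (big_ord_widen K (fun i => F i) NK) [RHS]big_mkcond /=.
by apply: eq_bigr => i _; case: ltnP => // /F0.
Qed.

(** Resummation of a double sum by total degree. Any bounds [K] and [L] above the vanishing
    threshold are allowed, so one large bound can be used for all sums at once. *)
Lemma sum_antidiag (N K L : nat) (F : nat -> nat -> W) : (N <= K)%N -> (N <= L)%N ->
  (forall i j, (N <= i + j)%N -> F i j = 0) ->
  \sum_(i < K) \sum_(j < L) F i j = \sum_(s < N) \sum_(j < s.+1) F (s - j)%N j.
Proof.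
move=> NK NL F0.
have -> : \sum_(i < K) \sum_(j < L) F i j = \sum_(j < N) \sum_(i < N) F i j.
  rewrite exchange_big /= (@sum_widen N L (fun j => \sum_(i < K) F i j))//; last first.
    by move=> j Nj; rewrite big1// => i _; apply: F0; lia.
  apply: eq_bigr => j _; rewrite (@sum_widen N K (F^~ j))// => i Ni.
  by apply: F0; lia.
have -> : \sum_(s < N) \sum_(j < s.+1) F (s - j)%N j =
    \sum_(s < N) \sum_(j < N | (j <= s)%N) F (s - j)%N j.
  apply: eq_bigr => s _; rewrite (big_ord_widen N (fun j => F (s - j)%N j))//.
rewrite [RHS](exchange_big_dep predT)//=; apply: eq_bigr => j _.
rewrite (@sum_widen (N - j)%N N (F^~ j)) ?leq_subr// => [|i Ni]; last by apply: F0; lia.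
rewrite -[RHS](big_mkord (fun s => (j <= s)%N) (fun s => F (s - j)%N j)).
rewrite (@big_cat_nat _ _ _ j)//= 1?ltnW// [X in _ = X + _]big_nat_cond.
rewrite [X in _ = X + _]big1 ?add0r => [|i H]; last by exfalso; lia.
rewrite -[X in _ = \sum_(X <= _ < _ | _) _]add0n big_addn big_mkord.
apply: eq_big => [i|i _]; last by rewrite addnK.
by rewrite leq_addl.
Qed.

End SumExchange.

(** * Modes of a vertex operator algebra *)

Section VoaModes.
Variables (C : numFieldType) (V : voa C).
Implicit Types u v w : V.
Local Notation Y := (@voa_md C V).
Local Notation "1v" := (vac V).
Local Notation om := (omega V).

Let Y2 : bilin Y := voa_bilin V.

Lemma voa_commutator u v w (m n : int) (N : nat) :
  (forall i : nat, (N <= i)%N -> Y u i v = 0) ->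
  Y u m (Y v n w) - Y v n (Y u m w) =
  \sum_(i < N) binc (m%:~R : C) i *: Y (Y u i v) (m + n - i%:Z) w.
Proof.
move=> HN; rewrite (@jacobi_commutator _ V V 1 Y Y 1 (fun=> id) u v w)//; last first.
  rewrite /= !rootp1 (voa_jacobi u v w) big_ord1 expr0 scalep1 invr1 scale1r.
  by [].
rewrite big_ord1 invr1 expr0 exp1rz !scale1r (@fsum_ord _ N) => [|i /HN ->]; last first.
  by rewrite (bilin0l Y2) scaler0.
by apply: eq_bigr => i _; rewrite mulr1 mul1r.
Qed.

Lemma voa_deriv_mode u n v : Y (Y om 0 u) n v = - n%:~R *: Y u (n - 1) v.
Proof.
have coef a (k : int) : vop 1 Y a%:fs (varp vx1) v%:fs ((- k%:~R - 1) *: delta_mx 0 vx1) = Y a k v.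
  have E k' : - k%:~R - 1 + (k' + 1%:Z)%:~R / 1%:R = (k' - k)%:~R :> rat.
    by rewrite divr1 intrB intrD; ring.
  rewrite -rootp1 vop_rootp// (@fsum_single _ _ k) => [|k' kk']; rewrite -scalerDl E /fconst.
    by rewrite subrr scale0r eqxx.
  rewrite ifF ?(bilin0r Y2)//; apply/eqP => /(congr1 (fun e : expo => e 0 vx1)).
  by rewrite delta_coord mxE => /eqP; rewrite intr_eq0 subr_eq0 (negPf kk').
rewrite -coef voa_deriv /fderiv delta_coord /= -{2}[delta_mx 0 vx1]scale1r -scalerDl.
have -> : - n%:~R - 1 + 1 = - (n - 1)%:~R - 1 :> rat by rewrite intrB; ring.
rewrite coef; congr (_ *: _).
by rewrite intrB opprB addrAC subrr add0r rmorphN /= ratr_int.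
Qed.

(** Homogeneity as an eigenvalue equation for [L(0) = omega_1], which combines directly with
    commutators; [homog_pr] and [pr_homog] relate it to the grading projections. *)
Definition homog (h : int) u := Y om 1 u = h%:~R *: u.

Lemma homog_pr h u : homog h (voa_pr V h u).
Proof.
apply: voa_L0; case: (voa_grading V) => [prpr _ _ _ _]; by rewrite prpr eqxx.
Qed.

Lemma commutator0 u n w : Y om 0 (Y u n w) - Y u n (Y om 0 w) = Y (Y om 0 u) n w.
Proof.
have [N HN] := trunc_nat (@voa_trunc _ V) om u 0.
have HN' (i : nat) : (N <= i)%N -> Y om i u = 0 by move=> /HN; rewrite add0r.
(* The bound is [N.+1] so that the sum has a first term, the only one for which [binc 0 i] is
   nonzero. *)
rewrite (@voa_commutator om u w 0 n N.+1) => [|i Ni]; last by apply: HN'; exact: ltnW.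
rewrite big_ord_recl binc0 scale1r big1 ?addr0 => [|i _]; first by congr (Y _ _ w) => /=; lia.
by rewrite -[0%:~R]/(0%:R : C) binc_nat bin_small// scale0r.
Qed.

Lemma commutator1 u n w :
  Y om 1 (Y u n w) - Y u n (Y om 1 w) = Y (Y om 0 u) (n + 1) w + Y (Y om 1 u) n w.
Proof.
have [N HN] := trunc_nat (@voa_trunc _ V) om u 0.
have HN' (i : nat) : (N <= i)%N -> Y om i u = 0 by move=> /HN; rewrite add0r.
rewrite (@voa_commutator om u w 1 n N.+2) => [|i Ni]; last by apply: HN'; exact: ltnW (ltnW Ni).
rewrite !big_ord_recl binc0 big1 ?addr0 => [|i _].
  rewrite -[1%:~R]/(1%:R : C) binc_nat bin1 !scale1r.
  by congr (Y (Y om _ u) _ w + Y (Y om _ u) _ w); rewrite ?lift0 /=; lia.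
by rewrite -[1%:~R]/(1%:R : C) binc_nat bin_small// scale0r.
Qed.

Lemma homog_mode h h' u v n : homog h u -> homog h' v -> homog (h + h' - n - 1) (Y u n v).
Proof.
move=> hu hv; have := commutator1 u n v; rewrite hu hv (bilinZr Y2) (bilinZl Y2) voa_deriv_mode.
move/eqP; rewrite subr_eq addrK => /eqP; rewrite /homog => ->.
rewrite -!scalerDl; congr (_ *: _); rewrite !(intrD, intrN); ring.
Qed.

Local Notation T := (Y om 0).

Lemma translation_comm v n w : T (Y v n w) = Y v n (T w) - n%:~R *: Y v (n - 1) w.
Proof. by apply/eqP; rewrite addrC -subr_eq commutator0 voa_deriv_mode scaleNr. Qed.

(** The coefficients of [Y(u, x) 1 = e ^ (x T) u], from the creation property and the
    [L(-1)]-derivative property. *)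
Lemma vac_mode u (k : nat) : Y u (- k%:Z - 1) 1v = (k`!%:R)^-1 *: iter k T u.
Proof.
elim: k u => [|k IH] u.
  by case: (voa_creation u) => _; rewrite oppr0 add0r invr1 scale1r.
have k0 : k.+1%:R != 0 :> C by rewrite pnatr_eq0.
apply: (scalerI k0); rewrite factS natrM invfM scalerA mulVKf// iterSr -IH voa_deriv_mode.
have -> : - k%:Z - 1 = - k.+1%:Z by lia.
by rewrite mulrNz opprK -pmulrn.
Qed.

Lemma bincN1 i : binc (-1 : C) i = (-1) ^+ i.
Proof.
elim: i => [|i IH]; first by rewrite binc0.
have i0 : i.+1%:R != 0 :> C by rewrite pnatr_eq0.
by apply: (mulfI i0); rewrite bincS IH exprS -natr1; ring.
Qed.

Lemma iter_TD k u v : iter k T (u + v) = iter k T u + iter k T v.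
Proof. by elim: k => //= k ->; rewrite (bilinDr Y2). Qed.

Lemma iter_TZ k a u : iter k T (a *: u) = a *: iter k T u.
Proof. by elim: k => //= k ->; rewrite (bilinZr Y2). Qed.

Lemma iter_T0 k : iter k T 0 = 0.
Proof. by elim: k => //= k ->; rewrite (bilin0r Y2). Qed.

(** The coefficients of [Y(u, x) v = e ^ (x T) Y(v, - x) u]. For [n >= -1], write [v = v_(-1) 1] and
    commute [u_n] past [v_(-1)]: the modes on the vacuum are known. For smaller [n], the derivative
    property lowers [n] at the cost of replacing [u] by [T u]. *)
Lemma voa_skew u v n (N : nat) : (forall i : nat, (N <= i)%N -> Y v (n + i%:Z) u = 0) ->
  Y u n v = \sum_(i < N) (sgn C (n + i%:Z + 1) / i`!%:R) *: iter i T (Y v (n + i%:Z) u).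
Proof.
have vac0 (u' : V) (k : int) : 0 <= k -> Y u' k 1v = 0.
  by case: (voa_creation u') => H _; exact: H.
have vac1 u' : Y u' (-1) 1v = u' by case: (voa_creation u').
have comm u' v' (n' : int) K : (forall i : nat, (K <= i)%N -> Y v' i u' = 0) ->
    Y u' n' v' = Y v' (-1) (Y u' n' 1v) - \sum_(i < K) (-1) ^+ i *: Y (Y v' i u') (n' - 1 - i%:Z) 1v.
  move=> HK; have := @voa_commutator v' u' 1v (-1) n' K HK; rewrite vac1 => H.
  rewrite -[LHS](subKr (Y v' (-1) (Y u' n' 1v))) H; congr (_ - _).
  apply: eq_bigr => i _; rewrite -[(-1)%:~R]/(-1 : C) bincN1.
  by congr (_ *: Y _ _ _); lia.
elim/int_ind: n u v N => [|a _|[|a] IH] u v N HN.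
- rewrite (comm _ _ _ N) => [|i /HN]; last by rewrite add0r.
  rewrite vac0// (bilin0r Y2) sub0r -sumrN; apply: eq_bigr => i _.
  have -> : 0 - 1 - i%:Z = - i%:Z - 1 by lia.
  rewrite vac_mode scalerA -scaleNr add0r; congr (_ *: _).
  by rewrite sgnD sgn1 sgn_nat; ring.
- rewrite (comm _ _ _ (a.+1 + N)%N) => [|i]; last first.
    move=> Ni; have -> : i%:Z = a.+1%:Z + (i - a.+1)%N%:Z by lia.
    by apply: HN; lia.
  rewrite vac0// (bilin0r Y2) sub0r -sumrN big_split_ord /= big1 ?add0r => [|i _]; last first.
    by rewrite vac0 ?scaler0 ?oppr0//; have := ltn_ord i; lia.
  apply: eq_bigr => i _.
  have -> : a.+1%:Z - 1 - (a.+1 + i)%N%:Z = - i%:Z - 1 by lia.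
  rewrite vac_mode scalerA -scaleNr PoszD; congr (_ *: _).
  by rewrite sgnD sgn1 sgnD !sgn_nat exprD; ring.
- pose F (i : nat) := (sgn C (- 1%:Z + i%:Z + 1) / i`!%:R) *: iter i T (Y v (- 1%:Z + i%:Z) u).
  rewrite -[RHS]/(\sum_(i < N) F i) -(@sum_widen _ N N.+1 F)// => [|i /HN]; last first.
    by rewrite /F => ->; rewrite iter_T0 scaler0.
  rewrite (comm _ _ _ N) => [|i Ni]; last first.
    have -> : i%:Z = - 1%:Z + i.+1%:Z by lia.
    exact/HN/leqW.
  rewrite -[- 1%:Z]/(-1 : int) vac1 big_ord_recl; congr (_ + _).
    by rewrite /F /= addr0 addNr divr1 scale1r.
  rewrite -sumrN; apply: eq_bigr => i _; rewrite /F lift0.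
  have -> : -1 - 1 - i%:Z = - i.+1%:Z - 1 by lia.
  have -> : - 1%:Z + i.+1%:Z = i%:Z by lia.
  by rewrite vac_mode scalerA -scaleNr sgnD sgn1 sgn_nat; congr (_ *: _); ring.
(* Since [n] is negative, the factor in [(T u)_n = - n u_(n-1)] can be cancelled. *)
set n : int := - a.+1%:Z in IH *.
have -> : - a.+2%:Z = n - 1 by rewrite /n; lia.
have n0 : - n%:~R != 0 :> C by rewrite oppr_eq0 intr_eq0.
apply: (scalerI n0); rewrite -voa_deriv_mode.
have HN' (i : nat) : (N <= i)%N -> Y v (n - 1 + i%:Z) u = 0.
  by move=> /HN; rewrite (_ : - a.+2%:Z = n - 1)//; rewrite /n; lia.
have [N1 HN1] := trunc_nat (@voa_trunc _ V) v (T u) n.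
set K := maxn N N1.
rewrite (IH _ _ K) => [|i]; last by rewrite geq_max => /andP[_ /HN1].
pose G (i : nat) := i`!%:R^-1 *: iter i T (Y v (n - 1 + i%:Z) u).
have G0 (i : nat) : (N <= i)%N -> G i = 0 by move=> /HN'; rewrite /G => ->; rewrite iter_T0 scaler0.
(* Moving [T] from [u] to the outside produces two sums, which recombine after a shift of the
   index. *)
transitivity (\sum_(i < K) ((sgn C (n + i.+1%:Z) * i.+1%:R) *: G i.+1 -
    (sgn C (n + i%:Z) * (n%:~R + i%:R)) *: G i)).
  apply: eq_bigr => i _.
  have -> : Y v (n + i%:Z) (T u) = T (Y v (n + i%:Z) u) + (n + i%:Z)%:~R *: Y v (n + i%:Z - 1) u.
    by rewrite translation_comm subrK.
  rewrite iter_TD iter_TZ -iterSr scalerDr /G !scalerA; congr (_ + _).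
    have -> : n - 1 + i.+1%:Z = n + i%:Z by lia.
    have -> : n + i.+1%:Z = n + i%:Z + 1 by lia.
    congr (_ *: _); rewrite factS natrM; have := fact_neq0 C i.
    have : i.+1%:R != 0 :> C by rewrite pnatr_eq0.
    by move: i.+1%:R i`!%:R => x y x0 y0; field; apply/andP.
  have -> : n - 1 + i%:Z = n + i%:Z - 1 by lia.
  by rewrite -scaleNr; congr (_ *: _); rewrite sgnD sgn1 intrD -pmulrn; ring.
rewrite big_split /= sumrN.
have -> : \sum_(i < K) (sgn C (n + i.+1%:Z) * i.+1%:R) *: G i.+1 =
    \sum_(i < K) (sgn C (n + i%:Z) * i%:R) *: G i.
  have := erefl (\sum_(i < K.+1) (sgn C (n + i%:Z) * i%:R) *: G i).
  rewrite {1}big_ord_recl big_ord_recr /= mulr0 scale0r add0r (G0 K) ?leq_maxl// scaler0 addr0.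
  by [].
rewrite -sumrB scaler_sumr -(@sum_widen _ N K (fun i => - n%:~R *:
  ((sgn C (n - 1 + i%:Z + 1) / i`!%:R) *: iter i T (Y v (n - 1 + i%:Z) u)))) ?leq_maxl//; last first.
  by move=> i /HN' ->; rewrite iter_T0 !scaler0.
apply: eq_bigr => i _; rewrite -scalerBl /G !scalerA; congr (_ *: _).
have -> : n - 1 + i%:Z + 1 = n + i%:Z by lia.
by ring.
Qed.

End VoaModes.

Lemma sum_triangle (W : zmodType) (q : nat) (F : nat -> nat -> W) :
  \sum_(j < q.+1) \sum_(i < (q - j).+1) F j i = \sum_(i < q.+1) \sum_(j < (q - i).+1) F j i.
Proof.
have E (G : nat -> nat -> W) : \sum_(j < q.+1) \sum_(i < (q - j).+1) G j i =
    \sum_(j < q.+1) \sum_(i < q.+1) if (j + i <= q)%N then G j i else 0.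
  apply: eq_bigr => j _; have jq := ltn_ord j.
  rewrite (@sum_widen _ (q - j).+1 q.+1 (fun i => if (j + i <= q)%N then G j i else 0)).
  - by apply: eq_bigr => i _; rewrite ifT//; have := ltn_ord i; lia.
  - by lia.
  - by move=> i ji; rewrite ifF//; apply/negbTE; lia.
rewrite E (E (fun i j => F j i)) exchange_big /=.
by apply: eq_bigr => i _; apply: eq_bigr => j _; rewrite addnC.
Qed.

(** * Zhu's vertex operators *)

Section ZhuModes.
Variables (C : numFieldType) (V : voa C).
Implicit Types u v w : V.
Local Notation Y := (@voa_md C V).
Local Notation om := (omega V).
Local Notation T := (Y om 0).
Local Notation Z := (@zhu_md C V).

Let Y2 : bilin Y := voa_bilin V.
Let Yt : truncated Y := @voa_trunc C V.

Lemma homog_components u : exists L : seq V,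
  (forall x, x \in L -> exists h, homog h x) /\ u = \sum_(x <- L) x.
Proof.
case: (voa_grading V) => _ _ uE _ _.
exists [seq voa_pr V h u | h <- finite_support 0 [set: int] (fun h => voa_pr V h u)].
rewrite big_map; split=> [x /mapP[h _ ->]|]; last exact: uE.
by exists h; exact: homog_pr.
Qed.

Lemma homog_ind (P : V -> Prop) : P 0 -> (forall u v, P u -> P v -> P (u + v)) ->
  (forall h u, homog h u -> P u) -> forall u, P u.
Proof.
move=> P0 PD Ph u; have [L [HL ->]] := homog_components u.
elim: L HL => [|x L IH] HL; first by rewrite big_nil.
rewrite big_cons; apply: PD; first by have [h /Ph] := HL x (mem_head _ _).
by apply: IH => y yL; apply: HL; rewrite inE yL orbT.
Qed.

Definition L0pow (j : nat) u : V := (j`!%:R : C)^-1 *: iter j (Y om 1) u.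

Lemma L0powD j u v : L0pow j (u + v) = L0pow j u + L0pow j v.
Proof.
rewrite /L0pow -scalerDr; congr (_ *: _).
by elim: j => //= j ->; rewrite (bilinDr Y2).
Qed.

Lemma L0pow_homog h j u : homog h u -> L0pow j u = ps_exp (h%:~R : C) j *: u.
Proof.
move=> hu; rewrite /L0pow /ps_exp mulrC -scalerA; congr (_ *: _).
by elim: j => [|j /= ->]; rewrite ?expr0 ?scale1r// (bilinZr Y2) hu scalerA -exprSr.
Qed.

Lemma expyL0E u (s : int) : expyL0 u (s%:~R *: delta_mx 0 vy) = if s is Posz j then L0pow j u else 0.
Proof.
have E (j : nat) : fscale (mono vy j%:R) (L0pow j u)%:fs (s%:~R *: delta_mx 0 vy) =
    if s == j then L0pow j u else 0.
  rewrite fscale_mono /fconst subr_eq0 pmulrn (inj_eq delta_vy_inj).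
  by [].
rewrite /expyL0 /fsum (fsum_eq E); case: s {E} => j; last by apply: fsum_eq0.
by rewrite (@fsum_single _ _ j) ?eqxx// => i ij; rewrite ifF//; apply/negbTE; rewrite eq_sym.
Qed.

(** The part of the mode [n] of [Y[u, y] v] that comes from the mode [n + a] of [Y(u, x) v]. Lower
    modes do not contribute, since [e ^ y - 1] has order 1 in [y] and [e ^ (y L(0))] has no negative
    powers. *)
Definition zhu_term u (n : int) v (a : nat) : V :=
  \sum_(i < a.+1) ps_quotz C (- (n + a%:Z) - 1) i *: Y (L0pow (a - i) u) (n + a%:Z) v.

Lemma zhu_mdE u n v : Z u n v = \sum_(a \in [set: nat]) zhu_term u n v a.
Proof.
rewrite /zhu_md vop_constr//.
have E (k : int) : fscale (expm1p C (- k - 1%:Z)) (fmapc (Y^~ k ^~ v) (expyL0 u))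
     ((- n - 1)%:~R *: delta_mx 0 vy) =
    \sum_(i \in [set: nat]) ps_quotz C (- k - 1) i *:
       Y (if k - n - i%:Z is Posz j then L0pow j u else 0) k v.
  rewrite expm1p_laurent fscale_laurent; apply: fsum_eq => i; rewrite /fmapc.
  rewrite -scalerBl -intrB (_ : - n - 1 - _ = k - n - i%:Z) ?expyL0E//.
  by rewrite -[1%:Z]/(1 : int); ring.
rewrite (fsum_eq E) (@fsum_inj _ _ nat (fun a => n + a%:Z)).
- apply: fsum_eq => a; rewrite (@fsum_ord _ a.+1) => [|i ai].
    apply: eq_bigr => i _; have ia : (i <= a)%N by rewrite -ltnS.
    by have -> : n + a%:Z - n - i%:Z = (a - i)%N%:Z by lia.
  have [j ->] : exists j, n + a%:Z - n - i%:Z = Negz j by exists (i - a.+1)%N; lia.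
  by rewrite (bilin0l Y2) scaler0.
- by move=> a b /addrI[].
- move=> k kn; apply: fsum_eq0 => i.
  have [j ->] : exists j, k - n - i%:Z = Negz j.
    have kn' : k < n.
      by rewrite ltNge; apply/negP => nk; apply: (kn `|(k - n)%R|%N); lia.
    by exists `|(k - n - i%:Z + 1)%R|%N; lia.
  by rewrite (bilin0l Y2) scaler0.
Qed.

Lemma zhu_term_homog h u n v a : homog h u ->
  zhu_term u n v a = zhu_ser (h%:~R : C) (- (n + a%:Z) - 1) a *: Y u (n + a%:Z) v.
Proof.
move=> hu; rewrite /zhu_term /zhu_ser mulrC psM scaler_suml; apply: eq_bigr => i _.
by rewrite (L0pow_homog _ hu) (bilinZl Y2) scalerA.
Qed.

Lemma zhu_termD u u' n v a : zhu_term (u + u') n v a = zhu_term u n v a + zhu_term u' n v a.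
Proof.
rewrite /zhu_term -big_split; apply: eq_bigr => i _.
by rewrite L0powD (bilinDl Y2) scalerDr.
Qed.

Lemma zhu_term0 n v a : zhu_term 0 n v a = 0.
Proof. by apply: (addrI (zhu_term 0 n v a)); rewrite -zhu_termD !addr0. Qed.

Lemma zhu_term_trunc u n v : exists N : nat, forall a, (N <= a)%N -> zhu_term u n v a = 0.
Proof.
elim/homog_ind: u => [|u u' [N HN] [N' HN']|h u hu].
- by exists 0%N => a _; rewrite zhu_term0.
- exists (maxn N N') => a; rewrite geq_max zhu_termD => /andP[/HN -> /HN' ->].
  by rewrite addr0.
have [N HN] := trunc_nat Yt u v n; exists N => a /HN Ya.
by rewrite (zhu_term_homog _ _ _ hu) Ya scaler0.
Qed.

Lemma zhu_homog h u n v (N : nat) : homog h u ->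
  (forall i : nat, (N <= i)%N -> Y u (n + i%:Z) v = 0) ->
  Z u n v = \sum_(i < N) zhu_ser (h%:~R : C) (- (n + i%:Z) - 1) i *: Y u (n + i%:Z) v.
Proof.
move=> hu HN; rewrite zhu_mdE (@fsum_ord _ N) => [|i /HN Yi]; last first.
  by rewrite (zhu_term_homog _ _ _ hu) Yi scaler0.
by apply: eq_bigr => i _; rewrite (zhu_term_homog _ _ _ hu).
Qed.

(** Sums over all of [nat] are additive only when the supports are finite; a common truncation bound
    turns all three into finite sums. *)
Lemma zhuDl u u' n v : Z (u + u') n v = Z u n v + Z u' n v.
Proof.
have [N HN] := zhu_term_trunc u n v; have [N' HN'] := zhu_term_trunc u' n v.
rewrite !zhu_mdE !(@fsum_ord _ (maxn N N')).
- by rewrite -big_split; apply: eq_bigr => i _; rewrite zhu_termD.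
- by move=> i; rewrite geq_max => /andP[_ /HN' ->].
- by move=> i; rewrite geq_max => /andP[/HN ->].
- by move=> i; rewrite geq_max zhu_termD => /andP[/HN -> /HN' ->]; rewrite addr0.
Qed.

Lemma zhuZl a u n v : Z (a *: u) n v = a *: Z u n v.
Proof.
rewrite !zhu_mdE -fsumZ; apply: fsum_eq => i; rewrite /zhu_term scaler_sumr.
apply: eq_bigr => j _; have -> : L0pow (i - j) (a *: u) = a *: L0pow (i - j) u.
  rewrite /L0pow scalerA mulrC -scalerA; congr (_ *: _).
  by elim: (i - j)%N => //= k ->; rewrite (bilinZr Y2).
by rewrite (bilinZl Y2) !scalerA mulrC.
Qed.

Lemma zhu_bilin : bilin Z.
Proof.
split=> [k a u v w|k v a w w']; first by rewrite zhuDl zhuZl.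
have [N HN] := zhu_term_trunc v k w; have [N' HN'] := zhu_term_trunc v k w'.
have tE i : zhu_term v k (a *: w + w') i = a *: zhu_term v k w i + zhu_term v k w' i.
  rewrite /zhu_term scaler_sumr -big_split; apply: eq_bigr => j _.
  by rewrite (bilinDr Y2) (bilinZr Y2) scalerDr !scalerA mulrC.
rewrite !zhu_mdE !(@fsum_ord _ (maxn N N')).
- by rewrite scaler_sumr -big_split; apply: eq_bigr => i _; rewrite tE.
- by move=> i; rewrite geq_max => /andP[_ /HN' ->].
- by move=> i; rewrite geq_max => /andP[/HN ->].
- by move=> i; rewrite geq_max tE => /andP[/HN -> /HN' ->]; rewrite scaler0 addr0.
Qed.

Lemma zhu_trunc : truncated Z.
Proof.
move=> u v; elim/homog_ind: u => [|u u' [N HN] [N' HN']|h u hu].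
- by exists 0 => k _; rewrite (bilin0l zhu_bilin).
- exists (Num.max N N') => k; rewrite ge_max zhuDl => /andP[/HN -> /HN' ->].
  by rewrite addr0.
have [N HN] := Yt u v; exists N => k Nk; rewrite (@zhu_homog h _ _ _ 0)// ?big_ord0// => i _.
by apply: HN; lia.
Qed.

End ZhuModes.

(** * Translation and skew-symmetry for [Y[u, y]] *)

Section ZhuTranslation.
Variables (C : numFieldType) (V : voa C).
Implicit Types u v w : V.
Local Notation Y := (@voa_md C V).
Local Notation om := (omega V).
Local Notation T := (Y om 0).
Local Notation Z := (@zhu_md C V).
Local Notation zs := (@zhu_ser C).

Let Y2 : bilin Y := voa_bilin V.
Let Yt : truncated Y := @voa_trunc C V.

Lemma homog_T h u : homog h u -> homog (h + 1) (T u).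
Proof.
move=> hu; have : Y om 1 (T u) - T (Y om 1 u) = 1%:~R *: T u + 0 *: u.
  exact: (@voa_virasoro C V 0 (-1) u).
rewrite scale0r addr0 hu (bilinZr Y2) /homog => /eqP.
by rewrite subr_eq => /eqP ->; rewrite -scalerDl intrD addrC.
Qed.

Lemma homog_iterT h k u : homog h u -> homog (h + k%:Z) (iter k T u).
Proof.
move=> hu; elim: k => [|k IH]; first by rewrite addr0.
by have := homog_T IH; rewrite (_ : h + k%:Z + 1 = h + k.+1%:Z)//; lia.
Qed.

(** Zhu's operator [L[-1]], the translation operator of [Y[., y]]. *)
Definition zhu_D u : V := T u + Y om 1 u.

Lemma zhu_DD u v : zhu_D (u + v) = zhu_D u + zhu_D v.
Proof. by rewrite /zhu_D !(bilinDr Y2) addrACA. Qed.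

Lemma zhu_DZ a u : zhu_D (a *: u) = a *: zhu_D u.
Proof. by rewrite /zhu_D !(bilinZr Y2) scalerDr. Qed.

(** The coefficient of [y ^ s], times [s!], in [e ^ (y (T + L(0))) w = e ^ ((e ^ y - 1) T) e ^ (y
    L(0)) w], a consequence of [[L(0), T] = T]. The induction matches coefficients through
    [zhu_ser_deriv] and [zhu_ser_pascal]. *)
Lemma iter_zhu_D g w s : homog g w -> iter s zhu_D w =
  \sum_(i < s.+1) (s`!%:R * zs g%:~R i%:Z (s - i)%N / i`!%:R) *: iter i T w.
Proof.
move=> gw; elim: s => [|s IH].
  by rewrite big_ord1 zhu_ser0 !divr1 mulr1 scale1r.
have zD I (r : seq I) P (F : I -> V) : zhu_D (\sum_(i <- r | P i) F i) = \sum_(i <- r | P i) zhu_D (F i).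
  elim/big_rec2: _ => [|i x y _ <-]; last by rewrite zhu_DD.
  by rewrite /zhu_D !(bilin0r Y2) addr0.
rewrite iterS IH zD.
transitivity (\sum_(i < s.+1) ((s`!%:R * zs g%:~R i%:Z (s - i)%N / i`!%:R) *: iter i.+1 T w +
    (s`!%:R * zs g%:~R i%:Z (s - i)%N / i`!%:R * (g%:~R + i%:R)) *: iter i T w)).
  apply: eq_bigr => i _; rewrite zhu_DZ /zhu_D scalerDr (homog_iterT i gw) scalerA.
  by rewrite intrD -pmulrn.
rewrite big_split /= [in LHS]big_ord_recr [X in _ + X]big_ord_recl /=.
rewrite [RHS]big_ord_recl [X in _ = _ + X]big_ord_recr /= subnn !zhu_ser0 !subn0.
have f0 := fact_neq0 C.
have -> : s`!%:R * 1 / s`!%:R = s.+1`!%:R * 1 / s.+1`!%:R :> C by rewrite !mulr1 !divff.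
rewrite addrC -!addrA; congr (_ + _).
  congr (_ *: _); rewrite addr0 factS natrM !divr1.
  have := zhu_ser_deriv (g%:~R : C) 0 s; rewrite mulr0z add0r mul0r addr0 => H.
  by rewrite -[Posz 0]/(0 : int) [RHS]mulrAC H; ring.
rewrite addrA; congr (_ + _); last by rewrite /bump /= !add1n subnn zhu_ser0.
rewrite -big_split; apply: eq_bigr => i _; rewrite /= -scalerDl /bump /= !add1n; congr (_ *: _).
have is1 := ltn_ord i.
have -> : (s - i = (s - i.+1).+1)%N by lia.
rewrite subSS; have -> : (s - i = (s - i.+1).+1)%N by lia.
set k := (s - i.+1)%N.
have H1 := zhu_ser_deriv (g%:~R : C) i.+1 k.
have H2 := zhu_ser_pascal (g%:~R : C) i%:Z k.
have E : i.+1%:Z - 1 = i%:Z by lia.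
have E' : i%:Z + 1 = i.+1%:Z by lia.
move: H1 H2; rewrite E E' => H1 H2.
have sE : s.+1%:R = i.+1%:R + k.+1%:R :> C by rewrite -natrD; congr (_%:R); rewrite /k; lia.
rewrite [s.+1`!]factS [i.+1`!]factS !natrM sE.
have -> : (i.+1%:R + k.+1%:R) * s`!%:R * zs g%:~R i.+1 k.+1 / (i.+1%:R * i`!%:R) =
    s`!%:R / (i.+1%:R * i`!%:R) * (g%:~R * zs g%:~R i.+1 k + i.+1%:R * zs (g%:~R + 1) i k.+1).
  by rewrite -[i.+1%:R in X in _ = _ * (_ + X)]/(i.+1%:~R) -H1 -[i.+1%:~R]/(i.+1%:R); ring.
rewrite H2; have := f0 i; have : i.+1%:R != 0 :> C by rewrite pnatr_eq0.
by move: i.+1%:R i`!%:R => x y x0 y0; field; apply/andP.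
Qed.

(** Both sides are expanded in the vectors [T ^ i (v_(n+q) u) / i!], the left by skew-symmetry of
    [Y], the right by [iter_zhu_D]. The coefficients agree by the reflection [y -> - y] and the
    multiplicativity of [zhu_ser]. *)
Lemma zhu_skew_homog h h' u v n (N : nat) : homog h u -> homog h' v ->
  (forall i : nat, (N <= i)%N -> Y v (n + i%:Z) u = 0) ->
  Z u n v = \sum_(i < N) (sgn C (n + i%:Z + 1) / i`!%:R) *: iter i zhu_D (Z v (n + i%:Z) u).
Proof.
move=> hu hv HN.
have HN' s (i : nat) : (N <= s + i)%N -> Y v (n + s%:Z + i%:Z) u = 0.
  by move=> /HN; rewrite PoszD addrA.
pose G (q i : nat) := (i`!%:R : C)^-1 *: iter i T (Y v (n + q%:Z) u).
have G0 q i : (N <= q)%N -> G q i = 0 by move=> /HN; rewrite /G => ->; rewrite iter_T0 scaler0.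
have Yu (k : nat) : Y u (n + k%:Z) v = \sum_(i < N) sgn C (n + (k + i)%N%:Z + 1) *: G (k + i)%N i.
  rewrite (@voa_skew _ _ _ _ _ N) => [|i Ni]; last by apply: HN'; lia.
  by apply: eq_bigr => i _; rewrite /G scalerA PoszD !addrA.
rewrite (@zhu_homog _ _ h _ _ _ N) => [|//|k Nk]; last first.
  by rewrite Yu big1// => i _; rewrite G0 ?scaler0//; lia.
pose F (k i : nat) := (zs h%:~R (- (n + k%:Z) - 1) k * sgn C (n + (k + i)%N%:Z + 1)) *: G (k + i)%N i.
transitivity (\sum_(k < N) \sum_(i < N) F k i).
  by apply: eq_bigr => k _; rewrite Yu scaler_sumr; apply: eq_bigr => i _; rewrite scalerA.
rewrite (@sum_antidiag _ N) => [|//|//|k i Nki]; last by rewrite /F G0 ?scaler0.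
pose F' (s j : nat) := (sgn C (n + s%:Z + 1) / s`!%:R * zs h'%:~R (- (n + s%:Z + j%:Z) - 1) j) *:
   iter s zhu_D (Y v (n + (s + j)%N%:Z) u).
have zDit0 s : iter s zhu_D 0 = 0.
  by elim: s => //= s ->; rewrite /zhu_D !(bilin0r Y2) addr0.
have zDit_sum s (r : seq 'I_N) (E : 'I_N -> V) : iter s zhu_D (\sum_(i <- r) E i) = \sum_(i <- r) iter s zhu_D (E i).
  elim: s => //= s ->; elim/big_rec2: _ => [|i x y _ <-]; last by rewrite zhu_DD.
  by rewrite /zhu_D !(bilin0r Y2) addr0.
have zDitZ s a w : iter s zhu_D (a *: w) = a *: iter s zhu_D w.
  by elim: s => //= s ->; rewrite zhu_DZ.
transitivity (\sum_(s < N) \sum_(j < N) F' s j); last first.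
  apply: eq_bigr => s _; rewrite (@zhu_homog _ _ h' _ _ _ N) => [|//|i Ni]; last by apply: HN'; lia.
  rewrite zDit_sum scaler_sumr; apply: eq_bigr => j _.
  by rewrite zDitZ scalerA /F' PoszD addrA.
rewrite [RHS](@sum_antidiag _ N) => [|//|//|s j Nsj]; last by rewrite /F' HN// zDit0 scaler0.
apply: eq_bigr => q _.
pose kp := - (n + q%:Z) - 1; pose g := h' + h - (n + q%:Z) - 1.
have hg : homog g (Y v (n + q%:Z) u) by exact: homog_mode.
transitivity (\sum_(j < q.+1) \sum_(i < (q - j).+1)
   (sgn C (n + (q - j)%N%:Z + 1) * zs h'%:~R kp j * zs g%:~R i%:Z (q - j - i)%N) *: G q i); last first.
  apply: eq_bigr => j _; have jq : (j <= q)%N by rewrite -ltnS.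
  rewrite /F' subnK// (iter_zhu_D _ hg) scaler_sumr; apply: eq_bigr => i _.
  rewrite /G !scalerA /kp (_ : n + (q - j)%N%:Z + j%:Z = n + q%:Z); last by lia.
  congr (_ *: _); have := fact_neq0 C (q - j); have := fact_neq0 C i.
  by move: (q - j)`!%:R i`!%:R => x y x0 y0; field; apply/andP.
rewrite (sum_triangle q (fun j i => (sgn C (n + (q - j)%N%:Z + 1) * zs h'%:~R kp j * zs g%:~R i%:Z (q - j - i)%N) *: G q i)).
apply: eq_bigr => i _; have iq : (i <= q)%N by rewrite -ltnS.
rewrite -scaler_suml /F subnK//; congr (_ *: _).
have -> : - (n + (q - i)%N%:Z) - 1 = kp + i%:Z by rewrite /kp; lia.
(* The weight [g] of [v_(n+q) u] is such that [- h' - kp + g = h]. *)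
have -> : zs h%:~R (kp + i%:Z) (q - i)%N = (zs (- h'%:~R - kp%:~R) kp * zs g%:~R i%:Z) (q - i)%N.
  rewrite zhu_serM; congr (zs _ _ _).
  by rewrite /g /kp !(intrD, intrN); ring.
rewrite psM mulr_suml; apply: eq_bigr => j _; rewrite -zhu_ser_refl.
have jqi := ltn_ord j; have -> : (q - j - i = q - i - j)%N by lia.
have -> : n + (q - j)%N%:Z + 1 = n + q%:Z + 1 - j%:Z by lia.
by rewrite (sgnD C (n + q%:Z + 1)) sgnN sgn_nat; ring.
Qed.

End ZhuTranslation.

Section ZhuSkewSymmetry.
Variables (C : numFieldType) (V : voa C).
Implicit Types u v w : V.
Local Notation Y := (@voa_md C V).
Local Notation om := (omega V).
Local Notation T := (Y om 0).
Local Notation Z := (@zhu_md C V).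
Local Notation zs := (@zhu_ser C).
Local Notation D := (@zhu_D C V).

Let Y2 : bilin Y := voa_bilin V.
Let Yt : truncated Y := @voa_trunc C V.
Let Z2 : bilin Z := zhu_bilin V.

(** Coefficients of [Y[D v, y] = d/dy Y[v, y]]. The two parts of [D v] have weights [h + 1] and [h],
    and their contributions to a given mode of [Y(v, x)] add up by [zhu_ser_deriv]. *)
Let zhu_deriv_homog h v n w : homog h v -> Z (D v) n w = - n%:~R *: Z v (n - 1) w.
Proof.
move=> hv; have [N HN] := trunc_nat Yt v w (n - 1).
have HN' (i : nat) : (N <= i)%N -> Y v (n + i%:Z) w = 0.
  by move=> Ni; have := HN i.+1 (leqW Ni); rewrite (_ : n - 1 + i.+1%:Z = n + i%:Z)//; lia.
rewrite /zhu_D hv (bilinDl Z2) (bilinZl Z2).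
rewrite (@zhu_homog _ _ (h + 1) _ _ _ N.+1) => [|//|i Ni]; first last.
- rewrite voa_deriv_mode (_ : n + i%:Z - 1 = n - 1 + i%:Z); last by lia.
  by rewrite HN ?scaler0// ltnW.
- exact: homog_T.
rewrite (@zhu_homog _ _ h _ _ _ N)// (@zhu_homog _ _ h _ _ _ N.+1) => [|//|i Ni]; last first.
  by apply: HN; rewrite ltnW.
rewrite [in LHS]big_ord_recl [in RHS]big_ord_recl scalerDr -addrA; congr (_ + _).
  rewrite !zhu_ser0 !scale1r voa_deriv_mode /= !addr0.
  by [].
rewrite !scaler_sumr -big_split; apply: eq_bigr => i _ /=.
rewrite voa_deriv_mode !scalerA /bump /= add1n.
have -> : n + i.+1%:Z - 1 = n + i%:Z by lia.
have -> : n - 1 + i.+1%:Z = n + i%:Z by lia.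
rewrite -scalerDl; congr (_ *: _).
have := zhu_ser_deriv (h%:~R : C) (- (n + i%:Z) - 1) i.
have -> : - (n + i%:Z) - 1 - 1 = - (n + i.+1%:Z) - 1 by lia.
have -> : (- (n + i%:Z) - 1)%:~R + i.+1%:R = - n%:~R :> C.
  by rewrite -natr1 !(intrD, intrN) -pmulrn; ring.
move=> ->; rewrite intrD addrC; congr (_ + _).
by rewrite mulrC; congr (_ * _); rewrite -mulrNz; congr (_%:~R); lia.
Qed.

Lemma zhu_deriv v n w : Z (D v) n w = - n%:~R *: Z v (n - 1) w.
Proof.
elim/homog_ind: v => [|v v' IH IH'|h v]; last exact: zhu_deriv_homog.
  by rewrite /zhu_D !(bilin0r Y2) addr0 !(bilin0l Z2) scaler0.
by rewrite zhu_DD (bilinDl Z2 (D v)) (bilinDl Z2 v) IH IH' scalerDr.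
Qed.

(** The commutators with [L(-1)] and [L(0)] yield modes of [v] alone, which [zhu_ser_pascal] matches
    with those of [D v]. *)
Let zhu_translation_homog h v n w : homog h v -> D (Z v n w) = Z v n (D w) + Z (D v) n w.
Proof.
move=> hv; have [N HN] := trunc_nat Yt v w (n - 1).
have [N1 HN1] := trunc_nat Yt v (D w) n.
pose K := maxn N N1.
have KN (i : nat) : (K <= i)%N -> Y v (n - 1 + i%:Z) w = 0.
  by rewrite geq_max => /andP[/HN].
have KN' (i : nat) : (K <= i)%N -> Y v (n + i%:Z) w = 0.
  by move=> Ni; have := KN i.+1 (leqW Ni); rewrite (_ : n - 1 + i.+1%:Z = n + i%:Z)//; lia.
have KN1 (i : nat) : (K <= i)%N -> Y v (n + i%:Z) (D w) = 0.
  by rewrite geq_max => /andP[_ /HN1].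
apply/eqP; rewrite addrC -subr_eq; apply/eqP.
rewrite [zhu_D v]/zhu_D hv (bilinDl Z2) (bilinZl Z2).
rewrite (@zhu_homog _ _ (h + 1) (T v) n w K.+1) => [|//|i Ni]; first last.
- rewrite voa_deriv_mode (_ : n + i%:Z - 1 = n - 1 + i%:Z); last by lia.
  by rewrite KN ?scaler0// ltnW.
- exact: homog_T.
rewrite !(@zhu_homog _ _ h _ _ _ K)//.
pose c (i : nat) : C := zs h%:~R (- (n + i%:Z) - 1) i.
transitivity (\sum_(i < K.+1) (c i * - (n + i%:Z)%:~R) *: Y v (n + i%:Z - 1) w +
   \sum_(i < K) (c i * (h%:~R - (n + i%:Z + 1)%:~R)) *: Y v (n + i%:Z) w).
  rewrite big_ord_recr /= (_ : Y v (n + K%:Z - 1) w = 0); last first.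
    by rewrite (_ : n + K%:Z - 1 = n - 1 + K%:Z) ?KN//; lia.
  rewrite scaler0 addr0 -big_split.
  have -> : D (\sum_(i < K) c i *: Y v (n + i%:Z) w) = \sum_(i < K) c i *: D (Y v (n + i%:Z) w).
    elim/big_rec2: _ => [|i x y _ <-]; last by rewrite zhu_DD zhu_DZ.
    by rewrite /zhu_D !(bilin0r Y2) addr0.
  rewrite -sumrB; apply: eq_bigr => i _; rewrite -scalerBr -!scalerA /= -scalerDr; congr (_ *: _).
  rewrite /zhu_D (bilinDr Y2) opprD addrACA commutator0 commutator1 hv (bilinZl Y2) !voa_deriv_mode.
  by rewrite addrK scalerBl addrC scaleNr [in RHS]addrC [X in _ = X + _]addrC.
rewrite [in LHS]big_ord_recl [in RHS]big_ord_recl -[LHS]addrA -[RHS]addrA; congr (_ + _).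
  by rewrite /c !zhu_ser0 !mul1r scale1r voa_deriv_mode.
rewrite scaler_sumr -!big_split; apply: eq_bigr => i _ /=.
rewrite voa_deriv_mode /bump /= !add1n /c.
have -> : n + i.+1%:Z - 1 = n + i%:Z by lia.
rewrite !scalerA -!scalerDl; congr (_ *: _).
rewrite [(h + 1)%:~R]intrD zhu_ser_pascal.
have -> : - (n + i.+1%:Z) - 1 + 1 = - (n + i%:Z) - 1 by lia.
have -> : (n + i%:Z + 1)%:~R = (n + i.+1%:Z)%:~R :> C by congr (_%:~R); lia.
by ring.
Qed.

Lemma zhu_translation v n w : D (Z v n w) = Z v n (D w) - n%:~R *: Z v (n - 1) w.
Proof.
rewrite -scaleNr -zhu_deriv.
elim/homog_ind: v => [|v v' IH IH'|h v]; last exact: zhu_translation_homog.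
  have D0 : D 0 = 0 by rewrite /zhu_D !(bilin0r Y2) addr0.
  by rewrite D0 !(bilin0l Z2) D0 addr0.
by rewrite zhu_DD (bilinDl Z2 (D v)) !(bilinDl Z2 v) zhu_DD IH IH' addrACA.
Qed.

(** A vanishing hypothesis on the modes of [v] on [u] would not pass to homogeneous components,
    where cancellations may be hidden; a threshold for [N] does. *)
Lemma zhu_skew u v n : exists N0 : nat, forall N : nat, (N0 <= N)%N ->
  Z u n v = \sum_(i < N) (sgn C (n + i%:Z + 1) / i`!%:R) *: iter i D (Z v (n + i%:Z) u).
Proof.
have D0 i : iter i D 0 = 0.
  by elim: i => //= i ->; rewrite /zhu_D !(bilin0r Y2) addr0.
have DD i x y : iter i D (x + y) = iter i D x + iter i D y.
  by elim: i => //= i ->; rewrite zhu_DD.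
elim/homog_ind: u => [|u u' [N0 IH] [N0' IH']|h u hu].
- exists 0%N => N _; rewrite (bilin0l Z2) big1// => i _.
  by rewrite (bilin0r Z2) D0 scaler0.
- exists (maxn N0 N0') => N; rewrite geq_max => /andP[/IH uE /IH' u'E].
  rewrite (bilinDl Z2) uE u'E -big_split; apply: eq_bigr => i _.
  by rewrite (bilinDr Z2) DD scalerDr.
elim/homog_ind: v => [|v v' [N0 IH] [N0' IH']|h' v hv].
- exists 0%N => N _; rewrite (bilin0r Z2) big1// => i _.
  by rewrite (bilin0l Z2) D0 scaler0.
- exists (maxn N0 N0') => N; rewrite geq_max => /andP[/IH uE /IH' u'E].
  rewrite (bilinDr Z2) uE u'E -big_split; apply: eq_bigr => i _.
  by rewrite (bilinDl Z2) DD scalerDr.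
have [N0 HN0] := trunc_nat Yt v u n; exists N0 => N N0N.
by apply: (zhu_skew_homog hu hv) => i Ni; apply: HN0; exact: leq_trans N0N Ni.
Qed.

End ZhuSkewSymmetry.

(** Replacing [t] by [2 t] and subtracting [2 ^ N] times the original identity removes the leading
    term; the remaining factors [2 ^ q - 2 ^ N] are nonzero in characteristic 0. *)
Lemma poly_extract (C : numFieldType) (W : lmodType C) (N : nat) (X : nat -> W) :
  (forall t : C, \sum_(q < N) t ^+ q *: X q = 0) -> forall q, (q < N)%N -> X q = 0.
Proof.
elim: N X => // N IH X H.
have two_pow q : (q < N)%N -> (2 ^+ q - 2 ^+ N : C) != 0.
  move=> qN; rewrite subr_eq0 -!natrX eqr_nat eqn_exp2l//; apply/eqP; lia.
have small q : (q < N)%N -> X q = 0.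
  move=> qN; suff /eqP : (2 ^+ q - 2 ^+ N : C) *: X q = 0.
    by rewrite scaler_eq0 (negPf (two_pow q qN)) => /eqP.
  apply: (IH (fun q => (2 ^+ q - 2 ^+ N : C) *: X q)) => // t.
  have := congr1 ( *:%R (2 ^+ N)) (H t); have := H (2 * t).
  rewrite !big_ord_recr /= scaler0 => H1 H2.
  have : (\sum_(i < N) (2 * t) ^+ i *: X i + (2 * t) ^+ N *: X N) -
     2 ^+ N *: (\sum_(i < N) t ^+ i *: X i + t ^+ N *: X N) = 0 by rewrite H1 H2 subr0.
  rewrite scalerDr opprD addrACA exprMn scalerA subrr addr0 scaler_sumr -sumrB => E.
  rewrite -[RHS]E.
  by apply: eq_bigr => i _; rewrite exprMn !scalerA -scalerBl mulrBr; congr ((_ - _) *: _); ring.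
move=> q; rewrite ltnS leq_eqVlt => /orP[/eqP ->|]; last exact: small.
have := H 1; rewrite big_ord_recr /= big1 => [|i _]; last by rewrite small ?scaler0.
by rewrite add0r expr1n scale1r.
Qed.

(** * The commutator formula for [Y[u, y]] *)

Section ZhuCommutator.
Variables (C : numFieldType) (V : voa C).
Implicit Types u v w : V.
Local Notation Y := (@voa_md C V).
Local Notation Z := (@zhu_md C V).
Local Notation zs := (@zhu_ser C).

Let Y2 : bilin Y := voa_bilin V.
Let Yt : truncated Y := @voa_trunc C V.
Let Z2 : bilin Z := zhu_bilin V.

Let trunc0 u w : exists N : nat, forall i : nat, (N <= i)%N -> Y u i w = 0.
Proof. by have [N HN] := trunc_nat Yt u w 0; exists N => i /HN; rewrite add0r. Qed.

(* Res_y e ^ (t y) Y[u, y] w = Res_x (1 + x) ^ (t + h - 1) Y(u, x) w, with x = e ^ y - 1 *)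
Lemma zhu_residue h u w (t : C) (N : nat) : homog h u ->
  (forall i : nat, (N <= i)%N -> Y u i w = 0) ->
  \sum_(m < N) ps_exp t m *: Z u m w = \sum_(k < N) binc (t + h%:~R - 1) k *: Y u k w.
Proof.
move=> hu HN.
transitivity (\sum_(m < N) \sum_(i < N)
    (ps_exp t m * zs h%:~R (- (m + i)%N%:Z - 1) i) *: Y u (m + i)%N%:Z w).
  apply: eq_bigr => m _; rewrite (@zhu_homog _ _ h _ _ _ N)// => [|i Ni]; last first.
    by rewrite -PoszD HN//; lia.
  rewrite scaler_sumr; apply: eq_bigr => i _.
  by rewrite scalerA PoszD.
rewrite (@sum_antidiag _ N _ _ (fun m i => (ps_exp t m * zs h%:~R (- (m + i)%N%:Z - 1) i) *: Y u (m + i)%N%:Z w))//; last first.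
  by move=> i j /HN ->; rewrite scaler0.
apply: eq_bigr => k _; have -> : t + h%:~R - 1 = (h%:~R + t) - 1 by ring.
rewrite -zhu_ser_residue.
have -> : zs (h%:~R + t) (- k.+1%:Z) = zs h%:~R (- k.+1%:Z) * ps_exp t.
  by rewrite /zhu_ser ps_expD; ring.
rewrite psM scaler_suml; apply: eq_bigr => i _; have ik : (i <= k)%N by rewrite -ltnS.
rewrite subnK// mulrC; congr ((zs _ _ _ * _) *: _).
by lia.
Qed.

(** The commutator formula as a generating function in [t]. The bound [N0] is independent of [t], as
    [poly_extract] requires. Both sides are reduced to the same combination of the vectors
    [(u_i v)_(n+s) w]. *)
Let zhu_commutator_homog h h' u v w (n : int) : homog h u -> homog h' v ->
  exists N0 : nat, forall (K : nat) (t : C), (N0 <= K)%N ->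
  \sum_(q < K) ps_exp t q *: (Z u q (Z v n w) - Z v n (Z u q w)) =
  \sum_(q < K) ps_exp t q *: \sum_(j < q.+1) 'C(q, j)%:R *: Z (Z u j v) (q%:Z + n - j%:Z) w.
Proof.
move=> hu hv.
have [N1 HN1] := trunc0 u v.
have [N2 HN2] := @bound_all N1 (fun i s => Y (Y u i v) (n + s%:Z) w = 0)
  (fun i => trunc_nat Yt (Y u i v) w n).
have [N3 HN3] := trunc_nat Yt v w n.
have [N4 HN4] := trunc0 u w.
have [N5 HN5] := @bound_all N4 (fun k j => Y v (n + j%:Z) (Y u k w) = 0)
  (fun k => trunc_nat Yt v (Y u k w) n).
have [N6 HN6] := @bound_all N3 (fun j k => Y u k (Y v (n + j%:Z) w) = 0)
  (fun j => trunc0 u (Y v (n + j%:Z) w)).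
exists (N1 + N2 + N3 + N4 + N5 + N6)%N => K t NK.
pose c (j : nat) : C := zs h'%:~R (- (n + j%:Z) - 1) j.
pose b (k : nat) : C := binc (t + h%:~R - 1) k.
have ZvE x : (forall j : nat, (K <= j)%N -> Y v (n + j%:Z) x = 0) ->
    Z v n x = \sum_(j < K) c j *: Y v (n + j%:Z) x.
  by move=> Hx; rewrite (@zhu_homog _ _ h' _ _ _ K).
have Zvw : Z v n w = \sum_(j < K) c j *: Y v (n + j%:Z) w.
  by apply: ZvE => j jK; apply: HN3; lia.
have Zvu (k : nat) : Z v n (Y u k w) = \sum_(j < K) c j *: Y v (n + j%:Z) (Y u k w).
  apply: ZvE => j jK; have [kN4|kN4] := ltnP k N4; first by apply: HN5 => //; lia.
  by rewrite HN4// (bilin0r Y2).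
have lhs1 : \sum_(q < K) ps_exp t q *: Z u q (Z v n w) =
    \sum_(k < K) \sum_(j < K) (b k * c j) *: Y u k (Y v (n + j%:Z) w).
  rewrite (@zhu_residue h)// => [|i iK]; last first.
    rewrite Zvw (bilin_sumr Y2) big1// => j _; rewrite (bilinZr Y2).
    have [jN3|jN3] := ltnP j N3; first by rewrite HN6 ?scaler0//; lia.
    by rewrite HN3// (bilin0r Y2) scaler0.
  apply: eq_bigr => k _; rewrite Zvw (bilin_sumr Y2) scaler_sumr; apply: eq_bigr => j _.
  by rewrite (bilinZr Y2) scalerA.
have lhs2 : \sum_(q < K) ps_exp t q *: Z v n (Z u q w) =
    \sum_(k < K) \sum_(j < K) (b k * c j) *: Y v (n + j%:Z) (Y u k w).
  transitivity (Z v n (\sum_(q < K) ps_exp t q *: Z u q w)).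
    by rewrite (bilin_sumr Z2); apply: eq_bigr => q _; rewrite (bilinZr Z2).
  rewrite (@zhu_residue h)// => [|i iK]; last by apply: HN4; lia.
  rewrite (bilin_sumr Z2); apply: eq_bigr => k _; rewrite (bilinZr Z2) Zvu scaler_sumr.
  by apply: eq_bigr => j _; rewrite scalerA.
pose Q (i s : nat) := Y (Y u i v) (n + s%:Z) w.
have Q0 (i s : nat) : (N1 <= i)%N || (N2 <= s)%N -> Q i s = 0.
  move=> is0; have [iN1|iN1] := ltnP i N1; last by rewrite /Q HN1// (bilin0l Y2).
  by apply: HN2 => //; lia.
pose kp (s : nat) : int := - (n + s%:Z) - 1.
(* The common normal form: the exponent [h' + (t + h - 1 - i)] joins the weight of [v] to what is
   left of [(1 + x) ^ (t + h - 1)] after [i] differentiations. *)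
transitivity (\sum_(i < N1) \sum_(s < N2) (b i * zs (h'%:~R + (t + h%:~R - 1 - i%:R)) (kp s) s) *: Q i s).
  under eq_bigr do rewrite scalerBr.
  rewrite sumrB lhs1 lhs2 -sumrB.
  transitivity (\sum_(k < K) \sum_(j < K) \sum_(i < N1)
      (b k * c j * 'C(k, i)%:R) *: Y (Y u i v) (k%:Z + (n + j%:Z) - i%:Z) w).
    apply: eq_bigr => k _; rewrite -sumrB; apply: eq_bigr => j _.
    rewrite -scalerBr (@voa_commutator _ _ _ _ _ _ _ N1)// scaler_sumr.
    by apply: eq_bigr => i _; rewrite scalerA -[k%:Z%:~R]/(k%:R) binc_nat.
  under eq_bigr do rewrite exchange_big /=.
  rewrite exchange_big /=; apply: eq_bigr => i _; have iN1 := ltn_ord i.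
  have -> : K = (i + (K - i))%N by lia.
  rewrite big_split_ord /= big1 ?add0r => [|k _]; last first.
    by rewrite big1// => j _; rewrite bin_small ?mulr0 ?scale0r.
  transitivity (\sum_(k < K - i) \sum_(j < i + (K - i))
     (b i * binc (t + h%:~R - 1 - i%:R) k * c j) *: Q i (k + j)%N).
    apply: eq_bigr => k _; apply: eq_bigr => j _; rewrite /b.
    have -> : (i + k)%N%:Z + (n + j%:Z) - i%:Z = n + (k + j)%N%:Z by lia.
    by rewrite -binc_trinomial; congr (_ *: _); ring.
  (* The trinomial identity has split off the index [i]; the remaining binomial in [k] is summed
     against [c j] by [zhu_ser_binom]. *)
  rewrite (@sum_antidiag _ N2 _ _ (fun k j => (b i * binc (t + h%:~R - 1 - i%:R) k * c j) *: Q i (k + j)%N)).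
  - apply: eq_bigr => s _; rewrite zhu_ser_binom mulr_sumr scaler_suml.
    rewrite (reindex_inj rev_ord_inj) /=; apply: eq_bigr => j _; have js := ltn_ord j.
    rewrite subSS subKn; last by rewrite -ltnS.
    rewrite subnKC; last by rewrite -ltnS.
    rewrite /c -mulrA; congr ((_ * (_ * zs _ _ _)) *: _).
    by rewrite /kp; lia.
  - by lia.
  - by lia.
  - by move=> k j kj; rewrite Q0 ?scaler0// kj orbT.
symmetry.
have HZ1 (j : nat) : (N1 <= j)%N -> Z u j v = 0.
  move=> jN1; rewrite (@zhu_homog _ _ h _ _ _ 0)// ?big_ord0// => i _.
  by rewrite -PoszD HN1//; lia.
have HZ2 (i m : nat) : (N2 <= m)%N -> Z (Y u i v) (n + m%:Z) w = 0.
  move=> mN2; rewrite (zhu_homog (homog_mode i hu hv) (N := 0)) ?big_ord0// => s _.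
  by rewrite -addrA -PoszD -/(Q i (m + s)%N) Q0//; lia.
have Zexp (j : nat) : Z u j v = \sum_(i < N1) zs h%:~R (- (j + i)%N%:Z - 1) i *: Y u (j + i)%N%:Z v.
  rewrite (@zhu_homog _ _ h _ _ _ N1)// => i iN1.
  by rewrite -PoszD HN1//; lia.
have HZ3 (j m : nat) : (N2 <= m)%N -> Z (Z u j v) (n + m%:Z) w = 0.
  by move=> mN2; rewrite Zexp (bilin_suml Z2) big1// => i _; rewrite (bilinZl Z2) HZ2 ?scaler0.
pose F (m j : nat) := (ps_exp t m * ps_exp t j) *: Z (Z u j v) (n + m%:Z) w.
transitivity (\sum_(q < K) \sum_(j < q.+1) F (q - j)%N j).
  apply: eq_bigr => q _; rewrite scaler_sumr; apply: eq_bigr => j _.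
  have jq : (j <= q)%N by rewrite -ltnS.
  rewrite /F (_ : q%:Z + n - j%:Z = n + (q - j)%N%:Z); last by lia.
  rewrite scalerA; congr (_ *: _); rewrite /ps_exp -{1}(subnK jq) exprD.
  have : ('C(q, j) * (j`! * (q - j)`!))%:R = q`!%:R :> C by rewrite bin_fact.
  rewrite !natrM => <-; have := fact_neq0 C j; have := fact_neq0 C (q - j).
  have : 'C(q, j)%:R != 0 :> C by rewrite pnatr_eq0 -lt0n bin_gt0.
  by move: 'C(q, j)%:R (q - j)`!%:R j`!%:R => x y z x0 y0 z0; field; apply/and3P.
rewrite -(@sum_antidiag _ K K K F)//; last first.
  move=> m j mj; have [jN1|jN1] := ltnP j N1; first by rewrite /F HZ3 ?scaler0//; lia.
  by rewrite /F HZ1// (bilin0l Z2) scaler0.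
rewrite (@sum_widen _ N2 K (fun m => \sum_(j < K) F m j)); last 2 first.
- by lia.
- by move=> m mN2; rewrite big1// => j _; rewrite /F HZ3 ?scaler0.
transitivity (\sum_(m < N2) \sum_(i < N1) (ps_exp t m * b i) *: Z (Y u i v) (n + m%:Z) w).
  apply: eq_bigr => m _; rewrite (@sum_widen _ N1 K (F m)); last 2 first.
  - by lia.
  - by move=> j jN1; rewrite /F HZ1// (bilin0l Z2) scaler0.
  transitivity (ps_exp t m *: Z (\sum_(j < N1) ps_exp t j *: Z u j v) (n + m%:Z) w).
    rewrite (bilin_suml Z2) scaler_sumr; apply: eq_bigr => j _.
    by rewrite (bilinZl Z2) scalerA.
  rewrite (@zhu_residue h)// (bilin_suml Z2) scaler_sumr; apply: eq_bigr => i _.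
  by rewrite (bilinZl Z2) scalerA.
rewrite exchange_big /=; apply: eq_bigr => i _; have iN1 := ltn_ord i.
pose g : int := h + h' - i%:Z - 1.
transitivity (\sum_(m < N2) \sum_(s < N2) (ps_exp t m * b i * zs g%:~R (kp (m + s)%N) s) *: Q i (m + s)%N).
  apply: eq_bigr => m _; rewrite (zhu_homog (homog_mode i hu hv) (N := N2)) => [|s sN2].
    rewrite scaler_sumr; apply: eq_bigr => s _.
    by rewrite scalerA /Q /kp PoszD addrA.
  by rewrite -addrA -PoszD -/(Q i (m + s)%N) Q0//; lia.
rewrite (@sum_antidiag _ N2 _ _ (fun m s => (ps_exp t m * b i * zs g%:~R (kp (m + s)%N) s) *: Q i (m + s)%N))//; last first.
  by move=> m s ms; rewrite Q0 ?scaler0// ms orbT.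
apply: eq_bigr => s _.
(* Here [u_i v] has weight [g = h + h' - i - 1], and together with [e ^ (t y)] it gives the exponent
   of the normal form. *)
have -> : zs (h'%:~R + (t + h%:~R - 1 - i%:R)) (kp s) = zs g%:~R (kp s) * ps_exp t.
  rewrite /zhu_ser [RHS]mulrAC -ps_expD; congr (ps_exp _ * _).
  by rewrite /g !(intrD, intrN) -pmulrn; ring.
rewrite psM mulr_sumr scaler_suml; apply: eq_bigr => j _.
have js : (j <= s)%N by rewrite -ltnS.
by rewrite subnK//; congr (_ *: _); ring.
Qed.

Lemma zhu_commutator u v w (q : nat) (n : int) :
  Z u q (Z v n w) - Z v n (Z u q w) =
  \sum_(j < q.+1) 'C(q, j)%:R *: Z (Z u j v) (q%:Z + n - j%:Z) w.
Proof.
elim/homog_ind: u => [|u u' IH IH'|h u hu].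
- rewrite !(bilin0l Z2) (bilin0r Z2) subr0 big1// => j _.
  by rewrite !(bilin0l Z2) scaler0.
- rewrite !(bilinDl Z2) (bilinDr Z2) opprD addrACA IH IH' -big_split; apply: eq_bigr => j _ /=.
  by rewrite !(bilinDl Z2) scalerDr.
elim/homog_ind: v => [|v v' IH IH'|h' v hv].
- rewrite !(bilin0l Z2) (bilin0r Z2) subr0 big1// => j _.
  by rewrite (bilin0r Z2) (bilin0l Z2) scaler0.
- rewrite !(bilinDl Z2) (bilinDr Z2) opprD addrACA IH IH' -big_split; apply: eq_bigr => j _ /=.
  by rewrite (bilinDr Z2) (bilinDl Z2) scalerDr.
have [N0 HN0] := @zhu_commutator_homog h h' u v w n hu hv.
(* The factorial comes from [ps_exp t q = t ^ q / q!], so that [X q] is the coefficient of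
   [t ^ q]. *)
pose X (q : nat) := (q`!%:R : C)^-1 *: (Z u q (Z v n w) - Z v n (Z u q w) -
  \sum_(j < q.+1) 'C(q, j)%:R *: Z (Z u j v) (q%:Z + n - j%:Z) w).
have /eqP : X q = 0.
  apply: (@poly_extract _ _ (maxn N0 q.+1)) => [t|]; last by rewrite leq_max leqnn orbT.
  have := HN0 _ t (leq_maxl N0 q.+1) => /eqP; rewrite -subr_eq0 -sumrB => /eqP E.
  rewrite -[RHS]E; apply: eq_bigr => i _.
  by rewrite /X scalerA -scalerBr.
by rewrite scaler_eq0 invr_eq0 (negPf (fact_neq0 C q)) subr_eq0 => /eqP.
Qed.

Lemma zhu_skew_bound u v n (N : nat) : (forall i : nat, (N <= i)%N -> Z v (n + i%:Z) u = 0) ->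
  Z u n v = \sum_(i < N) (sgn C (n + i%:Z + 1) / i`!%:R) *: iter i (@zhu_D C V) (Z v (n + i%:Z) u).
Proof.
move=> HN; have [N0 HN0] := zhu_skew u v n.
rewrite (HN0 (maxn N0 N)) ?leq_maxl// -(@sum_widen _ N (maxn N0 N) (fun i =>
  (sgn C (n + i%:Z + 1) / i`!%:R) *: iter i (@zhu_D C V) (Z v (n + i%:Z) u))) ?leq_maxr// => i /HN ->.
have -> : iter i (@zhu_D C V) 0 = 0; last by rewrite scaler0.
by elim: i => //= i ->; rewrite /zhu_D !(bilin0r Y2) addr0.
Qed.

End ZhuCommutator.

Lemma sum_diag (W : zmodType) (r : nat) (F : nat -> nat -> W) :
  \sum_(s < r.+1) \sum_(m < (r - s).+1) F s m = \sum_(n < r.+1) \sum_(s < n.+1) F s (n - s)%N.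
Proof.
pose G (m s : nat) := if (s + m <= r)%N then F s m else 0.
transitivity (\sum_(m < r.+1) \sum_(s < r.+1) G m s).
  rewrite exchange_big /=; apply: eq_bigr => s _; have sr := ltn_ord s.
  rewrite (@sum_widen _ (r - s).+1 r.+1 (fun m => G m s)).
  - by apply: eq_bigr => m _; rewrite /G ifT//; have := ltn_ord m; lia.
  - by lia.
  - by move=> m rm; rewrite /G ifF//; apply/negbTE; lia.
rewrite (@sum_antidiag _ r.+1)// => [|m s ms]; last by rewrite /G ifF//; apply/negbTE; lia.
apply: eq_bigr => n _; apply: eq_bigr => s _; rewrite /G ifT//.
by have := ltn_ord n; have := ltn_ord s; lia.
Qed.

(** * The residue of an iterate *)

Section DividedPowers.
Variables (C : numFieldType) (V : lmodType C) (Z : V -> int -> V -> V) (D : V -> V) (t : C).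
Implicit Types (u v w A B E X : V).

Hypothesis Z2 : bilin Z.
Hypothesis DD : forall u v, D (u + v) = D u + D v.
Hypothesis DZ : forall a u, D (a *: u) = a *: D u.
Hypothesis translation : forall v n w, D (Z v n w) = Z v n (D w) - n%:~R *: Z v (n - 1) w.

Let D0 : D 0 = 0.
Proof. by rewrite -[X in D X](scale0r (0 : V)) DZ scale0r. Qed.

(** Since [t] commutes with [D], [e ^ (y (t + D))] is [e ^ (t y) e ^ (y D)]: the weight of a residue
    together with the exponential produced by skew-symmetry. *)
Definition tD u : V := t *: u + D u.
(* (t + D) ^ q / q! *)
Definition dpow (q : nat) u : V := (q`!%:R : C)^-1 *: iter q tD u.

Lemma tDD u v : tD (u + v) = tD u + tD v.
Proof. by rewrite /tD DD scalerDr addrACA. Qed.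

Lemma tDZ a u : tD (a *: u) = a *: tD u.
Proof. by rewrite /tD DZ scalerDr !scalerA mulrC. Qed.

Lemma iter_tDZ q a u : iter q tD (a *: u) = a *: iter q tD u.
Proof. by elim: q => //= q ->; rewrite tDZ. Qed.

Lemma dpowD q u v : dpow q (u + v) = dpow q u + dpow q v.
Proof. by rewrite /dpow -scalerDr; congr (_ *: _); elim: q => //= q ->; rewrite tDD. Qed.

Lemma dpowZ q a u : dpow q (a *: u) = a *: dpow q u.
Proof. by rewrite /dpow iter_tDZ !scalerA mulrC. Qed.

Lemma dpow_0 q : dpow q 0 = 0.
Proof. by rewrite -[X in dpow q X](scale0r (0 : V)) dpowZ scale0r. Qed.

Lemma dpow_sum q I (r : seq I) (P : pred I) (F : I -> V) :
  dpow q (\sum_(i <- r | P i) F i) = \sum_(i <- r | P i) dpow q (F i).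
Proof. by elim/big_rec2: _ => [|i x y _ <-]; rewrite ?dpow_0 ?dpowD. Qed.

Lemma dpow0 u : dpow 0 u = u. Proof. by rewrite /dpow invr1 scale1r. Qed.

Lemma dpowS q u : q.+1%:R *: dpow q.+1 u = tD (dpow q u).
Proof.
have q0 : q.+1%:R != 0 :> C by rewrite pnatr_eq0.
by rewrite /dpow tDZ scalerA factS natrM invfM mulrA divff// mul1r.
Qed.

Lemma dpow_comp q j u : 'C(q + j, j)%:R *: dpow (q + j) u = dpow j (dpow q u).
Proof.
rewrite [dpow q u]/dpow dpowZ /dpow !scalerA addnC iterD; congr (_ *: _).
have : ('C(j + q, j) * (j`! * q`!))%:R = (j + q)`!%:R :> C.
  by have := bin_fact (leq_addr q j); rewrite addKn => ->.
rewrite !natrM => <-; have := fact_neq0 C j; have := fact_neq0 C q.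
have : 'C(j + q, j)%:R != 0 :> C by rewrite pnatr_eq0 -lt0n bin_gt0 leq_addr.
by move: 'C(j + q, j)%:R q`!%:R j`!%:R => x y z x0 y0 z0; field; apply/and3P.
Qed.

Lemma dpowE q u : dpow q u =
  \sum_(m < q.+1) (ps_exp t (q - m)%N / m`!%:R) *: iter m D u.
Proof.
elim: q => [|q IH].
  by rewrite big_ord1 dpow0 /ps_exp !divr1 scale1r.
have q0 : q.+1%:R != 0 :> C by rewrite pnatr_eq0.
apply: (scalerI q0); rewrite dpowS IH.
have tD_sum I (r : seq I) (P : pred I) (F : I -> V) :
    tD (\sum_(i <- r | P i) F i) = \sum_(i <- r | P i) tD (F i).
  elim/big_rec2: _ => [|i x y _ <-]; last by rewrite tDD.
  by rewrite /tD D0 scaler0 addr0.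
have texp (k : nat) : t * ps_exp t k = k.+1%:R * ps_exp t k.+1.
  by have := congr1 (fun f => f k.+1) (ps_euler_exp t); rewrite ps_constM psXS.
rewrite tD_sum scaler_sumr.
transitivity (\sum_(m < q.+1) ((t * ps_exp t (q - m)%N / m`!%:R) *: iter m D u +
    (ps_exp t (q - m)%N / m`!%:R) *: iter m.+1 D u)).
  by apply: eq_bigr => m _; rewrite tDZ /tD scalerDr scalerA; congr (_ *: _ + _); ring.
rewrite big_split /= [in LHS]big_ord_recl [X in _ + X]big_ord_recr /=.
rewrite [in RHS]big_ord_recl [X in _ = _ + X]big_ord_recr /= -!addrA; congr (_ + _).
  by rewrite scalerA !subn0 texp -mulrA.
rewrite addrA; congr (_ + _); last first.
  rewrite /bump /= !add1n subnn scalerA; congr (_ *: _).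
  rewrite /ps_exp subnn expr0 divr1 !mul1r factS natrM; have := fact_neq0 C q.
  by move: q.+1%:R q`!%:R q0 => x y x0 y0; field; apply/andP.
rewrite -big_split; apply: eq_bigr => m _; rewrite /bump /= !add1n scalerA -scalerDl; congr (_ *: _).
have mq := ltn_ord m.
rewrite texp subSS (_ : (q - m.+1).+1 = (q - m)%N); last by lia.
have -> : q.+1%:R = (q - m)%:R + m.+1%:R :> C by rewrite -natrD; congr (_%:R); lia.
rewrite factS natrM; have := fact_neq0 C m; have : m.+1%:R != 0 :> C by rewrite pnatr_eq0.
by move: m.+1%:R m`!%:R => x y x0 y0; field; apply/andP.
Qed.

(** The coefficient of [y ^ r] in [e ^ (y (t + D)) e ^ (- y D) = e ^ (t y)]. *)
Lemma dpow_inv r u :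
  \sum_(s < r.+1) ((-1) ^+ s / s`!%:R) *: dpow (r - s)%N (iter s D u) = ps_exp t r *: u.
Proof.
transitivity (\sum_(s < r.+1) \sum_(m < (r - s).+1)
   ((-1) ^+ s / s`!%:R * (ps_exp t (r - (s + m))%N / m`!%:R)) *: iter (s + m) D u).
  apply: eq_bigr => s _; rewrite dpowE scaler_sumr; apply: eq_bigr => m _.
  by rewrite scalerA addnC iterD addnC subnDA.
rewrite (sum_diag r (fun s m => ((-1) ^+ s / s`!%:R * (ps_exp t (r - (s + m))%N / m`!%:R)) *: iter (s + m) D u)).
have E n : \sum_(s < n.+1) (-1) ^+ s / s`!%:R * (n - s)`!%:R^-1 = (n == 0%N)%:R :> C.
  transitivity ((ps_exp (-1 : C) * ps_exp 1) n); last by rewrite -ps_expD addNr ps_exp0.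
  rewrite psM; apply: eq_bigr => s _.
  by rewrite /ps_exp expr1n mul1r.
rewrite big_ord_recl [X in _ + X]big1 => [|n _].
  by rewrite /= big_ord1 /= !subn0 !divr1 mul1r addr0.
transitivity (\sum_(s < (lift ord0 n).+1) ((-1) ^+ s / s`!%:R * (lift ord0 n - s)`!%:R^-1) *:
    (ps_exp t (r - lift ord0 n)%N *: iter (lift ord0 n) D u)).
  apply: eq_bigr => s _; have sn : (s <= lift ord0 n)%N by rewrite -ltnS.
  by rewrite scalerA subnKC//; congr (_ *: _); ring.
by rewrite -scaler_suml E /= scale0r.
Qed.

(** Translation covariance [e ^ (y (t + D)) Y[X, z] = Y[X, z + y] e ^ (y (t + D))], expanded in
    nonnegative powers of [y]. *)
Lemma dpow_mode (q : nat) X (a : int) v : dpow q (Z X a v) =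
  \sum_(m < q.+1) ((-1) ^+ m * binc (a%:~R : C) m) *: Z X (a - m%:Z) (dpow (q - m)%N v).
Proof.
elim: q => [|q IH].
  by rewrite big_ord1 !dpow0 binc0 mulr1 scale1r subr0.
have q0 : q.+1%:R != 0 :> C by rewrite pnatr_eq0.
apply: (scalerI q0); rewrite dpowS IH.
have tD_sum I (r : seq I) (P : pred I) (F : I -> V) :
    tD (\sum_(i <- r | P i) F i) = \sum_(i <- r | P i) tD (F i).
  elim/big_rec2: _ => [|i x y _ <-]; last by rewrite tDD.
  by rewrite /tD D0 scaler0 addr0.
have tDm b x : tD (Z X b x) = Z X b (tD x) - b%:~R *: Z X (b - 1) x.
  by rewrite /tD translation (bilinDr Z2) (bilinZr Z2) addrA.
rewrite tD_sum scaler_sumr.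
pose c (m : nat) : C := (-1) ^+ m * binc a%:~R m.
transitivity (\sum_(m < q.+1) ((c m * (q - m).+1%:R) *: Z X (a - m%:Z) (dpow (q - m).+1 v) +
    (c m.+1 * m.+1%:R) *: Z X (a - m.+1%:Z) (dpow (q - m)%N v))).
  apply: eq_bigr => m _; rewrite tDZ tDm -dpowS (bilinZr Z2) scalerBr !scalerA -/(c m).
  congr (_ + _); rewrite -scaleNr; have -> : a - m%:Z - 1 = a - m.+1%:Z by lia.
  congr (_ *: _); rewrite /c exprS.
  transitivity (- ((-1) ^+ m * (m.+1%:R * binc (a%:~R : C) m.+1))); last by ring.
  by rewrite bincS intrB -pmulrn; ring.
rewrite big_split /= [in LHS]big_ord_recl [X in _ + X]big_ord_recr /=.
rewrite [in RHS]big_ord_recl [X in _ = _ + X]big_ord_recr /= -!addrA; congr (_ + _).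
  by rewrite scalerA !subn0 mulrC.
rewrite addrA; congr (_ + _); last first.
  by rewrite /bump /= !add1n !subnn scalerA mulrC.
rewrite -big_split; apply: eq_bigr => m _; rewrite /bump /= !add1n scalerA.
have mq := ltn_ord m.
rewrite subSS (_ : (q - m.+1).+1 = (q - m)%N) -?scalerDl; last by lia.
congr (_ *: _); rewrite -/(c m.+1) -mulrDr mulrC; congr (_ * _).
by rewrite -natrD; congr (_%:R); lia.
Qed.

Hypothesis Ztrunc : truncated Z.
Hypothesis deriv : forall v n w, Z (D v) n w = - n%:~R *: Z v (n - 1) w.
Hypothesis commutator : forall u v w (q : nat) (n : int),
  Z u q (Z v n w) - Z v n (Z u q w) =
  \sum_(j < q.+1) 'C(q, j)%:R *: Z (Z u j v) (q%:Z + n - j%:Z) w.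
Hypothesis skew : forall u v n (N : nat), (forall i : nat, (N <= i)%N -> Z v (n + i%:Z) u = 0) ->
  Z u n v = \sum_(i < N) (sgn C (n + i%:Z + 1) / i`!%:R) *: iter i D (Z v (n + i%:Z) u).

Let iterD_0 s : iter s D 0 = 0. Proof. by elim: s => //= s ->. Qed.

Lemma skew_trunc u v n (N : nat) : (forall i : nat, (N <= i)%N -> Z v (n + i%:Z) u = 0) ->
  forall i : nat, (N <= i)%N -> Z u (n + i%:Z) v = 0.
Proof.
move=> HN i Ni; rewrite (@skew _ _ _ 0%N) ?big_ord0// => j _.
by rewrite -addrA -PoszD HN//; lia.
Qed.

(** Skew-symmetry under the residue: for [n = 0] it says [Res_y e ^ (t y) Y[X, y] w = Res_y e ^ (y
    (t + D)) Y[w, - y] X]. *)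
Lemma residue_dpow X w n (N0 N : nat) : (N0 <= N)%N ->
  (forall r : nat, (N0 <= r)%N -> Z w (n + r%:Z) X = 0) ->
  \sum_(i < N) ps_exp t i *: Z X (n + i%:Z) w =
  \sum_(r < N) sgn C (n + r%:Z + 1) *: dpow r (Z w (n + r%:Z) X).
Proof.
move=> N0N H0.
pose F (i s : nat) := (ps_exp t i * (sgn C (n + (i + s)%N%:Z + 1) / s`!%:R)) *: iter s D (Z w (n + (i + s)%N%:Z) X).
transitivity (\sum_(i < N) \sum_(s < N) F i s).
  apply: eq_bigr => i _; rewrite (@skew _ _ _ N) => [|s Ns]; last first.
    by rewrite -addrA -PoszD H0//; lia.
  rewrite scaler_sumr; apply: eq_bigr => s _.
  by rewrite scalerA /F PoszD !addrA.
rewrite (@sum_antidiag _ N)// => [|i s Nis]; last by rewrite /F H0 ?iterD_0 ?scaler0//; lia.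
apply: eq_bigr => r _; rewrite dpowE scaler_sumr; apply: eq_bigr => s _.
have sr : (s <= r)%N by rewrite -ltnS.
by rewrite /F subnK// scalerA; congr (_ *: _); ring.
Qed.

(** The coefficients in [z] of [e ^ (- z (t + D)) Y[X, z] B = e ^ (- t z) Y[B, - z] X]. *)
Lemma dpow_skew X B (a : int) (N0 N : nat) : (N0 <= N)%N ->
  (forall r : nat, (N0 <= r)%N -> Z B (a + r%:Z) X = 0) ->
  \sum_(m < N) sgn C m *: dpow m (Z X (a + m%:Z) B) =
  \sum_(j < N) (ps_exp (- t) j * sgn C (a + j%:Z + 1)) *: Z B (a + j%:Z) X.
Proof.
move=> N0N H0.
pose F (m s : nat) := (sgn C (a + 1) * ((-1) ^+ s / s`!%:R)) *: dpow m (iter s D (Z B (a + (m + s)%N%:Z) X)).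
transitivity (\sum_(m < N) \sum_(s < N) F m s).
  apply: eq_bigr => m _; rewrite (@skew _ _ _ N) => [|s Ns]; last first.
    by rewrite -addrA -PoszD H0//; lia.
  rewrite dpow_sum scaler_sumr; apply: eq_bigr => s _.
  rewrite dpowZ scalerA /F PoszD !addrA; congr (_ *: _).
  have -> : a + m%:Z + s%:Z + 1 = (a + 1) + s%:Z + m%:Z by lia.
  by rewrite 2!sgnD [sgn C s]sgn_nat -[RHS]mulr1 -(sgnM C m); ring.
rewrite (@sum_antidiag _ N)// => [|m s Nms]; last first.
  by rewrite /F H0 ?iterD_0 ?dpow_0 ?scaler0//; lia.
apply: eq_bigr => r _.
transitivity (sgn C (a + 1) *: \sum_(s < r.+1) ((-1) ^+ s / s`!%:R) *: dpow (r - s)%N (iter s D (Z B (a + r%:Z) X))).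
  rewrite scaler_sumr; apply: eq_bigr => s _; have sr : (s <= r)%N by rewrite -ltnS.
  by rewrite /F subnK// [RHS]scalerA.
rewrite dpow_inv scalerA; congr (_ *: _).
have -> : a + r%:Z + 1 = a + 1 + r%:Z by lia.
rewrite (sgnD C (a + 1)) sgn_nat /ps_exp [(- t) ^+ r]exprNn.
have : (-1) ^+ r * (-1) ^+ r = 1 :> C by rewrite -exprMn mulN1r opprK expr1n.
by move: ((-1) ^+ r) => e e1; rewrite -[LHS]mulr1 -e1; ring.
Qed.

(** In series form, [Res_y e ^ (y (t + D)) Y[X, z] Y[w, - y] X' = Res_y e ^ (t y) Y[X, z + y]
    Y[X', y] w]. The exponential is carried through [Y[X, z]] by [dpow_mode], and then skew-symmetry
    is undone. *)
Lemma dpow_assoc X X' w (a : int) (N0 N : nat) : (N0 <= N)%N ->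
  (forall r : nat, (N0 <= r)%N -> Z w r X' = 0) ->
  \sum_(q < N) sgn C (q%:Z + 1) *: dpow q (Z X a (Z w q X')) =
  \sum_(m < N) \sum_(i < N) (ps_exp t i * ((-1) ^+ m * binc (a%:~R : C) m)) *:
    Z X (a - m%:Z) (Z X' (m + i)%N%:Z w).
Proof.
move=> N0N H0.
pose F (r m : nat) := (sgn C ((r + m)%N%:Z + 1) * ((-1) ^+ m * binc (a%:~R : C) m)) *:
   Z X (a - m%:Z) (dpow r (Z w (r + m)%N%:Z X')).
transitivity (\sum_(r < N) \sum_(m < N) F r m).
  rewrite (@sum_antidiag _ N)// => [|r m Nrm]; last first.
    by rewrite /F H0 ?dpow_0 ?(bilin0r Z2) ?scaler0//; lia.
  apply: eq_bigr => q _; rewrite dpow_mode scaler_sumr; apply: eq_bigr => m _.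
  have mq : (m <= q)%N by rewrite -ltnS.
  by rewrite /F subnK// scalerA.
rewrite exchange_big /=; apply: eq_bigr => m _.
transitivity (((-1) ^+ m * binc (a%:~R : C) m) *: Z X (a - m%:Z)
   (\sum_(i < N) ps_exp t i *: Z X' (m%:Z + i%:Z) w)); last first.
  rewrite (bilin_sumr Z2) scaler_sumr; apply: eq_bigr => i _.
  by rewrite (bilinZr Z2) scalerA mulrC PoszD.
rewrite (@residue_dpow _ _ _ N0) => [|//|r N0r]; last by rewrite -PoszD H0//; lia.
rewrite (bilin_sumr Z2) scaler_sumr; apply: eq_bigr => r _.
by rewrite (bilinZr Z2) scalerA /F addnC PoszD mulrC.
Qed.

(* Res_y e ^ (t y) Y(Y(A, y1)B, y)w in powers of y1, moved to the other side of w by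
   skew-symmetry *)
Lemma residue_iterate A B w (a : int) : exists N0 : nat, forall N : nat, (N0 <= N)%N ->
  \sum_(i < N) ps_exp t i *: Z (Z A a B) i w =
  \sum_(q < N) sgn C (q%:Z + 1) *: dpow q (Z A a (Z w q B)) +
  \sum_(j < N) (ps_exp (- t) j * sgn C (a + j%:Z + 1)) *:
    \sum_(q < N) sgn C (q%:Z + 1) *: dpow q (Z B (a + j%:Z) (Z w q A)).
Proof.
have trunc0 u x : exists N : nat, forall r : nat, (N <= r)%N -> Z u r x = 0.
  by have [N HN] := trunc_nat Ztrunc u x 0; exists N => i /HN; rewrite add0r.
have [N1 HN1] := trunc0 w A; have [N2 HN2] := trunc0 w (Z A a B).
have [N3 HN3] := @bound_all N1 (fun q j => Z B (a + j%:Z) (Z w q A) = 0)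
  (fun q => trunc_nat Ztrunc B (Z w q A) a).
have HN3' (q j : nat) : (N3 <= j)%N -> Z B (a + j%:Z) (Z w q A) = 0.
  by move=> jN; have [qN|qN] := ltnP q N1; [exact: HN3|rewrite HN1// (bilin0r Z2)].
exists (N1 + N2 + N3)%N => N NN.
under eq_bigr do rewrite -[Posz _]add0r.
rewrite (@residue_dpow _ _ _ N2) => [|//|r]; last first.
- by rewrite add0r => /HN2.
- by lia.
pose H (m j : nat) := sgn C ((m + j)%N%:Z + 1) *: dpow j (dpow m (Z (Z w j A) (a + m%:Z) B)).
transitivity (\sum_(q < N) sgn C (q%:Z + 1) *: dpow q (Z A a (Z w q B)) +
    \sum_(q < N) \sum_(j < q.+1) H (q - j)%N j).
  rewrite -big_split; apply: eq_bigr => q _; rewrite add0r.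
  have -> : Z w q (Z A a B) = Z A a (Z w q B) +
      \sum_(j < q.+1) 'C(q, j)%:R *: Z (Z w j A) (q%:Z + a - j%:Z) B.
    by rewrite -commutator addrC subrK.
  rewrite dpowD scalerDr /=; congr (_ + _).
  rewrite dpow_sum scaler_sumr; apply: eq_bigr => j _; have jq : (j <= q)%N by rewrite -ltnS.
  (* The binomial coefficient is absorbed by splitting [dpow q] into [dpow j] after [dpow (q - j)];
     the inner factor acts on the vertex operator of [w_j A] and is removed below by [dpow_skew]. *)
  rewrite /H -dpow_comp subnK// dpowZ; congr (_ *: (_ *: dpow _ (Z _ _ _))).
  by lia.
congr (_ + _); rewrite -(@sum_antidiag _ N N N H)//; last first.
  move=> m j Nmj; rewrite /H; have [jN|jN] := leqP N1 j.
    by rewrite HN1// (bilin0l Z2) !dpow_0 scaler0.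
  by rewrite (@skew_trunc _ _ _ N3) ?dpow_0 ?scaler0// => [i|]; [exact: HN3'|lia].
rewrite exchange_big /=.
transitivity (\sum_(j < N) sgn C (j%:Z + 1) *: dpow j (\sum_(m < N) sgn C m *: dpow m (Z (Z w j A) (a + m%:Z) B))).
  apply: eq_bigr => j _; rewrite dpow_sum scaler_sumr; apply: eq_bigr => m _.
  rewrite dpowZ [RHS]scalerA /H PoszD -sgnD; congr (sgn _ _ *: _); lia.
transitivity (\sum_(q < N) \sum_(j < N) (ps_exp (- t) j * sgn C (a + j%:Z + 1)) *:
    (sgn C (q%:Z + 1) *: dpow q (Z B (a + j%:Z) (Z w q A)))).
  apply: eq_bigr => q _; rewrite (@dpow_skew _ _ _ N3); last 2 first.
  - by lia.
  - by move=> r; exact: HN3'.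
  rewrite dpow_sum scaler_sumr; apply: eq_bigr => j _.
  by rewrite dpowZ [LHS]scalerA [RHS]scalerA mulrC.
by rewrite exchange_big /=; apply: eq_bigr => j _; rewrite scaler_sumr.
Qed.

(** The coefficients of [Y[e ^ (y D) S, z] = Y[S, z + y]], by iterating the derivative property. *)
Lemma mode_iter_D S (c : int) w (m : nat) :
  (m`!%:R : C)^-1 *: Z (iter m D S) c w = ((-1) ^+ m * binc (c%:~R : C) m) *: Z S (c - m%:Z) w.
Proof.
elim: m c => [|m IH] c; first by rewrite binc0 invr1 mulr1 !scale1r subr0.
have m0 : m.+1%:R != 0 :> C by rewrite pnatr_eq0.
have -> : c - m.+1%:Z = c - 1 - m%:Z by lia.
rewrite iterS deriv factS natrM invfM.
have := IH (c - 1); rewrite scalerA => H.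
transitivity ((- c%:~R / m.+1%:R : C) *: ((m`!%:R : C)^-1 *: Z (iter m D S) (c - 1) w)).
  by rewrite !scalerA; congr (_ *: _); ring.
rewrite IH scalerA; congr (_ *: _).
have E : m.+1%:R * binc (c%:~R : C) m.+1 = c%:~R * binc ((c - 1)%:~R : C) m.
  by rewrite binc_absorb intrB.
apply: (mulfI m0); rewrite exprS [RHS]mulrCA E.
by move: m.+1%:R m0 => x x0; field.
Qed.

Lemma mode_dpow S (c : int) w (q : nat) : Z (dpow q S) c w =
  \sum_(m < q.+1) (ps_exp t (q - m)%N * ((-1) ^+ m * binc (c%:~R : C) m)) *: Z S (c - m%:Z) w.
Proof.
rewrite dpowE (bilin_suml Z2); apply: eq_bigr => m _.
by rewrite (bilinZl Z2) -[LHS]scalerA mode_iter_D [LHS]scalerA.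
Qed.

(** Under the commutator formula, the weights ['C(i, j) t ^ i / i!] factor as [t ^ j / j!] times
    [t ^ (i - j) / (i - j)!]. The first belongs to the residue acting on [E], the second is the
    coefficient of [e ^ (t z)] for the variable [z] of [Y[E, z]]. *)
Lemma residue_mode_comm U E w (c : int) : exists N0 : nat, forall N : nat, (N0 <= N)%N ->
  \sum_(i < N) ps_exp t i *: Z U i (Z E c w) =
  Z E c (\sum_(i < N) ps_exp t i *: Z U i w) +
  \sum_(l < N) ps_exp t l *: Z (\sum_(j < N) ps_exp t j *: Z U j E) (c + l%:Z) w.
Proof.
have trunc0 u x : exists N : nat, forall r : nat, (N <= r)%N -> Z u r x = 0.
  by have [N HN] := trunc_nat Ztrunc u x 0; exists N => i /HN; rewrite add0r.
have [N1 HN1] := trunc0 U E.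
have [N2 HN2] := @bound_all N1 (fun j l => Z (Z U j E) (c + l%:Z) w = 0)
  (fun j => trunc_nat Ztrunc (Z U j E) w c).
exists (N1 + N2)%N => N NN.
pose F (l j : nat) := (ps_exp t j * ps_exp t l) *: Z (Z U j E) (c + l%:Z) w.
transitivity (Z E c (\sum_(i < N) ps_exp t i *: Z U i w) + \sum_(i < N) \sum_(j < i.+1) F (i - j)%N j).
  rewrite (bilin_sumr Z2) -big_split; apply: eq_bigr => i _ /=.
  have -> : Z U i (Z E c w) = Z E c (Z U i w) +
      \sum_(j < i.+1) 'C(i, j)%:R *: Z (Z U j E) (i%:Z + c - j%:Z) w.
    by rewrite -commutator addrC subrK.
  rewrite scalerDr (bilinZr Z2); congr (_ + _); rewrite scaler_sumr; apply: eq_bigr => j _.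
  have ji : (j <= i)%N by rewrite -ltnS.
  have -> : i%:Z + c - j%:Z = c + (i - j)%N%:Z by lia.
  rewrite /F scalerA; congr (_ *: _); rewrite /ps_exp -{1}(subnKC ji) exprD.
  have : ('C(i, j) * (j`! * (i - j)`!))%:R = i`!%:R :> C by rewrite bin_fact.
  rewrite !natrM => <-; have := fact_neq0 C j; have := fact_neq0 C (i - j).
  have : 'C(i, j)%:R != 0 :> C by rewrite pnatr_eq0 -lt0n bin_gt0.
  by move: 'C(i, j)%:R (i - j)`!%:R j`!%:R => x y z x0 y0 z0; field; apply/and3P.
congr (_ + _); rewrite -(@sum_antidiag _ N N N F)//; last first.
  move=> l j Nlj; rewrite /F; have [jN|jN] := leqP N1 j.
    by rewrite HN1// (bilin0l Z2) scaler0.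
  by rewrite HN2 ?scaler0//; lia.
apply: eq_bigr => l _; rewrite (bilin_suml Z2) scaler_sumr; apply: eq_bigr => j _.
by rewrite (bilinZl Z2) scalerA mulrC.
Qed.

(* The coefficient of y1 ^ (-a-1) y2 ^ (-c-1) in the theorem, before applying X_M. *)
Theorem residue_jacobi A B E w (a c : int) : exists N0 : nat, forall N : nat, (N0 <= N)%N ->
  \sum_(i < N) ps_exp t i *: Z (Z A a B) i (Z E c w) =
  \sum_(i < N) \sum_(j < N) (ps_exp t i * ps_exp (- t) j) *: Z E c
     (\sum_(m < N) (sgn C (a + j%:Z + 1) * ((-1) ^+ m * binc ((a + j%:Z)%:~R : C) m)) *:
        Z B (a + j%:Z - m%:Z) (Z A (m + i)%N%:Z w)) +
  \sum_(i < N) ps_exp t i *: Z E c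
     (\sum_(m < N) ((-1) ^+ m * binc (a%:~R : C) m) *: Z A (a - m%:Z) (Z B (m + i)%N%:Z w)) +
  \sum_(i < N) \sum_(j < N) \sum_(l < N) (ps_exp t i * ps_exp (- t) j * ps_exp t l) *:
     \sum_(m < N) (sgn C ((m + i)%N%:Z + 1) * sgn C (a + j%:Z + 1) *
          ((-1) ^+ m * binc ((c + l%:Z)%:~R : C) m)) *:
        Z (Z B (a + j%:Z) (Z E (m + i)%N%:Z A)) (c + l%:Z - m%:Z) w +
  \sum_(i < N) \sum_(l < N) (ps_exp t i * ps_exp t l) *:
     \sum_(m < N) (sgn C ((m + i)%N%:Z + 1) * ((-1) ^+ m * binc ((c + l%:Z)%:~R : C) m)) *:
        Z (Z A a (Z E (m + i)%N%:Z B)) (c + l%:Z - m%:Z) w.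
Proof.
have trunc0 u x : exists N : nat, forall r : nat, (N <= r)%N -> Z u r x = 0.
  by have [N HN] := trunc_nat Ztrunc u x 0; exists N => i /HN; rewrite add0r.
have [N1 HN1] := residue_mode_comm (Z A a B) E w c.
have [N2 HN2] := residue_iterate A B w a.
have [N3 HN3] := residue_iterate A B E a.
have [N4 HN4] := trunc0 w A; have [N5 HN5] := trunc0 w B.
have [N6 HN6] := trunc0 E A; have [N7 HN7] := trunc0 E B.
exists (N1 + N2 + N3 + N4 + N5 + N6 + N7)%N => N NN.
rewrite HN1; last by lia.
rewrite HN2; last by lia.
rewrite HN3; last by lia.
rewrite (bilinDr Z2) -!addrA.
have -> : \sum_(q < N) sgn C (q%:Z + 1) *: dpow q (Z A a (Z w q B)) =
    \sum_(i < N) ps_exp t i *: (\sum_(m < N) ((-1) ^+ m * binc (a%:~R : C) m) *: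
       Z A (a - m%:Z) (Z B (m + i)%N%:Z w)).
  rewrite (@dpow_assoc _ _ _ _ N5) => [|//|//]; last by lia.
  rewrite exchange_big /=; apply: eq_bigr => i _; rewrite scaler_sumr; apply: eq_bigr => m _.
  by rewrite scalerA.
have -> : \sum_(j < N) (ps_exp (- t) j * sgn C (a + j%:Z + 1)) *:
       (\sum_(q < N) sgn C (q%:Z + 1) *: dpow q (Z B (a + j%:Z) (Z w q A))) =
    \sum_(i < N) \sum_(j < N) (ps_exp t i * ps_exp (- t) j) *:
     (\sum_(m < N) (sgn C (a + j%:Z + 1) * ((-1) ^+ m * binc ((a + j%:Z)%:~R : C) m)) *:
        Z B (a + j%:Z - m%:Z) (Z A (m + i)%N%:Z w)).
  rewrite [RHS]exchange_big /=; apply: eq_bigr => j _.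
  rewrite (@dpow_assoc _ _ _ _ N4) => [|//|//]; last by lia.
  rewrite exchange_big /= scaler_sumr; apply: eq_bigr => i _; rewrite !scaler_sumr.
  by apply: eq_bigr => m _; rewrite !scalerA; congr (_ *: _); ring.
rewrite [RHS]addrCA; congr (_ + _).
  by rewrite (bilin_sumr Z2); apply: eq_bigr => i _; rewrite (bilinZr Z2).
congr (_ + _).
  rewrite (bilin_sumr Z2); apply: eq_bigr => i _; rewrite (bilin_sumr Z2).
  by apply: eq_bigr => j _; rewrite (bilinZr Z2).
(* Inside the left argument of a vertex operator in [y2], the exponential becomes the shift from
   [y2] to [y2 + y], by [mode_dpow]. *)
have expand S (l : nat) : (forall q : nat, (N <= q)%N -> S q = 0) ->
    Z (\sum_(q < N) sgn C (q%:Z + 1) *: dpow q (S q)) (c + l%:Z) w =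
    \sum_(i < N) ps_exp t i *: \sum_(m < N) (sgn C ((m + i)%N%:Z + 1) *
       ((-1) ^+ m * binc ((c + l%:Z)%:~R : C) m)) *: Z (S (m + i)%N) (c + l%:Z - m%:Z) w.
  move=> S0; rewrite (bilin_suml Z2).
  pose F (i m : nat) := (sgn C ((i + m)%N%:Z + 1) * (ps_exp t i *
       ((-1) ^+ m * binc ((c + l%:Z)%:~R : C) m))) *: Z (S (i + m)%N) (c + l%:Z - m%:Z) w.
  transitivity (\sum_(q < N) \sum_(m < q.+1) F (q - m)%N m).
    apply: eq_bigr => q _; rewrite (bilinZl Z2) mode_dpow scaler_sumr; apply: eq_bigr => m _.
    have mq : (m <= q)%N by rewrite -ltnS.
    by rewrite scalerA /F subnK.
  rewrite -(@sum_antidiag _ N N N F)//; last first.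
    by move=> i m Nim; rewrite /F S0// (bilin0l Z2) scaler0.
  apply: eq_bigr => i _; rewrite scaler_sumr; apply: eq_bigr => m _.
  by rewrite scalerA /F addnC; congr (_ *: _); ring.
under eq_bigr do rewrite (bilinDl Z2) scalerDr.
rewrite big_split /= addrC; congr (_ + _).
  have S0 (j q : nat) : (N <= q)%N -> Z B (a + j%:Z) (Z E q A) = 0.
    by move=> Nq; rewrite HN6 ?(bilin0r Z2)//; lia.
  rewrite [RHS]exchange_big /=.
  under [RHS]eq_bigr do rewrite exchange_big /=.
  rewrite [RHS]exchange_big /=; apply: eq_bigr => l _.
  rewrite (bilin_suml Z2) scaler_sumr; apply: eq_bigr => j _.
  rewrite (bilinZl Z2) (expand (fun q => Z B (a + j%:Z) (Z E q A)) l (S0 j)) !scaler_sumr.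
  apply: eq_bigr => i _; rewrite !scaler_sumr; apply: eq_bigr => m _.
  by rewrite !scalerA; congr (_ *: _); ring.
have S0 (q : nat) : (N <= q)%N -> Z A a (Z E q B) = 0.
  by move=> Nq; rewrite HN7 ?(bilin0r Z2)//; lia.
rewrite [RHS]exchange_big /=; apply: eq_bigr => l _.
rewrite (expand (fun q => Z A a (Z E q B)) l S0) !scaler_sumr.
apply: eq_bigr => i _; rewrite !scaler_sumr; apply: eq_bigr => m _.
by rewrite !scalerA; congr (_ *: _); ring.
Qed.

End DividedPowers.

Lemma sum_ord_opp (W : zmodType) (p : nat) (f : nat -> W) : (0 < p)%N -> f p = f 0%N ->
  \sum_(r < p) f r = \sum_(r < p) f (p - r)%N.
Proof.
case: p => // p _ fp; rewrite big_ord_recl [RHS]big_ord_recl /= subn0 fp; congr (_ + _).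
rewrite (reindex_inj rev_ord_inj); apply: eq_bigr => r _ /=; congr f.
by rewrite /bump /=; have := ltn_ord r; lia.
Qed.

(** * Homogeneous twisted vertex operators *)

Section Automorphism.
Variables (C : numFieldType) (V : voa C) (nu : automorphism V).
Local Notation Y := (@voa_md C V).
Local Notation Z := (@zhu_md C V).
Implicit Types u v w : V.

Lemma aut_mode v n w : nu (Y v n w) = Y (nu v) n (nu w).
Proof. by rewrite -aut_md aut_funK. Qed.

Lemma aut_homog h u : homog h u -> homog h (nu u).
Proof. by rewrite /homog -{2}(aut_omega nu) -aut_mode => ->; rewrite linearZ. Qed.

Lemma aut_zhu u n v : nu (Z u n v) = Z (nu u) n (nu v).
Proof.
have tE a : nu (zhu_term u n v a) = zhu_term (nu u) n (nu v) a.
  rewrite /zhu_term linear_sum; apply: eq_bigr => i _; rewrite linearZ /= aut_mode.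
  congr (_ *: Y _ _ _); rewrite /L0pow linearZ /=; congr (_ *: _).
  by elim: (a - i)%N => //= k <-; rewrite aut_mode aut_omega.
have [N HN] := zhu_term_trunc u n v.
rewrite !zhu_mdE !(@fsum_ord _ N) => [|a /HN|//]; last by rewrite -tE => ->; rewrite linear0.
by rewrite linear_sum; apply: eq_bigr => a _; rewrite tE.
Qed.

Lemma aut_inv_zhu r u n v :
  iter r (aut_inv nu) (Z u n v) = Z (iter r (aut_inv nu) u) n (iter r (aut_inv nu) v).
Proof.
elim: r => //= r ->; apply: (can_inj (aut_funK nu)).
by rewrite aut_invK aut_zhu !aut_invK.
Qed.

Lemma aut_inv_iter p r u : (forall v, iter p nu v = v) -> (r <= p)%N ->
  iter (p - r) nu u = iter r (aut_inv nu) u.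
Proof.
move=> nup rp; rewrite -{1}[u](_ : iter r nu (iter r (aut_inv nu) u) = u).
  by rewrite -iterD subnK.
by elim: r {rp} u => // r IH u; rewrite iterSr iterS aut_invK IH.
Qed.

End Automorphism.

Section Homogeneous.
Variables (C : numFieldType) (V : voa C) (nu : automorphism V) (p : nat) (zeta : C).
Variable M : twisted_module nu p zeta.
Hypothesis p_gt0 : (0 < p)%N.
Hypothesis zeta_p : zeta ^+ p = 1.
Hypothesis nu_p : forall v : V, iter p nu v = v.
Implicit Types (u v : V) (w : M).
Local Notation Y := (@voa_md C V).
Local Notation Z := (@zhu_md C V).
Local Notation tw := (@tw_md C V nu p zeta M).

Let Y2 : bilin Y := voa_bilin V.
Let Yt : truncated Y := @voa_trunc C V.
Let tw2 : bilin tw := tw_bilin M.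
Let Z2 : bilin Z := zhu_bilin V.

(* the coefficient of x ^ (- l / p) in X_M(v, x) *)
Definition xmode (l : int) v w : M :=
  \sum_(n \in [set: int]) tw (voa_pr V n v) (p%:Z * (n - 1) + l) w.

Lemma pr_support v : exists S : seq int, uniq S /\ forall n, n \notin S -> voa_pr V n v = 0.
Proof.
case: (voa_grading V) => _ fin _ _ _; have /finite_seqP[S SE] := fin v.
exists (undup S); split=> [|n]; first exact: undup_uniq.
rewrite mem_undup => nS; apply/eqP; apply: contraNT nS => vn.
by have : [set n | voa_pr V n v != 0] n by []; rewrite SE.
Qed.

Lemma xmode_seq l v w (S : seq int) : uniq S -> (forall n, n \notin S -> voa_pr V n v = 0) ->
  xmode l v w = \sum_(n <- S) tw (voa_pr V n v) (p%:Z * (n - 1) + l) w.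
Proof. by move=> uS HS; apply: fsum_seq => // n /HS ->; rewrite (bilin0l tw2). Qed.

Lemma xmodeDl l u v w : xmode l (u + v) w = xmode l u w + xmode l v w.
Proof.
have [S [uS HS]] := pr_support u; have [S' [uS' HS']] := pr_support v.
have H n : n \notin undup (S ++ S') -> voa_pr V n u = 0 /\ voa_pr V n v = 0.
  by rewrite mem_undup mem_cat negb_or => /andP[/HS -> /HS' ->].
rewrite !(@xmode_seq _ _ _ (undup (S ++ S'))) ?undup_uniq//.
- by rewrite -big_split; apply: eq_bigr => n _; rewrite linearD (bilinDl tw2).
- by move=> n /H[].
- by move=> n /H[].
- by move=> n /H[E E']; rewrite linearD /= E E' addr0.
Qed.

Lemma xmodeZl l a v w : xmode l (a *: v) w = a *: xmode l v w.
Proof.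
by rewrite /xmode -fsumZ; apply: fsum_eq => n; rewrite linearZ /= (bilinZl tw2).
Qed.

Lemma xmode0l l w : xmode l 0 w = 0.
Proof. by rewrite -(scale0r (0 : V)) xmodeZl scale0r. Qed.

Lemma xmode_suml l I (r : seq I) (P : pred I) (F : I -> V) w :
  xmode l (\sum_(i <- r | P i) F i) w = \sum_(i <- r | P i) xmode l (F i) w.
Proof. by elim/big_rec2: _ => [|i x y _ <-]; rewrite ?xmode0l ?xmodeDl. Qed.

Lemma xmodeDr l v w w' : xmode l v (w + w') = xmode l v w + xmode l v w'.
Proof.
have [S [uS HS]] := pr_support v; rewrite !(@xmode_seq _ _ _ S)// -big_split.
by apply: eq_bigr => n _; rewrite (bilinDr tw2).
Qed.

Lemma xmode0r l v : xmode l v 0 = 0.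
Proof. by apply: fsum_eq0 => n; rewrite (bilin0r tw2). Qed.

(** Projecting [L(0) v = h v] to the graded pieces compares eigenvalues, and distinct integers stay
    distinct in characteristic 0. *)
Lemma pr_homog h v n : homog h v -> voa_pr V n v = if n == h then v else 0.
Proof.
move=> hv; have [S [uS HS]] := pr_support v; have [prpr _ sumE _ _] := voa_grading V.
have pr0 m : m != h -> voa_pr V m v = 0.
  move=> mh; have E : voa_pr V m (Y (omega V) 1 v) = m%:~R *: voa_pr V m v.
    have vE : v = \sum_(m <- S) voa_pr V m v by rewrite {1}[v]sumE; exact: fsum_seq.
    rewrite {1}vE (bilin_sumr Y2) linear_sum -(@fsum_seq _ _ S (fun m' => voa_pr V m (Y (omega V) 1 (voa_pr V m' v))))//.
      rewrite (@fsum_single _ _ m) => [|m' m'm].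
        by rewrite (homog_pr m v) linearZ /= prpr eqxx.
      by rewrite (homog_pr m' v) linearZ /= prpr eq_sym (negPf m'm) scaler0.
    by move=> m' /HS ->; rewrite (bilin0r Y2) linear0.
  move: E; rewrite hv linearZ /= => /eqP; rewrite -subr_eq0 -scalerBl scaler_eq0.
  by rewrite -intrB intr_eq0 subr_eq0 eq_sym (negPf mh) => /eqP.
case: eqP => [->|/eqP /pr0//].
by rewrite [RHS]sumE (@fsum_single _ _ h).
Qed.

Lemma xmode_homog h l v w : homog h v -> xmode l v w = tw v (p%:Z * (h - 1) + l) w.
Proof.
move=> hv; rewrite /xmode (@fsum_single _ _ h) => [|n /negPf nh].
  by rewrite (pr_homog h hv) eqxx.
by rewrite (pr_homog n hv) nh (bilin0l tw2).
Qed.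

Lemma aut_iter_homog h r u : homog h u -> homog h (iter r nu u).
Proof. by move=> hu; elim: r => //= r; exact: aut_homog. Qed.

Let tw_commutator u v (k l : int) w (N : nat) :
  (forall r (i : nat), (r < p)%N -> (N <= i)%N -> Y (iter r nu u) i v = 0) ->
  tw u k (tw v l w) - tw v l (tw u k w) =
  (p%:R : C)^-1 *: \sum_(r < p) (zeta ^+ r) ^ (- k) *: \sum_(j < N)
      binc (k%:~R / p%:R) j *: tw (Y (iter r nu u) j v) (k + l - p%:Z * j%:Z) w.
Proof.
move=> HN; rewrite (@jacobi_commutator _ _ _ p Y tw zeta (fun r => iter r nu) u v w)//.
  congr (_ *: _); apply: eq_bigr => r _; congr (_ *: _).
  by rewrite (@fsum_ord _ N)// => j Nj; rewrite HN// (bilin0l tw2) scaler0.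
exact: tw_jacobi.
Qed.

(** With [k] replaced by [p (h - 1) + k] in the commutator of modes, the upper argument of the
    binomial is [k / p + h - 1], which [zhu_residue] recognizes as the residue against [e ^ (t y)]
    with [t = k / p]. *)
Let xmode_commutator_homog h h' u v (k l : int) w : homog h u -> homog h' v ->
  exists N0 : nat, forall N : nat, (N0 <= N)%N ->
  xmode k u (xmode l v w) - xmode l v (xmode k u w) =
  (p%:R : C)^-1 *: \sum_(r < p) (zeta ^- r) ^ (- k) *:
    xmode (k + l) (\sum_(m < N) ps_exp (k%:~R / p%:R) m *: Z (iter r (aut_inv nu) u) m v) w.
Proof.
move=> hu hv.
have [N0 HN0] := @bound_all p.+1 (fun r i => Y (iter r nu u) i v = 0) (fun r =>
  let: ex_intro N HN := trunc_nat Yt (iter r nu u) v 0 in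
  ex_intro _ N (fun i Ni => etrans (congr1 (fun x => Y _ x v) (esym (add0r _))) (HN i Ni))).
exists N0 => N N0N.
have p0' : p%:R != 0 :> C by rewrite pnatr_eq0 -lt0n.
have zeta0 : zeta != 0.
  apply/eqP => z0; move: zeta_p; rewrite z0 expr0n (gtn_eqF p_gt0) => /eqP.
  by rewrite eq_sym oner_eq0.
pose f (r : nat) : M := (zeta ^+ r) ^ (- k) *:
  xmode (k + l) (\sum_(m < N) ps_exp (k%:~R / p%:R) m *: Z (iter r nu u) m v) w.
transitivity ((p%:R : C)^-1 *: \sum_(r < p) f r); last first.
  (* The index [r] is replaced by [p - r], which turns [nu ^ r] into [nu ^ (- r)] and [zeta ^ r]
     into [zeta ^ (- r)]. *)
  congr (_ *: _); rewrite sum_ord_opp//; last by rewrite /f zeta_p nu_p expr0.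
  apply: eq_bigr => r _; rewrite /f (aut_inv_iter _ nu_p) ?(ltnW (ltn_ord r))//.
  congr (_ ^ _ *: _); apply: (mulIf (expf_neq0 r zeta0)).
  by rewrite -exprD subnK ?(ltnW (ltn_ord r))// zeta_p mulVf// expf_neq0.
rewrite (xmode_homog l _ hv) !(xmode_homog k _ hu) (xmode_homog l _ hv).
rewrite (@tw_commutator _ _ _ _ _ N) => [|r i rp Ni]; last first.
  by apply: HN0; [exact: leqW|exact: leq_trans N0N Ni].
congr (_ *: _); apply: eq_bigr => r _; rewrite /f.
have zr (a : int) : (zeta ^+ r) ^ (- (p%:Z * a + k)) = (zeta ^+ r) ^ (- k).
  rewrite opprD -mulrN expfzDr ?expf_neq0// -exprz_exp.
  by rewrite -[(zeta ^+ r) ^ p%:Z]/((zeta ^+ r) ^+ p) exprAC zeta_p expr1n exp1rz mul1r.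
rewrite zr; congr (_ *: _).
rewrite (@zhu_residue _ _ h) => [||i Ni]; last 2 first.
- exact: aut_iter_homog.
- by apply: HN0; [exact: leqW|exact: leq_trans N0N Ni].
rewrite xmode_suml; apply: eq_bigr => j _; rewrite xmodeZl; congr (_ *: _).
  congr binc; rewrite intrD intrM intrB -pmulrn mulrDl mulrAC mulfV// mul1r.
  by ring.
rewrite (xmode_homog _ _ (homog_mode j (aut_iter_homog r hu) hv)); congr (tw _ _ w).
by ring.
Qed.

Lemma xmode_commutator u v (k l : int) w : exists N0 : nat, forall N : nat, (N0 <= N)%N ->
  xmode k u (xmode l v w) - xmode l v (xmode k u w) =
  (p%:R : C)^-1 *: \sum_(r < p) (zeta ^- r) ^ (- k) *:
    xmode (k + l) (\sum_(m < N) ps_exp (k%:~R / p%:R) m *: Z (iter r (aut_inv nu) u) m v) w.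
Proof.
have aD r x y : iter r (aut_inv nu) (x + y) = iter r (aut_inv nu) x + iter r (aut_inv nu) y.
  elim: r => //= r ->; apply: (can_inj (aut_funK nu)).
  by rewrite linearD /= !aut_invK.
have a0 r : iter r (aut_inv nu) 0 = 0.
  by apply: (addrI (iter r (aut_inv nu) 0)); rewrite -aD !addr0.
elim/homog_ind: u => [|u u' [N0 IH] [N0' IH']|h u hu].
- exists 0%N => N _; rewrite !xmode0l xmode0r subr0 big1 ?scaler0// => r _.
  rewrite big1 ?xmode0l ?scaler0// => m _.
  by rewrite a0 (bilin0l Z2) scaler0.
- exists (maxn N0 N0') => N; rewrite geq_max => /andP[/IH E /IH' E'].
  rewrite !xmodeDl xmodeDr opprD addrACA E E' -scalerDr -big_split; congr (_ *: _).
  apply: eq_bigr => r _; rewrite /= -scalerDr -xmodeDl -big_split; congr (_ *: xmode _ _ _).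
  by apply: eq_bigr => m _; rewrite aD (bilinDl Z2) scalerDr.
elim/homog_ind: v => [|v v' [N0 IH] [N0' IH']|h' v hv].
- exists 0%N => N _; rewrite !xmode0l xmode0r subr0 big1 ?scaler0// => r _.
  rewrite big1 ?xmode0l ?scaler0// => m _.
  by rewrite (bilin0r Z2) scaler0.
- exists (maxn N0 N0') => N; rewrite geq_max => /andP[/IH E /IH' E'].
  rewrite !xmodeDl xmodeDr opprD addrACA E E' -scalerDr -big_split; congr (_ *: _).
  apply: eq_bigr => r _; rewrite /= -scalerDr -xmodeDl -big_split; congr (_ *: xmode _ _ _).
  by apply: eq_bigr => m _; rewrite (bilinDr Z2) scalerDr.
exact: xmode_commutator_homog hu hv.
Qed.

End Homogeneous.

(** * Coefficients of nested vertex operators *)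

Section Coefficients.
Variables (C : numFieldType) (V : voa C).
Local Notation Z := (@zhu_md C V).
Let Z2 : bilin Z := zhu_bilin V.

Lemma avoids_fmapc (A B : zmodType) (f : A -> B) i (s : fser A) : f 0 = 0 ->
  avoids i s -> avoids i (fmapc f s).
Proof. by move=> f0 si e /si; rewrite /fmapc => ->. Qed.

Lemma sum_varp (A : zmodType) (W : lmodType C) (f : int -> A -> W) (w : C) i (t : fser A) (e : expo) (n : int) :
  (forall k, f k 0 = 0) -> avoids i t -> e 0 i = (- n - 1)%:~R ->
  \sum_(k \in [set: int]) fscale (scalep w (varp i) (- k - 1%:Z)) (fmapc (f k) t) e =
  w ^ (- n - 1) *: f n (t (e + (n + 1)%:~R *: delta_mx 0 i)).
Proof.
move=> f0 ti ei.
have E (k : int) : e - (- k - 1%:Z)%:~R *: delta_mx 0 i = e + (k + 1)%:~R *: delta_mx 0 i.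
  by rewrite -scaleNr -rmorphN; congr (_ + _%:~R *: _); lia.
rewrite (@fsum_single _ _ n) => [|k kn]; rewrite fscale_scalep fscale_varp E.
  by [].
rewrite (avoids_fmapc _ ti) ?scaler0// expoD delta_coord eqxx ei -intrD intr_eq0.
by apply: contra_neq kn; lia.
Qed.

(** As [t] does not involve the variable [i], the exponent of that variable ties the mode to the
    order [m] of the binomial expansion by [k = n - m]. The function [f] stands for the modes with
    either argument held fixed. *)
Lemma sum_sump (A : zmodType) (W : lmodType C) (f : int -> A -> W) (w c : C) i j (t : fser A) (e : expo) (n : int) :
  (forall k, f k 0 = 0) -> i != j -> avoids i t -> e 0 i = (- n - 1)%:~R ->
  \sum_(k \in [set: int]) fscale (scalep w (sump i c j) (- k - 1%:Z)) (fmapc (f k) t) e =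
  \sum_(m \in [set: nat]) (w ^ (m%:Z - 1 - n) * (binc (m%:R - 1 - n%:~R) m * c ^+ m)) *:
    f (n - m%:Z) (t (e + (n + 1)%:~R *: delta_mx 0 i - m%:R *: delta_mx 0 j)).
Proof.
move=> f0 ij ti ei.
have ekm (k : int) (m : nat) : k <> n - m%:Z ->
    fmapc (f k) t (e - (((- k - 1%:Z)%:~R - m%:R) *: delta_mx 0 i + m%:R *: delta_mx 0 j)) = 0.
  move=> kn; apply: (avoids_fmapc (f0 k) ti).
  rewrite expoD expoN expoD !delta_coord eqxx [j == i]eq_sym (negPf ij) addr0 ei.
  rewrite pmulrn -!intrB intr_eq0; apply/eqP => E; apply: kn; lia.
rewrite (@fsum_inj _ _ nat (fun m => n - m%:Z)).
- apply: fsum_eq => m; rewrite fscale_scalep fscale_binpow// (@fsum_single _ _ m) => [|m' m'm].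
    rewrite scalerA ratr_int.
    have -> : - (n - m%:Z) - 1%:Z = m%:Z - 1 - n by lia.
    have -> : (m%:Z - 1 - n)%:~R = m%:R - 1 - n%:~R :> C by rewrite !intrB -!pmulrn.
    congr (_ *: f _ (t _)); rewrite opprD addrA -scaleNr; congr (_ + _ *: _ - _).
    by rewrite !intrB intrD -!pmulrn; ring.
  by rewrite ekm ?scaler0//; move/eqP: m'm => m'm E; apply: m'm; lia.
- by move=> m m' /addrI/oppr_inj[].
- move=> k kn; rewrite fscale_scalep fscale_binpow// fsum_eq0 ?scaler0// => m.
  by rewrite ekm ?scaler0//; exact: kn.
Qed.

Lemma zhuY_varp (w : C) u i (t : fser V) (e : expo) (n : int) :
  avoids i t -> e 0 i = (- n - 1)%:~R ->
  zhuY u%:fs (scalep w (varp i)) t e = w ^ (- n - 1) *: Z u n (t (e + (n + 1)%:~R *: delta_mx 0 i)).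
Proof.
move=> ti ei; rewrite /zhuY (vop_constl _ _ _ _ _ Z2).
by rewrite (@sum_varp _ _ (fun k x => Z u k x) _ _ _ _ n)// => k; rewrite (bilin0r Z2).
Qed.

Lemma zhuY_sumpl (w c : C) u i j (t : fser V) (e : expo) (n : int) : i != j ->
  avoids i t -> e 0 i = (- n - 1)%:~R ->
  zhuY u%:fs (scalep w (sump i c j)) t e =
  \sum_(m \in [set: nat]) (w ^ (m%:Z - 1 - n) * (binc (m%:R - 1 - n%:~R) m * c ^+ m)) *:
    Z u (n - m%:Z) (t (e + (n + 1)%:~R *: delta_mx 0 i - m%:R *: delta_mx 0 j)).
Proof.
move=> ij ti ei; rewrite /zhuY (vop_constl _ _ _ _ _ Z2).
by rewrite (@sum_sump _ _ (fun k x => Z u k x) _ _ _ _ _ _ n)// => k; rewrite (bilin0r Z2).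
Qed.

Lemma zhuY_sumpr (w c : C) v i j (s : fser V) (e : expo) (n : int) : i != j ->
  avoids i s -> e 0 i = (- n - 1)%:~R ->
  zhuY s (scalep w (sump i c j)) v%:fs e =
  \sum_(m \in [set: nat]) (w ^ (m%:Z - 1 - n) * (binc (m%:R - 1 - n%:~R) m * c ^+ m)) *:
    Z (s (e + (n + 1)%:~R *: delta_mx 0 i - m%:R *: delta_mx 0 j)) (n - m%:Z) v.
Proof.
move=> ij ti ei; rewrite /zhuY (vop_constr _ _ _ _ _ Z2).
by rewrite (@sum_sump _ _ (fun k x => Z x k v) _ _ _ _ _ _ n)// => k; rewrite (bilin0l Z2).
Qed.

End Coefficients.

Section HomogeneousCoefficients.
Variables (C : numFieldType) (V : voa C) (nu : automorphism V) (p : nat) (zeta : C).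
Variable M : twisted_module nu p zeta.
Hypothesis p_gt0 : (0 < p)%N.
Local Notation tw := (@tw_md C V nu p zeta M).
Let tw2 : bilin tw := tw_bilin M.

Lemma xL0E i (s : fser V) e :
  xL0 i s e = \sum_(n \in [set: int]) voa_pr V n (s (e - n%:~R *: delta_mx 0 i)).
Proof. by apply: fsum_eq => n; rewrite fscale_mono. Qed.

(** The exponent of the variable [i] couples the mode [k] to the weight [n] through
    [k = p (n - 1) + l], the index used in [xmode]. *)
Lemma sum_xL0 i (s : fser V) (e : expo) (l : int) (w : M) :
  avoids i s -> e 0 i = - (l%:~R / p%:R) ->
  \sum_(k \in [set: int]) tw (xL0 i s (e + ((k + p%:Z)%:~R / p%:R) *: delta_mx 0 i)) k w =
  xmode l (s (e + (l%:~R / p%:R) *: delta_mx 0 i)) w.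
Proof.
move=> si ei; have p0 : p%:R != 0 :> rat by rewrite pnatr_eq0 -lt0n.
have E (k n : int) : k <> p%:Z * (n - 1) + l ->
    s (e + ((k + p%:Z)%:~R / p%:R) *: delta_mx 0 i - n%:~R *: delta_mx 0 i) = 0.
  move=> kn; apply: si; rewrite !(expoD, expoN) !delta_coord eqxx ei.
  apply/eqP => H; apply: kn; apply/eqP; rewrite -(eqr_int rat).
  rewrite -subr_eq0 -(mulIr_eq0 _ (mulIf (invr_neq0 p0))) -[X in _ == X]H; apply/eqP.
  by rewrite !(intrD, intrM, intrN) -!pmulrn; field.
rewrite (@fsum_inj _ _ int (fun n => p%:Z * (n - 1) + l)).
- apply: fsum_eq => n; rewrite xL0E (@fsum_single _ _ n) => [|n' n'n].
    congr (tw (voa_pr V n (s _)) _ w); rewrite -addrA -scalerBl; congr (_ + _ *: _).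
    by rewrite !(intrD, intrM, intrN) -!pmulrn; field.
  rewrite E ?linear0//; move/eqP: n'n => n'n /addIr H; apply: n'n.
  by have p0' : p%:Z != 0 by [rewrite eqz_nat -lt0n|]; move/(mulfI p0')/addIr: H.
- move=> n n' /addIr H; have p0' : p%:Z != 0 by rewrite eqz_nat -lt0n.
  by move/(mulfI p0')/addIr: H.
- move=> k kn; rewrite xL0E fsum_eq0 ?(bilin0l tw2)// => n.
  by rewrite E ?linear0//; exact: kn.
Qed.

Lemma homY_const i (s : fser V) (e : expo) (l : int) (w : M) :
  avoids i s -> e 0 i = - (l%:~R / p%:R) ->
  homY s i w%:fs e = xmode l (s (e + (l%:~R / p%:R) *: delta_mx 0 i)) w.
Proof. by move=> si ei; rewrite /homY vop_rootpr// (@sum_xL0 _ _ _ l). Qed.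

Definition only (I : pred 'I_6) (e : expo) := forall i, ~~ I i -> e 0 i = 0.

Lemma onlyD I d e : only I d -> only I e -> only I (d + e).
Proof. by move=> Id Ie i nI; rewrite expoD Id// Ie// addr0. Qed.

Lemma only0 I : only I 0.
Proof. by move=> i _; rewrite mxE. Qed.

Lemma only_delta (I : pred 'I_6) q i : I i -> only I (q *: delta_mx 0 i).
Proof. by move=> Ii j nI; rewrite delta_coord; case: eqP nI Ii => // <- /negPf ->. Qed.

Lemma avoids_only (W : zmodType) I (s : fser W) i : supp_in (only I) s -> ~~ I i -> avoids i s.
Proof. by move=> sI nI e ei; apply: sI => /(_ i nI) e0; rewrite e0 eqxx in ei. Qed.

Lemma homY_disjoint i (I J : pred 'I_6) (s : fser V) (t : fser M) (a b : expo) (l : int) :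
  supp_in (only I) s -> supp_in (only J) t -> ~~ I i -> ~~ J i -> (forall j, I j -> ~~ J j) ->
  only I (a - a 0 i *: delta_mx 0 i) -> only J b -> a 0 i = - (l%:~R / p%:R) ->
  homY s i t (a + b) = xmode l (s (a + (l%:~R / p%:R) *: delta_mx 0 i)) (t b).
Proof.
move=> sI tJ Ii Ji IJ aI bJ ai.
rewrite -sum_xL0//; last exact: avoids_only sI Ii.
apply: fsum_eq => k; rewrite fscale_rootp -opprD rmorphN /= mulNr scaleNr opprK addrAC.
apply: (@fprod2_disjoint _ _ _ _ (predU (pred1 i) I) J) => //.
- by move=> w; rewrite (bilin0l tw2).
- by move=> v; rewrite (bilin0r tw2).
- by move=> j /orP[/eqP ->|/IJ].
- apply: supp_fsum => n; apply: supp_fscale => [d e||]; first exact: onlyD.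
    by apply: supp_mono; apply: only_delta; rewrite /= eqxx.
  apply: supp_fmapc; first by rewrite linear0.
  by move=> e eI; apply: sI => H; apply: eI => j; rewrite negb_or => /andP[_ /H].
- move=> j; rewrite negb_or /= => /andP[/negPf ji nIj]; have := aI j nIj.
  by rewrite !(expoD, expoN) !delta_coord [i == j]eq_sym ji ?oppr0 ?addr0.
Qed.

(** The exponent [- k / p] of [x1] selects the power [- k] of the delta function. This moves the
    exponent of [x2] to [- (k + l) / p] and contributes [e ^ (- t (a y + b y1 + c y2))]; with
    [a = -1] the weight [e ^ (t y)] reappears. *)
Lemma fscale_delta_homY (w a b c : C) (S : fser V) (k l : int) (s q r : rat) (N : nat) (x : M) :
  supp_in (only (fun i => i \in [:: vy; vy1; vy2])) S ->
  let t : C := k%:~R / p%:R in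
  let coef (i j h : nat) : C := ps_exp (- t * a) i * ps_exp (- t * b) j * ps_exp (- t * c) h in
  let f (i j h : nat) : V := coef i j h *: S (ex6 0 0 0 (s - i%:R) (q - j%:R) (r - h%:R)) in
  (forall i j h, (N <= i)%N || (N <= j)%N || (N <= h)%N -> f i j h = 0) ->
  fscale (delta (scalep w (expquotp p (linexp a b c)))) (homY S vx2 x%:fs)
    (ex6 0 (- (k%:~R / p%:R)) (- (l%:~R / p%:R)) s q r) =
  w ^ (- k) *: xmode (k + l) (\sum_(i < N) \sum_(j < N) \sum_(h < N) f i j h) x.
Proof.
move=> SI t coef f f0.
have avS i : i \notin [:: vy; vy1; vy2] -> avoids i S by exact: avoids_only SI.
have -> : - (k%:~R / p%:R) = (- k)%:~R / p%:R :> rat by rewrite rmorphN mulNr.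
rewrite fscale_delta_exp//; last first.
  move=> e e1; rewrite /homY vop_rootpr// fsum_eq0// => n.
  rewrite xL0E fsum_eq0 ?(bilin0l tw2)// => n'; rewrite (avS vx1) ?linear0//.
  by rewrite !(expoD, expoN) !delta_coord /= addr0 subr0.
congr (_ *: _).
have E (y : nat * nat * nat) :
  (ps_exp ((- k)%:~R / p%:R * a) y.1.1 * ps_exp ((- k)%:~R / p%:R * b) y.1.2 *
     ps_exp ((- k)%:~R / p%:R * c) y.2) *:
    homY S vx2 x%:fs (ex6 0 0 (- (l%:~R / p%:R) + (- k)%:~R / p%:R) (s - y.1.1%:R) (q - y.1.2%:R) (r - y.2%:R)) =
  xmode (k + l) (f y.1.1 y.1.2 y.2) x.
  rewrite (@homY_const _ _ _ (k + l)); last 2 first.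
  - exact: avS.
  - by rewrite ex6_coord !rmorphD rmorphN /= mulNr mulrDl opprD addrC.
  rewrite /f xmodeZl /coef /t rmorphN mulNr; congr (_ *: xmode _ (S _) _).
  rewrite !ex6E rmorphN mulNr !addr0 rmorphD /= mulrDl; congr ex6.
  by ring.
rewrite (fsum_eq E) (@fsum_nat3 _ N) => [|i j h ijh]; last by rewrite /= f0// xmode0l.
rewrite xmode_suml; apply: eq_bigr => i _; rewrite xmode_suml; apply: eq_bigr => j _.
by rewrite xmode_suml; apply: eq_bigr => h _.
Qed.

End HomogeneousCoefficients.

Section Supports.
Variables (C : numFieldType) (P : expo -> Prop).
Hypothesis PD : forall d e, P d -> P e -> P (d + e).

Lemma supp_scalep (w : C) (z : powers C) : (forall n, supp_in P (z n)) ->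
  forall n, supp_in P (scalep w z n).
Proof. by move=> Pz n; exact: supp_scale. Qed.

Lemma supp_varp i : (forall n : int, P (n%:~R *: delta_mx 0 i)) ->
  forall n, supp_in P (varp i n : fser C^o).
Proof. by move=> Pi n; exact: supp_mono. Qed.

Lemma supp_sump i (c : C) j : (forall n : int, P (n%:~R *: delta_mx 0 i)) ->
  (forall n : int, P (n%:~R *: delta_mx 0 j)) -> forall n, supp_in P (sump i c j n).
Proof.
move=> Pi Pj n; apply: supp_binpow => m; apply: PD; last by rewrite pmulrn.
by rewrite pmulrn -intrB.
Qed.

Lemma supp_zhuY (V : voa C) (s : fser V) z t : (forall n, supp_in P (z n)) ->
  supp_in P s -> supp_in P t -> supp_in P (zhuY s z t).
Proof. by move=> *; apply: supp_vop => //; exact: zhu_bilin. Qed.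

Lemma supp_homY (V : voa C) (nu : automorphism V) (p : nat) (zeta : C)
    (M : twisted_module nu p zeta) (s : fser V) i (t : fser M) :
  (forall n : int, P (n%:~R *: delta_mx 0 i)) ->
  (forall n : int, P ((n%:~R / p%:R) *: delta_mx 0 i)) ->
  supp_in P s -> supp_in P t -> supp_in P (homY s i t).
Proof.
move=> Pi Pi' Ps Pt; apply: supp_vop => //; first exact: tw_bilin.
  by move=> n; exact: supp_mono.
apply: supp_fsum => n; apply: supp_fscale => //; first exact: supp_mono.
by apply: supp_fmapc => //; rewrite linear0.
Qed.

Lemma supp_delta_expquotp (p : nat) (w a b c : C) :
  (forall (n : int) (i j k : nat), P (ex6 0 (n%:~R / p%:R) (- (n%:~R / p%:R)) i%:R j%:R k%:R)) ->
  supp_in P (delta (scalep w (expquotp p (linexp a b c)))).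
Proof.
move=> Pn e Pe; rewrite delta_expquotpE fsum_eq0// => n.
apply/eqP; rewrite mulf_eq0; apply/orP; right; rewrite /expserE.
rewrite !(expoD, expoN) !ex6_coord !subr0 opprK.
case: ifP => // /and3P[/eqP e0 /eqP e1 /eqP e2]; apply: contraT.
have nat_of (u : C) r : expcoef u r != 0 -> exists m : nat, r = m%:R.
  move=> u0; apply: contrapT => rn; case/eqP: u0; apply: expcoef_eq0 => m rE; apply: rn.
  by exists m.
rewrite !mulf_eq0 !negb_or => /andP[/andP[/nat_of[i iE] /nat_of[j jE]] /nat_of[k kE]].
case: Pe; rewrite [e]ex6_eta e0 iE jE kE.
have -> : e 0 vx1 = n%:~R / p%:R by apply/eqP; rewrite -subr_eq0 e1.
by have -> : e 0 vx2 = - (n%:~R / p%:R) by apply/eqP; rewrite -addr_eq0 e2.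
Qed.

End Supports.

(** * The four summands of the commutator formula *)

Section Terms.
Variables (C : numFieldType) (V : voa C) (nu : automorphism V) (p : nat) (zeta : C).
Variable M : twisted_module nu p zeta.
Hypothesis p_gt0 : (0 < p)%N.
Local Notation Z := (@zhu_md C V).
Implicit Types (A B E w : V) (x : M).
Let Z2 : bilin Z := zhu_bilin V.

Let ytrunc u v : exists N : nat, forall i : nat, (N <= i)%N -> Z u i v = 0.
Proof. by have [N HN] := trunc_nat (@zhu_trunc C V) u v 0; exists N => i /HN; rewrite add0r. Qed.

Let I1 : pred 'I_6 := fun i => i \in [:: vy].
Let I2 : pred 'I_6 := fun i => i \in [:: vy; vy1].
Let I3 : pred 'I_6 := fun i => i \in [:: vy; vy1; vy2].

Let only_var (I : pred 'I_6) i : I i -> forall n : int, only I (n%:~R *: delta_mx 0 i).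
Proof. by move=> Ii n; exact: only_delta. Qed.

Let supp_w (I : pred 'I_6) w : supp_in (only I) w%:fs.
Proof. by apply: supp_fconst; exact: only0. Qed.

Lemma fconst0 w (e : expo) : e = 0 -> w%:fs e = w.
Proof. by move=> ->; rewrite /fconst eqxx. Qed.

(** The argument of [X_M] in the first two summands of the theorem: [w0 = c0 = -1] gives the
    variable [- y1 + y], and [w0 = c0 = 1] gives [y1 + y]. *)
Definition nestr (w0 c0 : C) A B E w :=
  zhuY E%:fs (varp vy2) (zhuY B%:fs (scalep w0 (sump vy1 c0 vy)) (zhuY A%:fs (varp vy) w%:fs)).

Lemma supp_nestr (w0 c0 : C) A B E w : supp_in (only I3) (nestr w0 c0 A B E w).
Proof.
have D := @onlyD I3; have V1 i : I3 i -> forall n, supp_in (only I3) (varp i n : fser C^o).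
  by move=> Ii; apply: supp_varp; exact: only_var.
apply: (supp_zhuY D (V1 vy2 isT) (supp_w _)).
apply: (supp_zhuY D _ (supp_w _)).
  by apply: supp_scalep; apply: (supp_sump D); exact: only_var.
exact: (supp_zhuY D (V1 vy isT) (supp_w _) (supp_w _)).
Qed.

Definition nestr_coef (w0 c0 : C) (n : int) A B w (i m : nat) : V :=
  (w0 ^ (m%:Z - 1 - n) * (binc (m%:R - 1 - n%:~R) m * c0 ^+ m)) *:
     Z B (n - m%:Z) (Z A (m + i)%N%:Z w).

(** The shifts [i], [j], [h] are the powers of [y], [y1], [y2] taken from the exponential in the
    delta function; the [-1] is the residue in [y]. *)
Lemma nestrE (w0 c0 : C) A B E w (a c : int) (i j h : nat) :
  nestr w0 c0 A B E w (ex6 0 0 0 (-1 - i%:R) ((- a - 1)%:~R - j%:R) ((- c - 1)%:~R - h%:R)) =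
  Z E (c + h%:Z) (\sum_(m \in [set: nat]) nestr_coef w0 c0 (a + j%:Z) A B w i m).
Proof.
have D := onlyD; have V1 (I : pred 'I_6) i' : I i' -> forall n, supp_in (only I) (varp i' n : fser C^o).
  by move=> Ii; apply: supp_varp; exact: only_var.
have s1 : supp_in (only I1) (zhuY A%:fs (varp vy) w%:fs).
  exact: (supp_zhuY (@D _) (V1 _ vy isT) (supp_w _) (supp_w _)).
have s1' : supp_in (only I2) (zhuY A%:fs (varp vy) w%:fs).
  exact: (supp_zhuY (@D _) (V1 _ vy isT) (supp_w _) (supp_w _)).
have s2 : supp_in (only I2) (zhuY B%:fs (scalep w0 (sump vy1 c0 vy)) (zhuY A%:fs (varp vy) w%:fs)).
  apply: (supp_zhuY (@D _) _ (supp_w _)) => //.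
  by apply: supp_scalep; apply: (supp_sump (@D _)); exact: only_var.
rewrite /nestr -[varp vy2]scalep1 (@zhuY_varp _ _ _ _ _ _ _ (c + h%:Z)); last 2 first.
- exact: (avoids_only s2).
- by rewrite ex6_coord !(intrD, intrN) -pmulrn; ring.
rewrite exp1rz scale1r; congr (Z _ _ _).
rewrite (@zhuY_sumpl _ _ _ _ _ _ _ _ _ (a + j%:Z))//; last 2 first.
- exact: (avoids_only s1).
- by rewrite !ex6E ex6_coord !(intrD, intrN) -!pmulrn; ring.
apply: fsum_eq => m; rewrite /nestr_coef; congr (_ *: Z _ _ _).
rewrite -[varp vy]scalep1 (@zhuY_varp _ _ _ _ _ _ _ (m + i)%N%:Z); last 2 first.
- exact: avoids_fconst.
- by rewrite !ex6E ex6_coord !(intrD, intrN) -!pmulrn natrD; ring.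
rewrite exp1rz scale1r; congr (Z _ _ _); apply: fconst0.
by rewrite !ex6E -ex60 !(intrD, intrN) -!pmulrn natrD; congr ex6; ring.
Qed.

Definition nestr_sum (t w0 c0 beta : C) A B E w (a c : int) (N : nat) : V :=
  \sum_(i < N) \sum_(j < N) (ps_exp t i * ps_exp (- t * beta) j) *:
    Z E c (\sum_(m < N) nestr_coef w0 c0 (a + j%:Z) A B w i m).

Lemma nestr_term (z w0 c0 beta : C) A B E v (a c k l : int) x :
  exists N0 : nat, forall N : nat, (N0 <= N)%N ->
  fscale (delta (scalep z (expquotp p (linexp (-1) beta 0)))) (homY (nestr w0 c0 A B E v) vx2 x%:fs)
    (ex6 0 (- (k%:~R / p%:R)) (- (l%:~R / p%:R)) (-1) (- a - 1)%:~R (- c - 1)%:~R) =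
  z ^ (- k) *: xmode (k + l) (nestr_sum (k%:~R / p%:R) w0 c0 beta A B E v a c N) x.
Proof.
have [N1 HN1] := ytrunc A v.
have [N2 HN2] := @bound_all N1 (fun q j => Z B (a + j%:Z) (Z A q v) = 0)
  (fun q => trunc_nat (@zhu_trunc C V) B (Z A q v) a).
(* At least 1, so that the sum over [h] contains [h = 0], its only nonzero term: the exponential
   does not involve [y2]. *)
exists (N1 + N2).+1 => N NN; set t : C := k%:~R / p%:R.
have coefm0 (i j m : nat) : (N1 <= m + i)%N -> nestr_coef w0 c0 (a + j%:Z) A B v i m = 0.
  by move=> mi; rewrite /nestr_coef HN1// (bilin0r Z2) scaler0.
have coefj0 (i j m : nat) : (N <= j)%N -> nestr_coef w0 c0 (a + j%:Z) A B v i m = 0.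
  move=> jN; have [mi|mi] := ltnP (m + i) N1; last exact: coefm0.
  have E' : a + j%:Z - m%:Z = a + (j - m)%N%:Z by lia.
  by rewrite /nestr_coef E' HN2 ?scaler0//; lia.
have exp0 (h : nat) : (0 < h)%N -> ps_exp (- t * 0) h = 0.
  by case: h => // h _; rewrite mulr0 ps_exp0 ps1.
rewrite (@fscale_delta_homY _ _ _ _ _ _ p_gt0 _ _ _ _ _ k l _ _ _ N); last 2 first.
- exact: supp_nestr.
- move=> i j h ijh; rewrite nestrE.
  have [iN|iN] := leqP N i.
    by rewrite fsum_eq0 ?(bilin0r Z2) ?scaler0// => m; rewrite coefm0//; lia.
  have [jN|jN] := leqP N j.
    by rewrite fsum_eq0 ?(bilin0r Z2) ?scaler0// => m; rewrite coefj0//; lia.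
  by rewrite exp0 ?mulr0 ?scale0r//; lia.
congr (_ *: xmode _ _ _); apply: eq_bigr => i _; apply: eq_bigr => j _.
case: N NN coefj0 i j => // N NN _ i j; rewrite [LHS]big_ord_recl [X in _ + X]big1 => [|h _]; last first.
  by rewrite exp0 ?mulr0 ?scale0r.
rewrite [LHS]addr0 nestrE mulr0 ps_exp0 ps1 mulr1 mulrN1 opprK /= addr0; congr (_ *: Z _ _ _).
by rewrite (@fsum_ord _ N.+1)// => m mN; rewrite coefm0//; lia.
Qed.

(** The inner argument in the last two summands of the theorem, with [w1 = -1] for [- y1] and
    [w1 = 1] for [y1]. *)
Definition nestl_arg (w1 : C) A B E := zhuY B%:fs (scalep w1 (varp vy1)) (zhuY E%:fs (scalep (-1) (varp vy)) A%:fs).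

Definition nestl (w1 : C) A B E w := zhuY (nestl_arg w1 A B E) (sump vy2 1 vy) w%:fs.

Lemma supp_nestl_arg (w1 : C) A B E : supp_in (only I2) (nestl_arg w1 A B E).
Proof.
have D := @onlyD I2; have V1 (z : C) i : I2 i -> forall n, supp_in (only I2) (scalep z (varp i) n).
  by move=> Ii; apply: supp_scalep; apply: supp_varp; exact: only_var.
exact: (supp_zhuY D (V1 _ vy1 isT) (supp_w _) (supp_zhuY D (V1 _ vy isT) (supp_w _) (supp_w _))).
Qed.

Lemma supp_nestl (w1 : C) A B E w : supp_in (only I3) (nestl w1 A B E w).
Proof.
apply: (supp_zhuY (@onlyD I3) _ _ (supp_w _)).
  by apply: (supp_sump (@onlyD I3)); exact: only_var.
move=> e eI; apply: supp_nestl_arg => eI2; apply: eI => i iI; apply: eI2.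
by apply: contra iI; rewrite /I2 /I3 !inE => /orP[] ->; rewrite ?orbT.
Qed.

Definition nestl_coef (w1 : C) (n n' : int) A B E w (i m : nat) : V :=
  (binc (m%:R - 1 - n%:~R : C) m * (w1 ^ (- n' - 1) * sgn C (- (m + i)%N%:Z - 1))) *:
     Z (Z B n' (Z E (m + i)%N%:Z A)) (n - m%:Z) w.

Lemma nestlE (w1 : C) A B E w (a c : int) (i j h : nat) :
  nestl w1 A B E w (ex6 0 0 0 (-1 - i%:R) ((- a - 1)%:~R - j%:R) ((- c - 1)%:~R - h%:R)) =
  \sum_(m \in [set: nat]) nestl_coef w1 (c + h%:Z) (a + j%:Z) A B E w i m.
Proof.
have V1 (z : C) (I : pred 'I_6) i' : I i' -> forall n, supp_in (only I) (scalep z (varp i') n).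
  by move=> Ii; apply: supp_scalep; apply: supp_varp; exact: only_var.
have Zl (s : C) X X' n v : X = s *: X' -> Z X n v = s *: Z X' n v by move=> ->; exact: (bilinZl Z2).
have Zr (s : C) X n v v' : v = s *: v' -> Z X n v = s *: Z X n v' by move=> ->; exact: (bilinZr Z2).
have s1 : supp_in (only I1) (zhuY E%:fs (scalep (-1) (varp vy)) A%:fs).
  exact: (supp_zhuY (@onlyD _) (V1 _ _ vy isT) (supp_w _) (supp_w _)).
rewrite /nestl -[sump vy2 1 vy]scalep1 (@zhuY_sumpr _ _ _ _ _ _ _ _ _ (c + h%:Z))//; last 2 first.
- exact: (avoids_only (@supp_nestl_arg _ _ _ _)).
- by rewrite ex6_coord !(intrD, intrN) -pmulrn; ring.
apply: fsum_eq => m; rewrite /nestl_coef exp1rz expr1n mul1r mulr1 -[RHS]scalerA; congr (_ *: _).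
apply: (Zl _ _ _ _ _).
rewrite /nestl_arg (@zhuY_varp _ _ _ _ _ _ _ (a + j%:Z)); last 2 first.
- exact: (avoids_only s1).
- by rewrite !ex6E ex6_coord !(intrD, intrN) -!pmulrn; ring.
rewrite -[RHS]scalerA; congr (_ *: _); apply: (Zr _ _ _ _ _).
rewrite (@zhuY_varp _ _ _ _ _ _ _ (m + i)%N%:Z); last 2 first.
- exact: avoids_fconst.
- by rewrite !ex6E ex6_coord !(intrD, intrN) -!pmulrn natrD; ring.
congr (_ *: Z _ _ _); apply: fconst0.
by rewrite !ex6E -ex60 !(intrD, intrN) -!pmulrn natrD; congr ex6; ring.
Qed.

Definition nestl_sum (t w1 beta : C) A B E w (a c : int) (N : nat) : V :=
  \sum_(i < N) \sum_(j < N) \sum_(h < N) (ps_exp t i * ps_exp (- t * beta) j * ps_exp t h) *: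
    \sum_(m < N) nestl_coef w1 (c + h%:Z) (a + j%:Z) A B E w i m.

Lemma nestl_term (z w1 beta : C) A B E v (a c k l : int) x :
  exists N0 : nat, forall N : nat, (N0 <= N)%N ->
  fscale (delta (scalep z (expquotp p (linexp (-1) beta (-1))))) (homY (nestl w1 A B E v) vx2 x%:fs)
    (ex6 0 (- (k%:~R / p%:R)) (- (l%:~R / p%:R)) (-1) (- a - 1)%:~R (- c - 1)%:~R) =
  z ^ (- k) *: xmode (k + l) (nestl_sum (k%:~R / p%:R) w1 beta A B E v a c N) x.
Proof.
have [N1 HN1] := ytrunc E A.
have [N2 HN2] := @bound_all N1 (fun q j => Z B (a + j%:Z) (Z E q A) = 0)
  (fun q => trunc_nat (@zhu_trunc C V) B (Z E q A) a).
have HN2' (q j : nat) : (N1 <= q)%N || (N2 <= j)%N -> Z B (a + j%:Z) (Z E q A) = 0.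
  by have [/HN1 ->|qN jN] := leqP N1 q; [rewrite (bilin0r Z2)|exact: HN2].
(* The bounds are nested: each one is uniform over the finitely many inner modes left nonzero by the
   preceding ones. *)
have [N3 HN3] := @bound_all N1 (fun q h => forall j : nat, (j < N2)%N ->
     Z (Z B (a + j%:Z) (Z E q A)) (c + h%:Z) v = 0) (fun q =>
  let: ex_intro N HN := @bound_all N2 (fun j h => Z (Z B (a + j%:Z) (Z E q A)) (c + h%:Z) v = 0)
     (fun j => trunc_nat (@zhu_trunc C V) (Z B (a + j%:Z) (Z E q A)) v c) in
  ex_intro _ N (fun h hN j jN => HN j h jN hN)).
exists (N1 + N2 + N3)%N => N NN; set t : C := k%:~R / p%:R.
(* In the last case [m < N1], so [N1 + N3 <= h] still leaves [h - m] above [N3]. *)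
have coef0 (i j h m : nat) : (N1 <= m + i)%N || (N2 <= j)%N || (N1 + N3 <= h)%N ->
    nestl_coef w1 (c + h%:Z) (a + j%:Z) A B E v i m = 0.
  move=> H; rewrite /nestl_coef.
  have [mi|mi] := leqP N1 (m + i); first by rewrite HN2' ?mi// (bilin0l Z2) scaler0.
  have [jN|jN] := leqP N2 j; first by rewrite HN2' ?jN ?orbT// (bilin0l Z2) scaler0.
  have E' : c + h%:Z - m%:Z = c + (h - m)%N%:Z by lia.
  by rewrite E' HN3 ?scaler0//; lia.
rewrite (@fscale_delta_homY _ _ _ _ _ _ p_gt0 _ _ _ _ _ k l _ _ _ N); last 2 first.
- exact: supp_nestl.
- by move=> i j h ijh; rewrite nestlE fsum_eq0 ?scaler0// => m; rewrite coef0//; lia.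
congr (_ *: xmode _ _ _); apply: eq_bigr => i _; apply: eq_bigr => j _; apply: eq_bigr => h _.
rewrite nestlE (@fsum_ord _ N) => [|m mN]; last by rewrite coef0//; lia.
by rewrite !mulrN1 opprK.
Qed.

End Terms.

Section Matching.
Variables (C : numFieldType) (V : voa C).
Local Notation Z := (@zhu_md C V).
Implicit Types (A B E w : V).
Let Z2 : bilin Z := zhu_bilin V.

Lemma binc_flip (n : int) m : binc (m%:R - 1 - n%:~R : C) m = (-1) ^+ m * binc (n%:~R : C) m.
Proof. by rewrite -(binc_opp n%:~R) mulrC -mulrA -exprD -signr_odd oddD addbb mulr1; congr binc; ring. Qed.

(** Specialises [residue_jacobi] to the modes of [Y[., y]]. What remains is to compare signs, and to
    insert a trivial sum over [j] in the two summands whose exponential does not involve [y1]. *)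
Lemma zhu_residue_jacobi (t : C) A B E w (a c : int) : exists N0 : nat, forall N : nat, (N0 <= N)%N ->
  \sum_(i < N) ps_exp t i *: Z (Z A a B) i (Z E c w) =
  nestr_sum t (-1) (-1) 1 A B E w a c N + nestr_sum t 1 1 0 B A E w a c N
  + nestl_sum t (-1) 1 A B E w a c N + nestl_sum t 1 0 B A E w a c N.
Proof.
have [N0 HN0] := @residue_jacobi C V Z (@zhu_D C V) t Z2 (@zhu_DD C V) (@zhu_DZ C V)
  (@zhu_translation C V) (@zhu_trunc C V) (@zhu_deriv C V) (@zhu_commutator C V)
  (@zhu_skew_bound C V) A B E w a c.
exists N0.+1 => -[//|N] /ltnW /HN0 ->.
have exp0 (h : nat) : (0 < h)%N -> ps_exp (- t * 0 : C) h = 0.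
  by case: h => // h _; rewrite mulr0 ps_exp0 ps1.
have exp00 : ps_exp (- t * 0 : C) 0 = 1 by rewrite mulr0 ps_exp0 ps1.
have j0 (F : nat -> V) : (forall h : nat, (0 < h)%N -> F h = 0) -> \sum_(j < N.+1) F j = F 0%N.
  by move=> F0; rewrite big_ord_recl [X in _ + X]big1 ?addr0// => h _; exact: F0.
congr (_ + _ + _ + _).
- rewrite /nestr_sum mulr1; apply: eq_bigr => i _; apply: eq_bigr => j _.
  congr (_ *: Z _ _ _); apply: eq_bigr => m _; rewrite /nestr_coef; congr (_ *: Z _ _ _).
  rewrite binc_opp -[(-1) ^ _]/(sgn C _) mulrA; congr (_ * _).
  have -> : m%:Z - 1 - (a + j%:Z) = m%:Z + - (a + j%:Z + 1) by lia.
  by rewrite [RHS]sgnD sgn_nat sgnN mulrC.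
- apply: eq_bigr => i _; rewrite [RHS](j0 (fun j => (ps_exp t i * ps_exp (- t * 0) j) *:
    Z E c (\sum_(m < N.+1) nestr_coef 1 1 (a + j%:Z) B A w i m))) => [|h /exp0 ->]; last by rewrite mulr0 scale0r.
  rewrite exp00 mulr1 addr0; congr (_ *: Z _ _ _); apply: eq_bigr => m _.
  by rewrite /nestr_coef exp1rz expr1n mulr1 mul1r binc_flip.
- rewrite /nestl_sum mulr1; apply: eq_bigr => i _; apply: eq_bigr => j _; apply: eq_bigr => h _.
  congr (_ *: _); apply: eq_bigr => m _; rewrite /nestl_coef; congr (_ *: Z _ _ _).
  rewrite binc_flip -[(-1) ^ (- _ - 1)]/(sgn C _).
  rewrite -[- (a + j%:Z) - 1]opprD -[- (m + i)%N%:Z - 1]opprD !sgnN; ring.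
- apply: eq_bigr => i _; rewrite [RHS](j0 (fun j => \sum_(h < N.+1)
    (ps_exp t i * ps_exp (- t * 0) j * ps_exp t h) *:
    \sum_(m < N.+1) nestl_coef 1 (c + h%:Z) (a + j%:Z) B A E w i m)) => [|h /exp0 E0]; last first.
    by apply: big1 => h' _; rewrite E0 mulr0 mul0r scale0r.
  apply: eq_bigr => h _; rewrite exp00 mulr1 addr0; congr (_ *: _); apply: eq_bigr => m _.
  rewrite /nestl_coef binc_flip exp1rz mul1r -[- (m + i)%N%:Z - 1]opprD !sgnN; congr (_ *: Z _ _ _).
  by rewrite mulrC.
Qed.

End Matching.

Section Bracket.
Variables (C : numFieldType) (V : voa C) (nu : automorphism V) (p : nat) (zeta : C).
Variable M : twisted_module nu p zeta.
Hypothesis p_gt0 : (0 < p)%N.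
Local Notation Z := (@zhu_md C V).
Implicit Types (u v : V) (x : M).

Lemma zhuY_const_coef u v i (a : int) : zhuY u%:fs (varp i) v%:fs ((- a - 1)%:~R *: delta_mx 0 i) = Z u a v.
Proof.
rewrite -[varp i]scalep1 (@zhuY_varp _ _ _ _ _ _ _ a); last 2 first.
- exact: avoids_fconst.
- by rewrite delta_coord eqxx.
rewrite exp1rz scale1r; congr (Z _ _ _); apply: fconst0.
by rewrite -scalerDl -intrD -opprD addNr scale0r.
Qed.

Lemma supp_zhuY_const (P : expo -> Prop) u v i : (forall d e, P d -> P e -> P (d + e)) -> P 0 ->
  (forall n : int, P (n%:~R *: delta_mx 0 i)) -> supp_in P (zhuY u%:fs (varp i) v%:fs).
Proof.
by move=> PD P0 Pi; apply: supp_zhuY => //; [exact: supp_varp|exact: supp_fconst|exact: supp_fconst].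
Qed.

Lemma homY_zhuY_coef i yi j yj u v u' v' (k l a c : int) x : uniq [:: i; yi; j; yj] ->
  homY (zhuY u%:fs (varp yi) v%:fs) i (homY (zhuY u'%:fs (varp yj) v'%:fs) j x%:fs)
    (((- (k%:~R / p%:R)) *: delta_mx 0 i + (- a - 1)%:~R *: delta_mx 0 yi) +
     ((- (l%:~R / p%:R)) *: delta_mx 0 j + (- c - 1)%:~R *: delta_mx 0 yj)) =
  xmode k (Z u a v) (xmode l (Z u' c v') x).
Proof.
rewrite /= !inE !negb_or !andbT => /and3P[/and3P[iyi ij iyj] /andP[yij yiyj] jyj].
have s1 (w w' : V) i' : supp_in (only (pred1 i')) (zhuY w%:fs (varp i') w'%:fs).
  apply: supp_zhuY_const; [exact: onlyD|exact: only0|move=> n; apply: only_delta; exact: eqxx].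
have cancel_delta (q r : rat) i' j' : - q *: delta_mx 0 i' + r *: delta_mx 0 j' + q *: delta_mx 0 i' = r *: delta_mx 0 j' :> expo.
  by rewrite addrAC scaleNr addNr add0r.
rewrite (@homY_disjoint _ _ _ _ _ _ p_gt0 _ (pred1 yi) (predU (pred1 j) (pred1 yj)) _ _ _ _ k).
- rewrite cancel_delta zhuY_const_coef; congr (xmode _ _ _).
  rewrite (@homY_const _ _ _ _ _ _ p_gt0 _ _ _ l).
  + by rewrite cancel_delta zhuY_const_coef.
  + exact: avoids_only (s1 _ _ _) jyj.
  + by rewrite !(expoD, delta_coord) eqxx eq_sym (negPf jyj) addr0.
- exact: s1.
- apply: supp_homY; first exact: onlyD.
  + by move=> n; apply: only_delta; rewrite /= eqxx.
  + by move=> n; apply: only_delta; rewrite /= eqxx.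
  + by move=> e eJ; apply: s1 => H; apply: eJ => j'; rewrite /= negb_or => /andP[_ /H].
  + by apply: supp_fconst; exact: only0.
- exact: iyi.
- by rewrite /= negb_or ij iyj.
- by move=> _ /eqP ->; rewrite /= negb_or yij yiyj.
- rewrite !(expoD, delta_coord) eqxx [yi == i]eq_sym (negPf iyi) addr0.
  rewrite addrAC subrr add0r; apply: only_delta; exact: eqxx.
- apply: onlyD; apply: only_delta; rewrite /= eqxx ?orbT//.
- by rewrite !(expoD, delta_coord) eqxx [yi == i]eq_sym (negPf iyi) addr0.
Qed.

End Bracket.

(** * Comparison of all coefficients *)

Section Identity.
Variables (C : numFieldType) (V : voa C) (nu : automorphism V) (p : nat) (zeta : C).
Variable M : twisted_module nu p zeta.
Hypothesis p_gt0 : (0 < p)%N.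
Hypothesis zeta_p : zeta ^+ p = 1.
Hypothesis nu_p : forall v : V, iter p nu v = v.
Variables (u1 v1 u2 v2 : V) (x : M).
Local Notation Z := (@zhu_md C V).
Local Notation nuV r v := (iter r (aut_inv nu) v).

Local Notation D r a b c := (delta (scalep (zeta ^- r) (expquotp p (linexp a b c)))).

Definition commutator_summand (r : nat) : fser M :=
  fscale (D r (-1) 1 0) (homY (nestr (-1) (-1) (nuV r u1) (nuV r v1) u2 v2) vx2 x%:fs)
  + fscale (D r (-1) 0 0) (homY (nestr 1 1 (nuV r v1) (nuV r u1) u2 v2) vx2 x%:fs)
  + fscale (D r (-1) 1 (-1)) (homY (nestl (-1) (nuV r u1) (nuV r v1) u2 v2) vx2 x%:fs)
  + fscale (D r (-1) 0 (-1)) (homY (nestl 1 (nuV r v1) (nuV r u1) u2 v2) vx2 x%:fs).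

Let commutator_summand_coef (k l a c : int) : exists N0 : nat, forall r N : nat, (r < p)%N -> (N0 <= N)%N ->
  commutator_summand r (ex6 0 (- (k%:~R / p%:R)) (- (l%:~R / p%:R)) (-1) (- a - 1)%:~R (- c - 1)%:~R) =
  (zeta ^- r) ^ (- k) *: xmode (k + l)
    (\sum_(i < N) ps_exp (k%:~R / p%:R) i *: Z (nuV r (Z u1 a v1)) i (Z u2 c v2)) x.
Proof.
apply: bound_all => r.
have [N1 H1] := nestr_term p_gt0 (zeta ^- r) (-1) (-1) 1 (nuV r u1) (nuV r v1) u2 v2 a c k l x.
have [N2 H2] := nestr_term p_gt0 (zeta ^- r) 1 1 0 (nuV r v1) (nuV r u1) u2 v2 a c k l x.
have [N3 H3] := nestl_term p_gt0 (zeta ^- r) (-1) 1 (nuV r u1) (nuV r v1) u2 v2 a c k l x.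
have [N4 H4] := nestl_term p_gt0 (zeta ^- r) 1 0 (nuV r v1) (nuV r u1) u2 v2 a c k l x.
have [N5 H5] := zhu_residue_jacobi (k%:~R / p%:R) (nuV r u1) (nuV r v1) u2 v2 a c.
exists (N1 + N2 + N3 + N4 + N5)%N => N NN.
rewrite aut_inv_zhu H5 ?xmodeDl ?scalerDr; last by lia.
have addE (f g : fser M) e : (f + g) e = f e + g e by [].
rewrite /commutator_summand !addE; congr (_ + _ + _ + _); [apply: H1|apply: H2|apply: H3|apply: H4]; lia.
Qed.

(** Both sides of the theorem are supported here, and on this set every exponent vector without [y]
    is indexed by modes [k], [l], [a], [c], so that the coefficient lemmas apply. *)
Let lattice (e : expo) : Prop := exists k l s a c : int,
  e = ex6 0 (k%:~R / p%:R) (l%:~R / p%:R) s%:~R a%:~R c%:~R.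

Let latticeD d e : lattice d -> lattice e -> lattice (d + e).
Proof.
move=> [k [l [s [a [c ->]]]]] [k' [l' [s' [a' [c' ->]]]]].
exists (k + k'), (l + l'), (s + s'), (a + a'), (c + c').
by rewrite !ex6E !intrD !mulrDl addr0.
Qed.

Let lattice0 : lattice 0.
Proof. by exists 0, 0, 0, 0, 0; rewrite !mul0r ex60. Qed.

Let p0 : p%:R != 0 :> rat. Proof. by rewrite pnatr_eq0 -lt0n. Qed.

Let lattice_x i (n : int) : i \in [:: vx1; vx2] -> lattice ((n%:~R / p%:R) *: delta_mx 0 i).
Proof.
rewrite !inE => /orP[] /eqP ->; rewrite ex6E.
  by exists n, 0, 0, 0, 0; rewrite mul0r.
by exists 0, n, 0, 0, 0; rewrite mul0r.
Qed.

Let lattice_var i (n : int) : i != vx0 -> lattice (n%:~R *: delta_mx 0 i).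
Proof.
have [ix|ix i0] := boolP (i \in [:: vx1; vx2]).
  move=> _; rewrite -[n%:~R](mulfK p0) -[X in _ * X / _]/((p%:Z)%:~R) -intrM; exact: lattice_x.
case: i ix i0 => -[|[|[|[|[|[|//]]]]]] // lt_i _ _.
- exists 0, 0, n, 0, 0; rewrite mul0r -delta_vy; congr (_ *: delta_mx _ _); exact: val_inj.
- exists 0, 0, 0, n, 0; rewrite mul0r -delta_vy1; congr (_ *: delta_mx _ _); exact: val_inj.
- exists 0, 0, 0, 0, n; rewrite mul0r -delta_vy2; congr (_ *: delta_mx _ _); exact: val_inj.
Qed.

Let supp_const (w : V) : supp_in lattice w%:fs.
Proof. exact: supp_fconst. Qed.

Let supp_var i : i != vx0 -> forall n, supp_in lattice (varp i n : fser C^o).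
Proof. by move=> i0; apply: supp_varp => n; exact: lattice_var. Qed.

Let supp_hom (s : fser V) i (t : fser M) : i \in [:: vx1; vx2] ->
  supp_in lattice s -> supp_in lattice t -> supp_in lattice (homY s i t).
Proof.
move=> ix; apply: supp_homY => // n; last exact: lattice_x.
by apply: lattice_var; move: ix; rewrite !inE => /orP[] /eqP ->.
Qed.

Let supp_D r b c : supp_in lattice (D r (-1) b c).
Proof.
apply: supp_delta_expquotp => n i j k; exists n, (- n), i, j, k.
by rewrite intrN mulNr -!pmulrn.
Qed.

Let supp_commutator_summand r : supp_in lattice (commutator_summand r).
Proof.
have nr w0 c0 A B : supp_in lattice (nestr w0 c0 A B u2 v2).
  apply: (supp_zhuY latticeD (supp_var _)) => //; apply: (supp_zhuY latticeD) => //.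
    by apply: supp_scalep; apply: (supp_sump latticeD) => n; exact: lattice_var.
  exact: (supp_zhuY latticeD (supp_var _)).
have nl w0 A B : supp_in lattice (nestl w0 A B u2 v2).
  apply: (supp_zhuY latticeD) => //.
    by apply: (supp_sump latticeD) => n; exact: lattice_var.
  apply: (supp_zhuY latticeD) => //; first by apply: supp_scalep; exact: supp_var.
  by apply: (supp_zhuY latticeD) => //; apply: supp_scalep; exact: supp_var.
have x0 : supp_in lattice x%:fs by exact: supp_fconst.
by do 3?apply: supp_add; apply: supp_fscale => //; try exact: supp_D; apply: supp_hom.
Qed.

Theorem homY_commutator :
  let A1 := zhuY u1%:fs (varp vy1) v1%:fs in
  let A2 := zhuY u2%:fs (varp vy2) v2%:fs in
  homY A1 vx1 (homY A2 vx2 x%:fs) - homY A2 vx2 (homY A1 vx1 x%:fs) =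
  fres vy ((p%:R : C)^-1 *: \sum_(r < p) commutator_summand r).
Proof.
move=> A1 A2; apply/funext => e.
have supp_rhs : supp_in lattice (fres vy ((p%:R : C)^-1 *: \sum_(r < p) commutator_summand r)).
  move=> d nd; rewrite /fres; case: eqP => // _.
  apply: supp_scale; first by apply: supp_sum => r; exact: supp_commutator_summand.
  move=> ld; apply: nd; rewrite -[d](subrK (delta_mx 0 vy)); apply: latticeD => //.
  by rewrite -[delta_mx 0 vy]scale1r; exact: (@lattice_var vy 1).
have supp_A P (w w' : V) i : (forall d e', P d -> P e' -> P (d + e')) -> P 0 ->
    (forall n : int, P (n%:~R *: delta_mx 0 i)) -> supp_in P (zhuY w%:fs (varp i) w'%:fs).
  exact: supp_zhuY_const.
have supp_lhs : supp_in lattice (homY A1 vx1 (homY A2 vx2 x%:fs) - homY A2 vx2 (homY A1 vx1 x%:fs)).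
  have sA (w w' : V) i : i != vx0 -> supp_in lattice (zhuY w%:fs (varp i) w'%:fs).
    by move=> i0; apply: supp_A => // n; exact: lattice_var.
  have sx : supp_in lattice x%:fs by exact: supp_fconst.
  apply: supp_add; [|apply: supp_opp].
    by apply: supp_hom => //; [exact: sA|apply: supp_hom => //; exact: sA].
  by apply: supp_hom => //; [exact: sA|apply: supp_hom => //; exact: sA].
have [le|nle] := pselect (lattice e); last by rewrite supp_lhs// supp_rhs.
(* Neither side involves [y]: the right by definition of [fres], the left because it is built from
   series without [y]. *)
have [ey|ey] := eqVneq (e 0 vy) 0; last first.
  pose P (d : expo) := d 0 vy = 0.
  have PD d e' : P d -> P e' -> P (d + e') by rewrite /P expoD => -> ->; rewrite addr0.
  have P0 : P 0 by rewrite /P mxE.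
  have Pd i q : i != vy -> P (q *: delta_mx 0 i) by rewrite /P delta_coord => /negPf ->.
  have supp_P (w w' : V) i : i != vy -> supp_in P (zhuY w%:fs (varp i) w'%:fs).
    by move=> iy; apply: supp_A => // n; exact: Pd.
  have hom_P i (s : fser V) (t : fser M) : i != vy -> supp_in P s -> supp_in P t -> supp_in P (homY s i t).
    by move=> iy; apply: supp_homY => // n; exact: Pd.
  rewrite /fres (negPf ey); apply: (_ : supp_in P _); last by apply/eqP.
  have sx : supp_in P x%:fs by exact: supp_fconst.
  apply: supp_add; [|apply: supp_opp].
    by apply: (hom_P) => //; [exact: supp_P|apply: (hom_P) => //; exact: supp_P].
  by apply: (hom_P) => //; [exact: supp_P|apply: (hom_P) => //; exact: supp_P].
have {ey le} [k [l [a [c eE]]]] : exists k l a c : int,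
    e = ex6 0 (- (k%:~R / p%:R)) (- (l%:~R / p%:R)) 0 (- a - 1)%:~R (- c - 1)%:~R.
  case: le ey => k [l [s [a [c ->]]]]; rewrite ex6_coord => ->.
  exists (- k), (- l), (- a - 1), (- c - 1).
  by rewrite !intrN !mulNr !opprK; congr ex6; congr (_%:~R); lia.
have e12 : e = ((- (k%:~R / p%:R)) *: delta_mx 0 vx1 + (- a - 1)%:~R *: delta_mx 0 vy1) +
    ((- (l%:~R / p%:R)) *: delta_mx 0 vx2 + (- c - 1)%:~R *: delta_mx 0 vy2).
  by rewrite eE !ex6E; congr ex6; rewrite ?addr0 ?add0r.
have e21 : e = ((- (l%:~R / p%:R)) *: delta_mx 0 vx2 + (- c - 1)%:~R *: delta_mx 0 vy2) +
    ((- (k%:~R / p%:R)) *: delta_mx 0 vx1 + (- a - 1)%:~R *: delta_mx 0 vy1).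
  by rewrite e12 addrC.
rewrite -[LHS]/(homY A1 vx1 (homY A2 vx2 x%:fs) e - homY A2 vx2 (homY A1 vx1 x%:fs) e).
rewrite {1}e12 (@homY_zhuY_coef _ _ _ _ _ _ p_gt0)// {1}e21 (@homY_zhuY_coef _ _ _ _ _ _ p_gt0)//.
have [N1 H1] := xmode_commutator p_gt0 zeta_p nu_p (Z u1 a v1) (Z u2 c v2) k l x.
have [N2 H2] := commutator_summand_coef k l a c.
rewrite (H1 (N1 + N2)%N); last by lia.
(* [fres vy] reads its argument one step lower in [y], at the exponent -1. *)
have -> : e = ex6 0 (- (k%:~R / p%:R)) (- (l%:~R / p%:R)) (-1) (- a - 1)%:~R (- c - 1)%:~R + delta_mx 0 vy.
  by rewrite eE -[delta_mx 0 vy]scale1r !ex6E !addr0 addNr.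
rewrite /fres expoD -[delta_mx 0 vy]scale1r delta_coord ex6_coord addNr eqxx scale1r addrK.
rewrite -[RHS]/(_ *: (\sum_(r < p) commutator_summand r) _); congr (_ *: _).
have -> d : (\sum_(r < p) commutator_summand r) d = \sum_(r < p) commutator_summand r d.
  by apply: (big_morph (fun f : fser M => f d)).
by apply: eq_bigr => r _; rewrite -(H2 r (N1 + N2)%N)//; lia.
Qed.

End Identity.

Local Close Scope classical_set_scope.

Theorem theorem6p1 (R : realType) (V : voa R[i]) (p : nat) (hp : (0 < p)%N)
    (zeta : R[i]) (hzeta : p.-primitive_root zeta)
    (nu : automorphism V) (hnu : forall v : V, iter p nu v = v)
    (M : twisted_module nu p zeta) (u1 v1 u2 v2 : V) (m : M) :
  let nuV (r : nat) (v : V) := (iter r (aut_inv nu) v)%:fs in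
  let D (r : nat) (a : fser R[i]^o) :=
    delta (scalep (zeta ^- r) (expquotp p a)) in
  let A1 := zhuY u1%:fs (varp vy1) v1%:fs in
  let A2 := zhuY u2%:fs (varp vy2) v2%:fs in
  homY A1 vx1 (homY A2 vx2 m%:fs) - homY A2 vx2 (homY A1 vx1 m%:fs) =
  fres vy ((p%:R : R[i])^-1 *: \sum_(r < p)
    ( fscale (D r (mono vy1 1 - mono vy 1))
        (homY (zhuY u2%:fs (varp vy2)
                (zhuY (nuV r v1) (scalep (-1) (sump vy1 (-1) vy))
                  (zhuY (nuV r u1) (varp vy) v2%:fs))) vx2 m%:fs)
    + fscale (D r (- mono vy 1))
        (homY (zhuY u2%:fs (varp vy2)
                (zhuY (nuV r u1) (sump vy1 1 vy)
                  (zhuY (nuV r v1) (varp vy) v2%:fs))) vx2 m%:fs)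
    + fscale (D r (- mono vy2 1 + mono vy1 1 - mono vy 1))
        (homY (zhuY (zhuY (nuV r v1) (scalep (-1) (varp vy1))
                      (zhuY u2%:fs (scalep (-1) (varp vy)) (nuV r u1)))
                 (sump vy2 1 vy) v2%:fs) vx2 m%:fs)
    + fscale (D r (- mono vy2 1 - mono vy 1))
        (homY (zhuY (zhuY (nuV r u1) (varp vy1)
                      (zhuY u2%:fs (scalep (-1) (varp vy)) (nuV r v1)))
                 (sump vy2 1 vy) v2%:fs) vx2 m%:fs))).
Proof.
move=> nuV D A1 A2.
have e1 : linexp (-1) 1 0 = mono vy1 1 - mono vy 1 :> fser R[i]^o.
  by rewrite /linexp scaleN1r scale1r scale0r addr0 addrC.
have e2 : linexp (-1) 0 0 = - mono vy 1 :> fser R[i]^o.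
  by rewrite /linexp scaleN1r !scale0r !addr0.
have e3 : linexp (-1) 1 (-1) = - mono vy2 1 + mono vy1 1 - mono vy 1 :> fser R[i]^o.
  by rewrite /linexp !scaleN1r scale1r addrC [X in _ + X = _]addrC addrA.
have e4 : linexp (-1) 0 (-1) = - mono vy2 1 - mono vy 1 :> fser R[i]^o.
  by rewrite /linexp !scaleN1r scale0r addr0 addrC.
rewrite (homY_commutator hp (prim_expr_order hzeta) hnu) /commutator_summand e1 e2 e3 e4.
by rewrite /nestr /nestl /nestl_arg (scalep1 (sump vy1 1 vy)) (scalep1 (varp vy1)).
Qed.
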